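(* Let $A,B\in\mathbb{R}_{\max}^{m\times n}$ have no rows identically equal to $-\infty$ and no common column identically equal to $-\infty$, and suppose that every entry of $A$ and $B$ is either $-\infty$ or an integer with absolute value bounded by $M$. Denote $\kappa:=\min(2m,n)$. 1. All affine pieces that constitute the spectral function $s(\lambda)$ of $(A,B)$, and hence the spectrum $\mathrm{spec}(A,B)$, can be identified in no more than $\Delta(A,B)\cdot O(\kappa^6)$ calls to the mean-payoff game oracle, whose worst-case complexity (per call) is $\mathrm{MPG}(2m,n,\kappa^2(M+4M\kappa^2))$. In particular, the reconstruction can be done in pseudo-polynomial time. 2. When $A$ and $B$ have no columns identically equal to $-\infty$, the number of calls needed to reconstruct the function $s(\lambda)$ can be decreased to $\Delta(A,B)\cdot O(\kappa^5)$, where each call takes no more than $\mathrm{MPG}(2m,n,\kappa^2(M+4M\kappa))$ operations. When all entries of $A$ and $B$ are real, the number of calls is decreased to $(\overline{C}(A,B)-\underline{C}(A,B))\cdot O(\kappa^4)$, and the complexity of each call to $\mathrm{MPG}(2m,n,3M\kappa^2)$ operations.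
   Context: $\mathbb{R}_{\max}=\mathbb{R}\cup\{-\infty\}$. For $A=(a_{ij})\in\mathbb{R}_{\max}^{m\times n}$ and $x\in\mathbb{R}_{\max}^n$, $(Ax)_i=\max_j(a_{ij}+x_j)$. For $y\in\mathbb{R}_{\max}^m$, $(A^{\sharp}y)_j=\min_{1\le i\le m}(-a_{ij}+y_i)$ with $(-\infty)+(+\infty)=+\infty$. $A^{\sharp}B$ denotes the composition $x\mapsto A^{\sharp}(Bx)$; $\wedge$ is componentwise minimum. For an order-preserving, additively homogeneous map $f$ of $\mathbb{R}_{\max}^n$ to itself, continuous for the metric $\max_i|e^{x_i}-e^{y_i}|$, $r(f)=\max\{\lambda\in\mathbb{R}_{\max}\mid\exists x\in\mathbb{R}_{\max}^n,\ x\not\equiv-\infty,\ \lambda+x=f(x)\}$. For $\lambda\in\mathbb{R}$ let $h_\lambda(x)=(\lambda+A^{\sharp}Bx)\wedge(-\lambda+B^{\sharp}Ax)$; the spectral function is $s(\lambda):=r(h_\lambda)$, a piecewise-affine function of $\lambda\in\mathbb{R}$. $\mathrm{spec}(A,B)$ is the set of $\lambda\in\mathbb{R}$ for which $Ax=\lambda+Bx$ for some $x\in\mathbb{R}_{\max}^n$, $x\not\equiv-\infty$; it equals $\{\lambda: s(\lambda)=0\}$. Further, $$\Delta(A,B)=\max\Big(\max_{i,j,k:\,a_{ij}\ne-\infty,\,b_{ik}\ne-\infty}(a_{ij}-b_{ik}),\ \max_{i,j,k:\,b_{ij}\ne-\infty,\,a_{ik}\ne-\infty}(b_{ij}-a_{ik})\Big),$$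 $$\overline{C}(A,B)=\max_{i,j,k:\,a_{ij}\ne-\infty,\,b_{ik}\ne-\infty}(a_{ij}-b_{ik}),\qquad \underline{C}(A,B)=\min_{i,j,k:\,a_{ik}\ne-\infty,\,b_{ij}\ne-\infty}(a_{ik}-b_{ij}).$$ Mean-payoff game oracle: a procedure which, given matrices $A',B'\in\mathbb{R}_{\max}^{m'\times n'}$ whose entries are $-\infty$ or integers of absolute value at most $M'$, computes $r((A')^{\sharp}B')$. Equivalently, it computes the greatest value, over starting nodes of player Min, of the zero-sum deterministic mean-payoff game with $m'$ nodes of Max and $n'$ nodes of Min, in which from node $j$ of Min she moves to a node $i$ of Max with $a'_{ij}\neq-\infty$, paying him $-a'_{ij}$, and from $i$ Max moves to a node $k$ of Min with $b'_{ik}\ne-\infty$, receiving $b'_{ik}$, the payoff being the average payment per turn (a pair of consecutive moves). $\mathrm{MPG}(m',n',M')$ denotes the worst-case execution time of the oracle on such inputs; it is known (Zwick–Paterson) that there is an oracle for which $\mathrm{MPG}(m',n',M')$ is pseudo-polynomial. The value $s(\lambda)$ equals $r$ of the operator $\begin{pmatrix}A\\ \lambda+B\end{pmatrix}^{\sharp}\begin{pmatrix}\lambda+B\\ A\end{pmatrix}$, a game with $2m$ nodes of Max and $n$ nodes of Min. $O(\cdot)$ constants are absolute. *)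

(* Defs.v *)
(* MathComp / MathComp-Analysis *)
From Stdlib Require List.
From mathcomp Require Import all_boot all_order all_algebra.
From mathcomp Require Import all_classical all_reals ereal.
Set Implicit Arguments.
Unset Strict Implicit.
Unset Printing Implicit Defensive.
Import Order.TTheory GRing.Theory Num.Theory.

Local Open Scope classical_set_scope.
Local Open Scope ring_scope.

(** * Max-plus algebra

    R_max is the part of [\bar R] below [+oo]; [+oo] only shows up as an
    intermediate value of [sharp]. *)
Section MaxPlus.
Variable R : realType.
Local Open Scope ereal_scope.

Definition in_Rmax (x : \bar R) : Prop := x != +oo.

Definition nonbottom_vec n (x : 'I_n -> \bar R) : Prop :=
  (forall j, in_Rmax (x j)) /\ exists j, x j != -oo.

Definition mpmul m n (A : 'M[\bar R]_(m, n)) (x : 'I_n -> \bar R) :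
    'I_m -> \bar R :=
  fun i => \big[maxe/-oo]_(j < n) (A i j + x j).

(* The dual addition is the one with (-oo) + (+oo) = +oo. *)
Definition sharp m n (A : 'M[\bar R]_(m, n)) (y : 'I_m -> \bar R) :
    'I_n -> \bar R :=
  fun j => \big[mine/+oo]_(i < m) (- A i j + y i)%dE.

Definition sharp_comp m n (A B : 'M[\bar R]_(m, n)) (x : 'I_n -> \bar R) :=
  sharp A (mpmul B x).

Definition eigenvalues n (f : ('I_n -> \bar R) -> 'I_n -> \bar R) :
    set (\bar R) :=
  [set l | in_Rmax l /\
     exists2 x, nonbottom_vec x & forall j, l + x j = f x j].

(* [is_r f rho]: the maximum r(f) exists and equals [rho]. *)
Definition is_r n (f : ('I_n -> \bar R) -> 'I_n -> \bar R) (rho : \bar R) :=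
  eigenvalues f rho /\ forall l, eigenvalues f l -> l <= rho.

Definition hmap m n (A B : 'M[\bar R]_(m, n)) (lam : R)
    (x : 'I_n -> \bar R) : 'I_n -> \bar R :=
  fun j => mine (lam%:E + sharp_comp A B x j) ((- lam)%:E + sharp_comp B A x j).

Definition is_spectral_value m n (A B : 'M[\bar R]_(m, n)) (lam : R)
    (v : \bar R) : Prop :=
  is_r (hmap A B lam) v.

Definition spec m n (A B : 'M[\bar R]_(m, n)) : set R :=
  [set lam | exists2 x, nonbottom_vec x &
     forall i, mpmul A x i = lam%:E + mpmul B x i].

Definition Cup m n (A B : 'M[\bar R]_(m, n)) : \bar R :=
  \big[maxe/-oo]_(i < m) \big[maxe/-oo]_(j < n)
    \big[maxe/-oo]_(k < n | (A i j != -oo) && (B i k != -oo)) (A i j - B i k).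

Definition Clow m n (A B : 'M[\bar R]_(m, n)) : \bar R :=
  \big[mine/+oo]_(i < m) \big[mine/+oo]_(j < n)
    \big[mine/+oo]_(k < n | (A i k != -oo) && (B i j != -oo)) (A i k - B i j).

Definition Delta m n (A B : 'M[\bar R]_(m, n)) : \bar R :=
  maxe (Cup A B) (Cup B A).

End MaxPlus.

(** * Matrices whose entries are integers or -oo (encoded by [None]) *)

Definition entry_real (R : realType) (a : option int) : \bar R :=
  if a is Some z then (z%:~R : R)%:E else -oo%E.

Definition mx_real (R : realType) m n (A : 'M[option int]_(m, n)) :
    'M[\bar R]_(m, n) :=
  map_mx (@entry_real R) A.

Definition bounded_by m n (M : nat) (A : 'M[option int]_(m, n)) : Prop :=
  forall i j z, A i j = Some z -> (`|z|%N <= M)%N.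

Definition no_bottom_row m n (A : 'M[option int]_(m, n)) : Prop :=
  forall i, exists j, A i j != None.

Definition no_bottom_col m n (A : 'M[option int]_(m, n)) : Prop :=
  forall j, exists i, A i j != None.

Definition no_common_bottom_col m n (A B : 'M[option int]_(m, n)) : Prop :=
  forall j, exists i, (A i j != None) || (B i j != None).

Definition all_finite m n (A : 'M[option int]_(m, n)) : Prop :=
  forall i j, A i j != None.

(** * Mean-payoff game oracles *)

Record game := Game {
  rows : nat;
  cols : nat;
  gameA : 'M[option int]_(rows, cols);
  gameB : 'M[option int]_(rows, cols) }.

(* Each player has a move at each of her or his nodes; then
   [gameA]^sharp [gameB] is a self-map of R_max^cols, and its [r] is the
   greatest value of the game. *)
Definition well_posed (g : game) : Prop :=
  [/\ (0 < cols g)%N, no_bottom_col (gameA g) & no_bottom_row (gameB g)].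

Definition games (m n M : nat) : set game :=
  [set g | [/\ rows g = m, cols g = n, well_posed g,
               bounded_by M (gameA g) & bounded_by M (gameB g)]].

(* Mean payoffs of games with integer payments are rational. *)
Record oracle := Oracle {
  answer : game -> rat;
  time : game -> nat }.

Definition oracle_correct (R : realType) (O : oracle) : Prop :=
  forall g, well_posed g ->
    is_r (sharp_comp (mx_real R (gameA g)) (mx_real R (gameB g)))
         (ratr (answer O g))%:E.

Definition MPG (R : realType) (O : oracle) (m n M : nat) : \bar R :=
  ereal_sup [set ((time O g)%:R : R)%:E | g in games m n M].

Definition pseudo_polynomial (R : realType) (O : oracle) : Prop :=
  exists c d : nat, forall m n M : nat,
    (MPG R O m n M <= ((c * (m + n + M).+1 ^ d)%N%:R : R)%:E)%E.

(** * Oracle programs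

    A while-language over integer registers and integer arrays, under the
    logarithmic cost criterion: each subexpression evaluated is charged the
    binary length of its value. *)

Inductive binop := OAdd | OSub | OMul | ODiv | OLe.

Inductive expr :=
  | ECst of int
  | EReg of nat
  | EArr of nat & expr
  | EOp of binop & expr & expr.

Inductive cmd :=
  | CSkip
  | CSet of nat & expr
  | CPut of nat & expr & expr
  | CSeq of cmd & cmd
  | CIf of expr & cmd & cmd
  | CWhile of expr & cmd
  | CCall of expr & expr & nat & nat & nat & nat.

Record state := State { reg : nat -> int; arr : nat -> int -> int }.

Definition set_reg (s : state) (x : nat) (v : int) : state :=
  State (fun y => if y == x then v else reg s y) (arr s).

Definition set_arr (s : state) (a : nat) (k v : int) : state :=
  State (reg s)
    (fun b l => if (b == a) && (l == k) then v else arr s b l).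

Definition eval_op (o : binop) (u v : int) : int :=
  match o with
  | OAdd => u + v
  | OSub => u - v
  | OMul => u * v
  | ODiv => (u %/ v)%Z
  | OLe => if u <= v then 1 else 0
  end.

Fixpoint eval (s : state) (e : expr) : int :=
  match e with
  | ECst z => z
  | EReg x => reg s x
  | EArr a e1 => arr s a (eval s e1)
  | EOp o e1 e2 => eval_op o (eval s e1) (eval s e2)
  end.

Definition bitlen (z : int) : nat := (trunc_log 2 `|z|%N).+1.

Fixpoint cost (s : state) (e : expr) : nat :=
  (bitlen (eval s e) +
   match e with
   | ECst _ | EReg _ => 0
   | EArr _ e1 => cost s e1
   | EOp _ e1 e2 => cost s e1 + cost s e2
   end)%N.

(* Matrices are stored row by row, two cells per entry: a flag, which is zero
   for -oo, followed by the integer value. *)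
Definition read_entry (f : int -> int) (p : nat) : option int :=
  if f (2 * p)%N == 0 then None else Some (f (2 * p).+1).

Definition read_mx (f : int -> int) (m n : nat) : 'M[option int]_(m, n) :=
  \matrix_(i < m, j < n) read_entry f (i * n + j)%N.

Definition write_mx m n (A : 'M[option int]_(m, n)) (z : int) : int :=
  if z is Posz c then
    match insub (c./2 %/ n)%N, insub (c./2 %% n)%N with
    | Some i, Some j =>
        if A i j is Some v then (if odd c then v else 1) else 0
    | _, _ => 0
    end
  else 0.

Definition query (s : state) (em en : expr) (a b : nat) : game :=
  let m := `|eval s em|%N in
  let n := `|eval s en|%N in
  Game (read_mx (arr s a) m n) (read_mx (arr s b) m n).

(* [exec O c s s' tr w]: from [s], [c] terminates in [s'] after submitting the
   successive queries [tr], the cost of everything but the oracle being [w].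
   [CCall em en a b x y] stores the numerator and the denominator of the answer
   in registers [x] and [y]. *)
Inductive exec (O : oracle) :
    cmd -> state -> state -> seq game -> nat -> Prop :=
  | exec_skip s : exec O CSkip s s [::] 1
  | exec_set s x e :
      exec O (CSet x e) s (set_reg s x (eval s e)) [::] (cost s e).+1
  | exec_put s a e1 e2 :
      exec O (CPut a e1 e2) s (set_arr s a (eval s e1) (eval s e2)) [::]
        (cost s e1 + cost s e2).+1
  | exec_seq c1 c2 s1 s2 s3 tr1 tr2 w1 w2 :
      exec O c1 s1 s2 tr1 w1 -> exec O c2 s2 s3 tr2 w2 ->
      exec O (CSeq c1 c2) s1 s3 (tr1 ++ tr2) (w1 + w2).+1
  | exec_if s e c1 c2 s' tr w :
      exec O (if eval s e != 0 then c1 else c2) s s' tr w ->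
      exec O (CIf e c1 c2) s s' tr (cost s e + w).+1
  | exec_while_stop s e c :
      eval s e = 0 -> exec O (CWhile e c) s s [::] (cost s e).+1
  | exec_while_loop s1 s2 s3 e c tr1 tr2 w1 w2 :
      eval s1 e != 0 -> exec O c s1 s2 tr1 w1 ->
      exec O (CWhile e c) s2 s3 tr2 w2 ->
      exec O (CWhile e c) s1 s3 (tr1 ++ tr2) (cost s1 e + w1 + w2).+1
  | exec_call s em en a b x y :
      let g := query s em en a b in
      let num := numq (answer O g) in
      let den := denq (answer O g) in
      exec O (CCall em en a b x y) s (set_reg (set_reg s x num) y den) [:: g]
        (cost s em + cost s en + bitlen num + bitlen den).+1.

Definition input m n (A B : 'M[option int]_(m, n)) : state :=
  State (fun x => nth 0 [:: Posz m; Posz n] x)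
    (fun a => match a with
              | 0%N => write_mx A
              | 1%N => write_mx B
              | _ => fun=> 0
              end).

(** * Piecewise-affine functions with rational data

    [cuts] lists the points separating consecutive pieces; the pieces are given
    by slope and intercept. *)

Record pwa := Pwa { cuts : seq rat; pieces : seq (rat * rat) }.

Definition on_piece (R : realType) (p : pwa) (i : nat) (x : R) : Prop :=
  [/\ (i <= size (cuts p))%N,
      (0 < i)%N -> ratr (nth 0 (cuts p) i.-1) <= x &
      (i < size (cuts p))%N -> x <= ratr (nth 0 (cuts p) i)].

Definition piece_at (R : realType) (p : pwa) (i : nat) (x : R) : R :=
  let sc := nth (0, 0) (pieces p) i in ratr sc.1 * x + ratr sc.2.

(* The pieces of [p] are exactly the maximal affine pieces of the spectral
   function, and the zero set of [p] is the spectrum. *)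
Definition identifies (R : realType) m n (A B : 'M[\bar R]_(m, n)) (p : pwa) :
    Prop :=
  [/\ size (pieces p) = (size (cuts p)).+1,
      sorted <%R (cuts p),
      forall i, (i < size (cuts p))%N ->
        nth (0, 0) (pieces p) i != nth (0, 0) (pieces p) i.+1,
      forall i lam, on_piece p i lam ->
        is_spectral_value A B lam (piece_at p i lam)%:E &
      spec A B = [set lam | exists2 i, on_piece p i lam
                                     & piece_at p i lam = 0]].

Definition read_rat (f : int -> int) (k : nat) : rat :=
  (f (2 * k)%N)%:~R / (f (2 * k).+1)%:~R.

(* Register 0 holds the number of cuts; arrays 0 and 1 hold the fractions. *)
Definition output (s : state) : pwa :=
  let k := `|reg s 0|%N in
  Pwa (mkseq (read_rat (arr s 0)) k)
      (mkseq (fun i => (read_rat (arr s 1) (2 * i)%N,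
                        read_rat (arr s 1) (2 * i).+1)) k.+1).

(** * Resources of a reconstruction *)

Definition total_time (O : oracle) (tr : seq game) (w : nat) : nat :=
  (w + \sum_(g <- tr) time O g)%N.

(* [prog] reconstructs the spectral function of (A, B) within [N] calls, each
   on a game with 2m nodes of Max, n nodes of Min and payments bounded by [M'],
   and with at most [W] operations per call besides those of the oracle (plus
   [W] overall). *)
Definition reconstructs_within (R : realType) (O : oracle) (prog : cmd)
    m n (A B : 'M[option int]_(m, n)) (N : \bar R) (M' W : nat) : Prop :=
  exists st tr w,
    [/\ exec O prog (input A B) st tr w,
        identifies (mx_real R A) (mx_real R B) (output st),
        (((size tr)%:R : R)%:E <= N)%E,
        List.Forall (fun g => games (2 * m) n M' g /\
          (((time O g)%:R : R)%:E <= MPG R O (2 * m) n M')%E) tr &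
        (w <= W * (size tr).+1)%N].

Definition reconstructs_in_time (R : realType) (O : oracle) (prog : cmd)
    m n (A B : 'M[option int]_(m, n)) (T : nat) : Prop :=
  exists st tr w,
    [/\ exec O prog (input A B) st tr w,
        identifies (mx_real R A) (mx_real R B) (output st) &
        (total_time O tr w <= T)%N].

Definition admissible m n (M : nat) (A B : 'M[option int]_(m, n)) : Prop :=
  [/\ (0 < m)%N, (0 < n)%N, no_bottom_row A /\ no_bottom_row B,
      no_common_bottom_col A B & bounded_by M A /\ bounded_by M B].

(* Main.v *)
(* At every [lam] the spectral function [s] is the value of a deterministic game,
   for which positional strategies give [l s(lam) = a + (l - 2 u) lam] with
   integers [0 < l <= k] and [u <= l]. Two such lines meet at a point [N / (2 t)]
   with [t <= k ^ 2]; as [s] is 1-Lipschitz, it is affine between consecutive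
   points of this form. Bounds on [a] show that [s] is also affine beyond
   [Delta k ^ 2] (beyond [Delta k] when no column is -oo, and outside
   [Clow .. Cup] when all entries are finite). The program visits the points in
   increasing order, with one query at each of them, and merges the pieces of
   equal slope. A query at [N / (2 t)] needs integer payments: they are
   multiplied by [t], and the shift by [N / 2] is distributed over the four
   blocks of the doubled matrices as [N = N1 + N2 + N3 + N4] with
   [Ni = floor ((N + i - 1) / 4)].

   When all the differences [a_ij - b_ik] are equal to some [c], the budget can be
   zero calls. Then [s] is positively homogeneous around [c], and the two values
   [s (c + 1)] and [s (c - 1)] come from value iteration: they are fractions of
   denominator at most [k], so that a close approximation determines them. *)
Require Import Defs.
From mathcomp Require Import all_boot all_order all_algebra.
From mathcomp Require Import all_classical all_reals ereal.
From mathcomp Require Import zify ring lra.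
Set Implicit Arguments.
Unset Strict Implicit.
Unset Printing Implicit Defensive.
Import Order.TTheory GRing.Theory Num.Theory.
Local Open Scope classical_set_scope.
Local Open Scope ring_scope.
Local Notation eval := Defs.eval.

(** Every property of values rests on certificates over the reals. A subcertificate lives on a set
    of nodes in which Max can keep the play, a supercertificate is finite everywhere, and comparing
    the two orders their values; properties of [s] are proved by carrying certificates from one game
    to another. An exact pair at [rho] also yields the eigenvector, hence [r].

    The shift is split into four parts for two reasons. Odd [N] need no doubling of the payments,
    since the floors misstate the shift by the same amount in all rows, and this amount is
    subtracted from the answer. Each entry carries only a quarter of [N], which keeps the payments
    within [3 M k ^ 2] in the finite case.

    A range of length [L] is met by about [L k ^ 4] fractions, counted with multiplicity; [L] of
    order [Delta k ^ 2], [Delta k] or [Cup - Clow] gives the three budgets. As for costs, every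
    register stays below a fixed power of one number [Y] polynomial in [m + n + M], so an operation
    is charged [O(log Y)], and the work per call outside the oracle is polynomial in [m], [n] and
    [log M]. *)

Lemma finite_max (R : realType) (T : finType) (P : T -> Prop) (F : T -> R) :
  (exists i, P i) -> exists i, P i /\ forall j, P j -> F j <= F i.
Proof.
case=> i0 Pi0; have Pi0' : [pred i | `[< P i >]] i0 by rewrite /= asboolT.
case: (@arg_maxP _ R T i0 [pred i | `[< P i >]] F Pi0') => i /asboolP Pi Hi.
by exists i; split=> // j Pj; apply: Hi; rewrite /= asboolT.
Qed.

Lemma finite_min (R : realType) (T : finType) (P : T -> Prop) (F : T -> R) :
  (exists i, P i) -> exists i, P i /\ forall j, P j -> F i <= F j.
Proof.
move=> exP; have [i [Pi Hi]] := finite_max (fun i => - F i) exP.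
by exists i; split=> // j /Hi; rewrite lerN2.
Qed.

Lemma finite_ub (R : realType) (T : finType) (F : T -> R) :
  exists2 C, 0 <= C & forall i, F i <= C.
Proof.
exists (\sum_i `|F i|); first by apply: sumr_ge0.
move=> i; apply: le_trans (ler_norm _) _.
by rewrite (bigD1 i) //= lerDl sumr_ge0.
Qed.

(** Compactness over a finite index set: thresholds that exist pointwise become a single one. It
    replaces limit arguments on strategies and replies. *)
Lemma finite_nat_ub (T : finType) (P : T -> nat -> Prop) :
  (forall i N N', (N <= N')%N -> P i N -> P i N') ->
  (forall i, exists N, P i N) -> exists N, forall i, P i N.
Proof.
move=> mono /choice[N HN]; exists (\max_i N i)%N => i.
by apply: mono (HN i); apply: leq_bigmax.
Qed.

(** * Potentials *)

Section Potentials.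
Variables (R : realType) (J : finType) (e : rel J) (c : J -> J -> R).

Fixpoint walk_weight (j : J) (p : seq J) : R :=
  if p is k :: p' then c j k + walk_weight k p' else 0.

Lemma walk_weight_cat j p q :
  walk_weight j (p ++ q) = walk_weight j p + walk_weight (last j p) q.
Proof. by elim: p j => [|k p IH] j /=; rewrite ?add0r // IH addrA. Qed.

Lemma walk_weight_le (C : R) j p : 0 <= C ->
  (forall j k, e j k -> c j k <= C) -> path e j p ->
  walk_weight j p <= (size p)%:R * C.
Proof.
move=> C0 Hc; elim: p j => [|k p IH] j /=; first by rewrite mul0r.
case/andP=> /Hc jk /IH; rewrite -[(size p).+1]add1n natrD mulrDl mul1r.
exact: lerD.
Qed.

Lemma walk_weight_potential (d : R) (y : J -> R) j p :
  (forall j k, e j k -> c j k + y k <= d + y j) -> path e j p ->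
  walk_weight j p + y (last j p) <= (size p)%:R * d + y j.
Proof.
move=> Hy; elim: p j => [|k p IH] j /=; first by rewrite mul0r.
case/andP=> /Hy jk /IH; rewrite -[(size p).+1]add1n natrD mulrDl mul1r.
lra.
Qed.

(** Along a closed walk the potentials telescope, so its weight is bounded by an arbitrarily small
    multiple of its length. *)
Lemma closed_walk_le0 j p :
  (forall eps : R, 0 < eps -> exists y : J -> R,
     forall j k, e j k -> c j k + y k <= eps + y j) ->
  path e j p -> last j p = j -> walk_weight j p <= 0.
Proof.
move=> feas pj lp; apply/ler_addgt0Pr => eps eps0; rewrite add0r.
have d0 : 0 < eps / (size p).+1%:R by rewrite divr_gt0 ?ltr0n.
have [y Hy] := feas _ d0.
have := walk_weight_potential Hy pj; rewrite lp lerD2r => /le_trans; apply.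
by rewrite mulrA ler_pdivrMr ?ltr0n // mulrC ler_pM2l // ler_nat.
Qed.

(** Potentials that are only approximate, and may blow up as [eps] tends to [0], still rule out
    cycles of positive weight. The largest weight of a simple path from [j] is then an exact
    potential, with a bound that depends only on [C] and the number of nodes. *)
Lemma potential_exists (C : R) : 0 <= C ->
  (forall j k, e j k -> c j k <= C) ->
  (forall eps : R, 0 < eps -> exists y : J -> R,
     forall j k, e j k -> c j k + y k <= eps + y j) ->
  exists y : J -> R, (forall j k, e j k -> c j k + y k <= y j) /\
    forall j, 0 <= y j <= #|J|%:R * C.
Proof.
move=> C0 HC feas.
pose D j : set R := [set walk_weight j p | p in
                       [set p : seq J | path e j p /\ uniq (j :: p)]].
have D0 j : D j 0 by exists [::].
have Dub j : ubound (D j) (#|J|%:R * C).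
  move=> _ [p [pj up] <-]; apply: le_trans (walk_weight_le C0 HC pj) _.
  rewrite ler_wpM2r // ler_nat; have := max_card (mem (j :: p)).
  by rewrite (card_uniqP up) /= => /ltnW.
have Dsup j r : D j r -> r <= sup (D j).
  by move=> Dr; apply: ub_le_sup => //; exists (#|J|%:R * C).
exists (fun j => sup (D j)); split; last first.
  by move=> j; rewrite Dsup //=; apply: ge_sup => //; exists 0.
move=> j k ejk; rewrite -lerBrDl; apply: ge_sup; first by exists 0.
move=> _ [p [pk up] <-]; rewrite lerBrDl.
(* If [j] already lies on the path from [k], the path returns to [j]: the closed part has weight at
   most [0], and what follows is a simple path from [j]. *)
have [jp|jp] := boolP (j \in k :: p); last first.
  by apply: Dsup; exists (k :: p) => //=; rewrite ejk pk; move: up jp => /= -> ->.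
have pjk : path e j (k :: p) by rewrite /= ejk.
have -> : c j k + walk_weight k p = walk_weight j (k :: p) by [].
move: up pjk; case/splitPr def_p: {1 2 3}(k :: p) / jp => [p1 p2].
rewrite -cat1s catA cat_uniq cat_path walk_weight_cat last_cat /= => up /andP[p1j p2j].
have : walk_weight j (p1 ++ [:: j]) <= 0.
  by apply: closed_walk_le0; rewrite ?last_cat.
have : walk_weight j p2 <= sup (D j).
  apply: Dsup; exists p2 => //; split=> //.
  by move: up; case/and3P=> _; rewrite /= => nh ->; rewrite andbT; apply: contra nh => jp2; apply/hasP; exists j => //; rewrite mem_cat mem_head orbT.
lra.
Qed.

End Potentials.

(** * Duality for finite mean-payoff games *)

Section Games.
Variables (R : realType) (I J : finType).
Variables (ea eb : I -> J -> bool) (wa wb : I -> J -> R).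
Hypotheses (ea_ex : forall j, exists i, ea i j)
  (eb_ex : forall i, exists k, eb i k).

Let w i j k := wb i k - wa i j.

(** A sub-eigenvector: [mu + x <= f x] for the operator [f] of the game, [S] being the set of its
    finite coordinates. Max can stay in [S] whatever Min plays. *)
Definition subcert (mu : R) (S : {set J}) (x : J -> R) :=
  S != finset.set0 /\ forall j i, j \in S -> ea i j ->
    exists k, [/\ k \in S, eb i k & mu + x j <= w i j k + x k].

(** A super-eigenvector with finite entries, [f y <= mu + y]; the row [i] is a positional strategy
    of Min. *)
Definition supcert (mu : R) (y : J -> R) :=
  forall j, exists i, ea i j /\
    forall k, eb i k -> w i j k + y k <= mu + y j.

Definition has_value (rho : R) :=
  (exists S x, subcert rho S x) /\ (exists y, supcert rho y).

(** At a node of [S] where [x - y] is largest, let Min play the row given by [y] and Max the reply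
    given by [x]: this difference grows by at least [mu - nu], yet it cannot grow. *)
Lemma weak_duality mu nu S x y : subcert mu S x -> supcert nu y -> mu <= nu.
Proof.
case=> /set0Pn Sne Hx Hy.
have [j [jS jmax]] := finite_max (fun j => x j - y j) Sne.
have [i [eij Hi]] := Hy j; have [k [kS eik Hk]] := Hx j i jS eij.
have := Hi k eik; have := jmax k kS; lra.
Qed.

Lemma value_unique r1 r2 : has_value r1 -> has_value r2 -> r1 = r2.
Proof.
move=> [[S1 [x1 H1]] [y1 K1]] [[S2 [x2 H2]] [y2 K2]]; apply/eqP.
by rewrite eq_le (weak_duality H1 K2) (weak_duality H2 K1).
Qed.

(* [c] is the value at [j] of the one-turn game with final payments [x]. *)
Definition turn_value (x : J -> R) (j : J) (c : R) :=
  (exists i, ea i j /\ forall k, eb i k -> w i j k + x k <= c) /\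
  (forall i, ea i j -> exists k, eb i k /\ c <= w i j k + x k).

Lemma turn_value_exists x j : exists c, turn_value x j c.
Proof.
have /choice[sg Hsg] i := finite_max (fun k => wb i k + x k) (eb_ex i).
have [i [eij Hi]] := finite_min (fun i => wb i (sg i) + x (sg i) - wa i j)
  (ea_ex j).
exists (wb i (sg i) + x (sg i) - wa i j); split.
  by exists i; split=> // k /(proj2 (Hsg i)); rewrite /w; lra.
move=> i' eij'; exists (sg i'); split; first by case: (Hsg i').
by have := Hi i' eij'; rewrite /w; lra.
Qed.

Lemma turn_value_mono x x' j c c' (d : R) : turn_value x j c ->
  turn_value x' j c' -> (forall k, x k <= x' k + d) -> c <= c' + d.
Proof.
move=> [_ Hc] [[i [eij Hi]] _] xx'; have [k [eik Hk]] := Hc i eij.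
by have := Hi k eik; have := xx' k; lra.
Qed.

(** The truncated iteration [g] decreases. If a coordinate stays at [0] forever, the limit on the
    coordinates that are bounded below is a subcertificate. Otherwise all coordinates are negative
    after some [N] turns, and this uniform decrease leaves room for a supercertificate strictly
    below [mu]. *)
Lemma alternative (mu : R) (j0 : J) : (forall S x, ~ subcert mu S x) ->
  exists2 eps, 0 < eps & exists y, supcert (mu - eps) y.
Proof.
move=> nosub.
have /choice[F HF] (x : J -> R) : exists f : J -> R, forall j, turn_value x j (f j).
  by have [f] := choice (turn_value_exists x); exists f.
pose G (x : J -> R) j := Num.min (x j) (F x j - mu).
pose g N := iter N G (fun=> 0).
have gS N j : g N.+1 j <= g N j by rewrite /g iterS ge_min lexx.
have gmono N N' j : (N <= N')%N -> g N' j <= g N j.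
  by move=> /subnKC <-; elim: (N' - N)%N => [|a IH];
     rewrite ?addn0 // addnS (le_trans (gS _ _)).
have g0 N j : g N j <= 0 by apply: (gmono 0%N).
have [[N HN]|nN] := pselect (exists N, forall j, g N j < 0); last first.
  exfalso.
  have [j1 Hj1] : exists j, forall N, g N j = 0.
    apply: contrapT => nj; apply: nN.
    have := @finite_nat_ub J (fun j N => g N j < 0); apply.
      by move=> i a b ab; apply: le_lt_trans; apply: gmono.
    move=> j; apply: contrapT => Hj; apply: nj; exists j => N.
    apply/eqP; rewrite eq_le g0 /= leNgt; apply/negP => gl.
    by apply: Hj; exists N.
  pose S := [set j | `[< exists b, forall N, b <= g N j >]]%SET.
  pose x j := inf [set g N j | N in [set: nat]].
  have xg j N : j \in S -> x j <= g N j.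
    rewrite inE => /asboolP[b Hb]; apply: ge_inf; last by exists N.
    by exists b => _ [? _ <-].
  apply: (nosub S x); split.
    by apply/set0Pn; exists j1; rewrite inE; apply/asboolP; exists 0 => N;
       rewrite Hj1.
  move=> j i jS eij; apply: contrapT => nk.
  (* Were every reply to fail in the limit, all would fail at a common [N] by finiteness, and the
     next iterate at [j] would drop below its infimum [x j]. *)
  have [N HN] : exists N, forall k, eb i k -> w i j k + g N k < mu + x j.
    apply: (@finite_nat_ub J (fun k N => eb i k -> w i j k + g N k < mu + x j)).
      move=> k a b ab Ha /Ha; apply: le_lt_trans; rewrite lerD2l.
      exact: gmono.
    move=> k; apply: contrapT => Hk; apply: nk; exists k.
    have HkN N : eb i k /\ mu + x j <= w i j k + g N k.
      apply: contrapT => H; apply: Hk; exists N => eik.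
      by rewrite ltNge; apply/negP => le; apply: H.
    have kS : k \in S.
      rewrite inE; apply/asboolP; exists (mu + x j - w i j k) => N.
      by have [_] := HkN N; lra.
    split=> //; first by case: (HkN 0%N).
    have : mu + x j - w i j k <= x k; last lra.
    apply: lb_le_inf; first by exists (g 0%N k), 0%N.
    by move=> _ [N _ <-]; have [_] := HkN N; lra.
  have := xg j N.+1 jS; rewrite /g iterS -/(g N) /G le_min => /andP[_].
  have [_ /(_ i eij)[k [eik]]] := HF (g N) j.
  by have := HN k eik; lra.
have [N0|N0] := posnP N.
  by have := HN j0; rewrite N0 /g /= ltxx.
have [b b0 Hb] : exists2 b, 0 < b & forall j, g N j <= - b.
  have [j [_ Hj]] := @finite_max R J (fun=> True) (g N) (ex_intro _ j0 Logic.I).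
  by exists (- g N j); rewrite ?oppr_gt0 // => k; rewrite opprK; apply: Hj.
pose eps := b / N%:R.
have eps0 : 0 < eps by rewrite divr_gt0 ?ltr0n.
exists eps => //.
pose h i j := g i j + i%:R * eps.
(* [y] is a super-eigenvector because [h N <= h 0] closes the chain. *)
have hN j : h N j <= h 0%N j.
  rewrite /h mul0r addr0 {2}/g /= /eps mulrC divfK ?pnatr_eq0 -?lt0n //.
  by have := Hb j; lra.
have /choice[ix Hix] j := @finite_min R 'I_N (fun=> True) (fun i => h i j)
  (ex_intro _ (Ordinal N0) Logic.I).
pose y j := h (ix j) j.
exists y => j.
have yh i k : (i < N)%N -> y k <= h i k.
  by move=> iN; have [_ /(_ (Ordinal iN))] := Hix k; apply.
(* An index attaining the minimum is written as a successor; index [0] is replaced by [N]. *)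
have [i iN yi] : exists2 i, (i < N)%N & h i.+1 j <= y j.
  rewrite /y; case: (ix j) => [[|i] ilt] /=; last by exists i => //; apply: ltnW.
  by exists N.-1; rewrite prednK.
have gF : F (g i) j - mu <= g i.+1 j.
  have := le_trans yi (yh i j iN); rewrite /h -addn1 natrD.
  rewrite /g addn1 iterS -/(g i) /G minEle; case: ifP => // _; lra.
have := HF y j => -[[i' [eij' Hi']] HF2]; exists i'; split=> // k eik.
have := turn_value_mono (d := i%:R * eps) (HF y j) (HF (g i) j).
move=> /(_ (fun k => yh i k iN)).
have := Hi' k eik; move: yi; rewrite /h -addn1 natrD; rewrite addn1; lra.
Qed.

Variable W : R.
Hypothesis wW : forall i j k, ea i j -> eb i k -> `|w i j k| <= W.

(** Both certificates are needed at the supremum [rho] itself. Without a subcertificate at [rho],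
    the alternative would give a supercertificate below [rho]. Conversely, supercertificates exist
    just above [rho]; one of the finitely many positional strategies of Min serves arbitrarily small
    [eps], and potentials for that strategy reach [rho]. The bound on [y] comes from
    [w - rho <= 2 * W]. *)
Theorem duality (j0 : J) : exists rho S x y,
  [/\ subcert rho S x, supcert rho y & forall j, 0 <= y j <= #|J|%:R * (2 * W)].
Proof.
have W0 : 0 <= W.
  have [i ij] := ea_ex j0; have [k ik] := eb_ex i.
  exact: le_trans (wW ij ik).
pose E : set R := [set mu | exists S x, subcert mu S x].
have EW : E (- W).
  exists finset.setT, (fun=> 0); split; first by apply/set0Pn; exists j0; rewrite inE.
  move=> j i _ ij; have [k ik] := eb_ex i; exists k; split=> //.
  by have := wW ij ik; rewrite ler_norml !addr0 => /andP[].
have supW : supcert W (fun=> 0).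
  move=> j; have [i ij] := ea_ex j; exists i; split=> // k ik.
  by have := wW ij ik; rewrite ler_norml !addr0 => /andP[].
have Eub : ubound E W by move=> mu [S [x H]]; apply: weak_duality H supW.
have hE : has_sup E by split; [exists (- W)|exists W].
set rho := sup E.
have rhoW : `|rho| <= W.
  by rewrite ler_norml sup_upper_bound //= ge_sup //; exists (- W).
have supgt mu : rho < mu -> exists y, supcert mu y.
  move=> rmu; have [S x H|eps eps0 [y Hy]] := @alternative mu j0.
    by move: rmu; rewrite ltNge sup_upper_bound //; exists S, x.
  exists y => j; have [i [ij Hi]] := Hy j; exists i; split=> // k ik.
  by have := Hi k ik; lra.
have [S [x Hx]] : exists S x, subcert rho S x.
  apply: contrapT => H; have [S x K|eps eps0 [y Hy]] := @alternative rho j0.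
    by apply: H; exists S, x.
  have : rho <= rho - eps; last lra.
  apply: ge_sup; first by exists (- W).
  by move=> mu [S [x K]]; apply: weak_duality K Hy.
exists rho, S, x.
pose good (t : {ffun J -> I}) eps (y : J -> R) := forall j,
  ea (t j) j /\ forall k, eb (t j) k -> w (t j) j k + y k <= rho + eps + y j.
have [t Ht] : exists t, forall eps, 0 < eps -> exists y, good t eps y.
  apply: contrapT => nt.
  have [||N HN] := @finite_nat_ub {ffun J -> I}
    (fun t N => forall y, ~ good t N.+1%:R^-1 y).
  - move=> t a b ab Ha y Hy; apply: (Ha y) => j; have [tj Hj] := Hy j.
    split=> // k ik; apply: le_trans (Hj k ik) _; rewrite lerD2r lerD2l.
    by rewrite lef_pV2 ?posrE ?ltr0n // ler_nat.
  - move=> t; apply: contrapT => Ht; apply: nt; exists t => eps eps0.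
    apply: contrapT => H; apply: Ht; exists (Num.bound eps^-1) => y Hy.
    apply: H; exists y => j; have [tj Hj] := Hy j; split=> // k ik.
    apply: le_trans (Hj k ik) _; rewrite lerD2r lerD2l -[leRHS]invrK.
    rewrite lef_pV2 ?posrE ?ltr0n ?invr_gt0 //.
    have /archi_boundP/ltW/le_trans : 0 <= eps^-1 by rewrite invr_ge0 ltW.
    by apply; rewrite ler_nat.
  have [|y Hy] := supgt (rho + N.+1%:R^-1).
    by rewrite ltrDl invr_gt0 ltr0n.
  have [t Ht] := choice Hy.
  by apply: (HN (finfun t) y) => j; rewrite ffunE; apply: Ht.
have W2 : 0 <= 2 * W by rewrite mulr_ge0.
have [| |y [Hy Hy0]] := @potential_exists R J (fun j k => eb (t j) k)
  (fun j k => w (t j) j k - rho) _ W2.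
- have [y Hy] := Ht _ ltr01.
  move=> j k tjk; have [tj _] := Hy j; have := wW tj tjk; move: rhoW.
  by rewrite !ler_norml => /andP[? ?] /andP[? ?]; lra.
- move=> eps /Ht[y Hy]; exists y => j k tjk.
  by have [_ /(_ k tjk)] := Hy j; lra.
exists y; split=> // j; exists (t j).
have [z Hz] := Ht _ ltr01; have [tj _] := Hz j.
by split=> // k tjk; have := Hy j k tjk; lra.
Qed.

(* [T] is a union of cycles when both players use positional strategies, so
   that the potentials cancel in the sum over [T]. *)
Theorem value_formula rho : has_value rho -> exists (T : {set J}) (t : J -> I)
    (g : I -> J),
  [/\ (0 < #|T|)%N, (#|T| <= minn #|I| #|J|)%N,
      forall j, j \in T -> ea (t j) j /\ eb (t j) (g (t j)) &
      #|T|%:R * rho = \sum_(j in T) w (t j) j (g (t j))].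
Proof.
move=> [[S [x [Sne Hx]]] [y Hy]].
have [t Ht] := choice Hy.
have /set0Pn Sex := Sne.
(* The reply of Max depends on the row alone; rows without a move into [S] get an arbitrary node of
   [S]. *)
have /choice[g Hg] i : exists k, (exists k', k' \in S /\ eb i k') ->
    [/\ k \in S, eb i k & forall k', k' \in S -> eb i k' ->
        wb i k' + x k' <= wb i k + x k].
  have [ex|nex] := pselect (exists k', k' \in S /\ eb i k'); last first.
    by have [j jS] := Sex; exists j.
  have [k [[kS ik] Hk]] := finite_max (fun k => wb i k + x k) ex.
  by exists k => _; split=> // k' k'S ik'; apply: Hk.
pose f j := g (t j).
have fS j : j \in S -> [/\ f j \in S, eb (t j) (f j) &
    rho + x j <= w (t j) j (f j) + x (f j)].
  move=> jS; have [k [kS ik Hk]] := Hx j (t j) jS (proj1 (Ht j)).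
  have [|gS ig Hg'] := Hg (t j); first by exists k.
  by split=> //; have := Hg' k kS ik; move: Hk; rewrite /w /f; lra.
(* On a minimal nonempty invariant set the map [f] is onto, hence a permutation. As [f] factors
   through [t], the rows used are distinct too, which bounds [#|T|] by [#|I|]. *)
pose inv (T : {set J}) := (T != finset.set0) && (f @: T \subset T)%SET.
have invS : inv S.
  rewrite /inv Sne; apply/fintype.subsetP => _ /imsetP[j jS ->].
  by case: (fS j jS).
have [T minT TS] := minset_exists invS.
have /andP[Tne fT] : inv T := minsetp minT.
have fTT : (f @: T)%SET = T.
  apply: (minsetinf minT) => //; rewrite /inv imsetS // andbT.
  by have /set0Pn[j jT] := Tne; apply/set0Pn; exists (f j); apply: imset_f.
have finj : {in T &, injective f} by apply/imset_injP; rewrite fTT.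
have sumf (z : J -> R) : \sum_(j in T) z (f j) = \sum_(j in T) z j.
  by rewrite -{2}fTT big_imset.
exists T, t, g; split.
- by rewrite card_gt0.
- rewrite leq_min max_card andbT.
  have <- : #|(t @: T)%SET| = #|T|.
    by apply: card_in_imset => a b aT bT tab; apply: finj; rewrite // /f tab.
  exact: max_card.
- move=> j jT; have jS : j \in S by apply: (fintype.subsetP TS).
  by split; [case: (Ht j)|case: (fS j jS)].
have cst (z : R) : #|T|%:R * z = \sum_(j in T) z.
  by rewrite sumr_const mulr_natl.
apply/eqP; rewrite eq_le; apply/andP; split.
  rewrite -(lerD2r (\sum_(j in T) x j)) cst -{2}(sumf x) -!big_split /=.
  apply: ler_sum => j jT; have jS : j \in S by apply: (fintype.subsetP TS).
  by case: (fS j jS).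
rewrite -(lerD2r (\sum_(j in T) y j)) cst -{1}(sumf y) -!big_split /=.
apply: ler_sum => j jT; have jS : j \in S by apply: (fintype.subsetP TS).
by apply: (proj2 (Ht j)); case: (fS j jS).
Qed.
End Games.

(** * Operators on R_max^n *)

Lemma ereal_shift (R : realType) (a b c : R) (x y : \bar R) :
  (x + a%:E - c%:E <= b%:E + y)%E = (x <= (c + (b - a))%:E + y)%E.
Proof.
case: x y => [r| |] [s| |] //=; rewrite -?EFinN -?EFinD ?lee_fin ?leey ?leNye //.
by apply/idP/idP; lra.
Qed.

Section Operators.
Variables (R : realType) (I : finType) (n : nat).
Variables (ea eb : I -> 'I_n -> bool) (wa wb : I -> 'I_n -> R).
Let w i j k := wb i k - wa i j.

(* An operator on R_max is determined by the lower bounds [v] of its values. *)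
Definition shapley (f : ('I_n -> \bar R) -> 'I_n -> \bar R) := forall x j v,
  (v <= f x j)%E <-> forall i, ea i j ->
    v = -oo%E \/ exists k, eb i k /\ (v <= (w i j k)%:E + x k)%E.

Variable f : ('I_n -> \bar R) -> 'I_n -> \bar R.
Hypothesis fP : shapley f.

Lemma shapley_mono x x' : (forall j, x j <= x' j)%E -> forall j, (f x j <= f x' j)%E.
Proof.
move=> xx' j; apply/fP => i ij; have /fP/(_ i ij) := lexx (f x j).
case=> [|[k [ik Hk]]]; [by left|right; exists k; split=> //].
by apply: le_trans Hk _; apply: leeD2l.
Qed.

Lemma shapley_subcert r x : nonbottom_vec x ->
  (forall j, r%:E + x j <= f x j)%E ->
  subcert ea eb wa wb r [set j | x j != -oo%E]%SET (fun j => fine (x j)).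
Proof.
move=> [xo [j1 xj1]] Hx.
have xfin j : x j != -oo%E -> x j = (fine (x j))%:E.
  by move=> xj; rewrite fineK // fin_numE xj; apply: xo.
split; first by apply/set0Pn; exists j1; rewrite inE.
move=> j i; rewrite inE => xj ij.
have /fP/(_ i ij) := Hx j; rewrite (xfin j xj) => -[//|[k [ik Hk]]]; exists k.
have xk : x k != -oo%E by apply: contraTN Hk => /eqP->; rewrite addeNy leeNy_eq.
by rewrite inE; split=> //; move: Hk; rewrite (xfin k xk) -!EFinD lee_fin.
Qed.

(** The largest sub-eigenvector [z] below a translate of the super-eigenvector is an eigenvector,
    because [f z - rho] is again one of them. The translate is raised above [x], so that [z] is not
    identically [-oo]. Maximality is weak duality. *)
Lemma shapley_is_r rho : has_value ea eb wa wb rho -> is_r f rho%:E.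
Proof.
move=> [[S [x Hx]] [y Hy]]; have [Sne HxS] := Hx; have /set0Pn[j0 j0S] := Sne.
have [c c0 Hc] := finite_ub (fun j => x j - y j).
pose Y j : \bar R := (y j + c)%:E.
pose x0 j : \bar R := if j \in S then (x j)%:E else -oo%E.
pose D : set ('I_n -> \bar R) := [set u | (forall j, u j <= Y j)%E /\
   (forall j, rho%:E + u j <= f u j)%E].
pose z j := ereal_sup [set u j | u in D].
have Dz u j : D u -> (u j <= z j)%E by move=> Du; apply: ereal_sup_ubound; exists u.
have zle j v : (forall u, D u -> u j <= v)%E -> (z j <= v)%E.
  by move=> H; apply: ge_ereal_sup => _ [u Du <-]; apply: H.
have zY j : (z j <= Y j)%E by apply: zle => u [].
have Dx0 : D x0.
  split=> j; rewrite /x0 /Y; case: ifPn => jS; rewrite ?leNye ?lee_fin //.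
    by have := Hc j; lra.
  apply/fP => i ij; right; have [k [kS ik Hk]] := HxS j i jS ij; exists k.
  by rewrite kS; split=> //; rewrite -!EFinD lee_fin.
have subz j : (rho%:E + z j <= f z j)%E.
  rewrite -leeBrDl //; apply: zle => u Du; rewrite leeBrDl //.
  by apply: le_trans (proj2 Du j) _; apply: shapley_mono => k; apply: Dz.
have fY j : (f z j <= rho%:E + Y j)%E.
  have [i [ij Hi]] := Hy j.
  have /fP/(_ i ij)[->|[k [ik Hk]]] := lexx (f z j); first exact: leNye.
  apply: le_trans Hk _; apply: le_trans (leeD2l _ (zY k)) _.
  by rewrite /Y -!EFinD lee_fin; have := Hi k ik; rewrite /w; lra.
have Du' : D (fun j => f z j - rho%:E)%E.
  split=> j; first by rewrite leeBlDl.
  rewrite addeC subeK //; apply: shapley_mono => k; rewrite leeBrDl //; exact: subz.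
split.
  split=> //; exists z; last first.
    move=> j; apply/eqP; rewrite eq_le subz /= -leeBlDl //.
    exact: (Dz _ j Du').
  split=> [j|]; first by apply/negP => /eqP zj; have := zY j; rewrite zj.
  exists j0; apply/negP => /eqP zj; have := Dz _ j0 Dx0.
  by rewrite zj /x0 j0S leeNy_eq.
move=> l [lo [x' Hx' Hl]]; case: l lo Hl => [r| |] lo Hl; last 2 first.
- by move: lo; rewrite /in_Rmax eqxx.
- exact: leNye.
rewrite lee_fin; apply: weak_duality Hy; apply: shapley_subcert (x') _ _ => //.
by move=> j; rewrite Hl.
Qed.

End Operators.

Lemma is_r_unique (R : realType) n (f : ('I_n -> \bar R) -> 'I_n -> \bar R) r1 r2 :
  is_r f r1 -> is_r f r2 -> r1 = r2.
Proof.
by move=> [e1 u1] [e2 u2]; apply/eqP; rewrite eq_le u2 ?u1.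
Qed.

(** Certificates are scaled by [t], and the rows need only correspond through a surjection. It
    serves the exchange of [A] and [B], the scaling of the payments and the homogeneity in the
    degenerate case. *)
Lemma has_value_transport (R : realType) (I I' J : finType) (h : I -> I')
    (ea eb : I -> J -> bool) (wa wb : I -> J -> R)
    (ea' eb' : I' -> J -> bool) (wa' wb' : I' -> J -> R) (t d rho : R) :
  (forall i', exists i, h i = i') -> 0 <= t ->
  (forall i j, ea' (h i) j = ea i j) -> (forall i k, eb' (h i) k = eb i k) ->
  (forall i j k, ea i j -> eb i k ->
     wb' (h i) k - wa' (h i) j = t * (wb i k - wa i j) + d) ->
  has_value ea eb wa wb rho -> has_value ea' eb' wa' wb' (t * rho + d).
Proof.
move=> hsurj t0 eaE ebE wE [[S [x [Sne Hx]]] [y Hy]]; split.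
  exists S, (fun j => t * x j); split=> // j i' jS.
  have [i <-] := hsurj i'; rewrite eaE => ij.
  have [k [kS ik Hk]] := Hx j i jS ij; exists k; rewrite ebE; split=> //.
  by rewrite wE // -lerBrDr; have := ler_wpM2l t0 Hk; lra.
exists (fun j => t * y j) => j; have [i [ij Hi]] := Hy j; exists (h i).
rewrite eaE; split=> // k; rewrite ebE => ik; rewrite wE //.
by have := ler_wpM2l t0 (Hi k ik); lra.
Qed.

Lemma has_value_exists (R : realType) (I J : finType) (ea eb : I -> J -> bool)
    (wa wb : I -> J -> R) (j0 : J) :
  (forall j, exists i, ea i j) -> (forall i, exists k, eb i k) ->
  exists rho, has_value ea eb wa wb rho.
Proof.
move=> eaex ebex.
have [C _ HC] := finite_ub (fun q : I * J * J => `|wb q.1.1 q.2 - wa q.1.1 q.1.2|).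
have HC' i j k : ea i j -> eb i k -> `|wb i k - wa i j| <= C.
  by move=> _ _; apply: HC (i, j, k).
have [rho [S [x [y [Hx Hy _]]]]] := duality eaex ebex HC' j0.
by exists rho; split; [exists S, x|exists y].
Qed.

(** * Matrices with integer entries *)

Definition finite m n (A : 'M[option int]_(m, n)) i j := A i j != None.
Definition intval m n (A : 'M[option int]_(m, n)) i j : int := odflt 0 (A i j).

Section IntegerMatrices.
Variables (R : realType) (m n : nat) (A B : 'M[option int]_(m, n)).

Lemma le_bigmaxe_iff (P : pred 'I_n) (F : 'I_n -> \bar R) v :
  (v <= \big[maxe/-oo]_(k < n | P k) F k)%E <->
  v = -oo%E \/ exists k, P k /\ (v <= F k)%E.
Proof.
split=> [|[->|[k [Pk vk]]]]; last 2 first.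
- exact: leNye.
- exact: bigmax_sup vk.
elim/big_ind: _ => [|x y Hx Hy|k Pk vk].
- by rewrite leeNy_eq => /eqP; left.
- by rewrite le_max => /orP[].
by right; exists k.
Qed.

Lemma le_mpmul x i v : (v <= mpmul (mx_real R B) x i)%E <->
  v = -oo%E \/ exists k, finite B i k /\ (v <= ((intval B i k)%:~R)%:E + x k)%E.
Proof.
rewrite /mpmul le_bigmaxe_iff /finite /intval.
split=> -[->|[k]]; try by left.
  rewrite mxE /entry_real; case Bik: (B i k) => [z|]; last first.
    by case=> _; rewrite addNye leeNy_eq => /eqP; left.
  by case=> _ vk; right; exists k; rewrite Bik.
by case; case Bik: (B i k) => [z|] // _ vk; right; exists k; rewrite mxE Bik.
Qed.

(** By the dual addition, an entry [-oo] of [A] contributes [+oo] to the minimum and imposes no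
    condition. *)
Lemma le_sharp y j v : (v <= sharp (mx_real R A) y j)%E <->
  forall i, finite A i j -> (v <= (- (intval A i j)%:~R)%:E + y i)%E.
Proof.
rewrite /sharp /finite /intval; split=> [/bigmin_geP[_ H] i|H].
  by move: (H i isT); rewrite mxE; case: (A i j) => // z; case: (y i).
apply/bigmin_geP; split=> [|i _]; first exact: leey.
rewrite mxE; have := H i; case: (A i j) => [z|_] /=; last exact: leey.
by case: (y i) => [r| |] /(_ isT).
Qed.

Lemma sharp_comp_shapley : shapley (finite A) (finite B)
  (fun i j => (intval A i j)%:~R) (fun i k => (intval B i k)%:~R)
  (sharp_comp (mx_real R A) (mx_real R B)).
Proof.
move=> x j v; rewrite /sharp_comp; split=> [/le_sharp H|H]; last (apply/le_sharp); move=> i /(H i).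
  rewrite -leeBlDl // => /le_mpmul[vE|[k [ik Hk]]].
    by left; case: v vE {H} => [r| |].
  by right; exists k; split=> //; move: Hk; rewrite leeBlDl // addeA -EFinD [- _ + _]addrC.
case=> [->|[k [ik Hk]]]; first exact: leNye.
rewrite -leeBlDl //; apply/le_mpmul; right; exists k; split=> //.
by rewrite leeBlDl // addeA -EFinD [- _ + _]addrC.
Qed.

End IntegerMatrices.

(** * The spectral function *)

Section SpectralGame.
Variables (R : realType) (m n : nat) (A B : 'M[option int]_(m, n)).

(* Row [(true, i)] is the move of Min to row [i] of [A], row [(false, i)] her
   move to row [i] of [lam + B]. *)
Definition dbl_a (p : bool * 'I_m) j := finite (if p.1 then A else B) p.2 j.
Definition dbl_b (p : bool * 'I_m) k := finite (if p.1 then B else A) p.2 k.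
Definition dbl_wa (lam : R) (p : bool * 'I_m) j : R :=
  if p.1 then (intval A p.2 j)%:~R else lam + (intval B p.2 j)%:~R.
Definition dbl_wb (lam : R) (p : bool * 'I_m) k : R :=
  if p.1 then lam + (intval B p.2 k)%:~R else (intval A p.2 k)%:~R.

Definition spectral lam := has_value dbl_a dbl_b (dbl_wa lam) (dbl_wb lam).

Lemma dbl_wE lam p j k : dbl_wb lam p k - dbl_wa lam p j =
  if p.1 then lam + ((intval B p.2 k)%:~R - (intval A p.2 j)%:~R)
  else - lam + ((intval A p.2 k)%:~R - (intval B p.2 j)%:~R).
Proof. by rewrite /dbl_wb /dbl_wa; case: p.1; ring. Qed.

(** A minimum of two operators of games is the operator of the game in which Min has the rows of
    both. *)
Lemma hmap_shapley lam : shapley dbl_a dbl_b (dbl_wa lam) (dbl_wb lam)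
  (hmap (mx_real R A) (mx_real R B) lam).
Proof.
move=> x j v; rewrite /hmap le_min.
have E F (r : R) : (v <= r%:E + F x j)%E = (v - r%:E <= F x j)%E.
  by rewrite leeBlDl.
have Eoo (r : R) : (v - r%:E = -oo)%E <-> v = -oo%E by clear; case: v.
have Er (r s : R) (y : \bar R) : (v - r%:E <= s%:E + y)%E <-> (v <= (r + s)%:E + y)%E.
  by rewrite leeBlDl // addeA -EFinD.
rewrite !E; split=> [/andP[/(sharp_comp_shapley _ _ _ _) H1
    /(sharp_comp_shapley _ _ _ _) H2] [[] i] ij|H].
- have [/Eoo|[k [ik /Er Hk]]] := H1 i ij; [by left|right; exists k].
  by rewrite dbl_wE.
- have [/Eoo|[k [ik /Er Hk]]] := H2 i ij; [by left|right; exists k].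
  by rewrite dbl_wE.
apply/andP; split; apply/sharp_comp_shapley => i ij.
  have [->|[k [ik]]] := H (true, i) ij; first by left.
  by rewrite dbl_wE => Hk; right; exists k; split=> //; apply/Er.
have [->|[k [ik]]] := H (false, i) ij; first by left.
by rewrite dbl_wE => Hk; right; exists k; split=> //; apply/Er.
Qed.

Lemma spectral_is_value lam rho : spectral lam rho ->
  is_spectral_value (mx_real R A) (mx_real R B) lam rho%:E.
Proof. exact: (shapley_is_r (@hmap_shapley lam)). Qed.

Hypotheses (n_gt0 : (0 < n)%N) (Arow : no_bottom_row A) (Brow : no_bottom_row B)
  (ABcol : no_common_bottom_col A B).

Lemma dbl_a_ex j : exists p, dbl_a p j.
Proof.
by have [i /orP[ij|ij]] := ABcol j; [exists (true, i)|exists (false, i)].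
Qed.

Lemma dbl_b_ex p : exists k, dbl_b p k.
Proof. by case: p => [[] i]; [have [k] := Brow i|have [k] := Arow i]; exists k. Qed.

Lemma spectral_exists lam : exists rho, spectral lam rho.
Proof. exact: has_value_exists (Ordinal n_gt0) dbl_a_ex dbl_b_ex. Qed.

(** A supercertificate for [lam'] remains one for [lam] once its value is raised by the largest
    change of a payment. *)
Lemma spectral_le lam lam' rho rho' : spectral lam rho -> spectral lam' rho' ->
  rho <= rho' + `|lam - lam'|.
Proof.
move=> [[S [x Hx]] _] [_ [y Hy]]; apply: (weak_duality (y := y) Hx).
move=> j; have [p [pj Hp]] := Hy j; exists p; split=> // k pk.
have := Hp k pk; rewrite !dbl_wE; have := ler_norm (lam - lam').
by have := ler_norm (lam' - lam); rewrite distrC; case: p.1; lra.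
Qed.

Lemma spectral_lip lam lam' rho rho' : spectral lam rho -> spectral lam' rho' ->
  `|rho - rho'| <= `|lam - lam'|.
Proof.
move=> H H'; rewrite ler_norml; have := spectral_le H H'.
by have := spectral_le H' H; rewrite distrC; lra.
Qed.

(** Min can always choose a row of [lam + B]; with a constant potential each turn then pays at most
    [- lam + D]. *)
Lemma spectral_le_minus lam rho (D : R) : no_bottom_col B ->
  (forall i j k, finite A i j -> finite B i k ->
     (intval A i j)%:~R - (intval B i k)%:~R <= D) ->
  spectral lam rho -> rho <= - lam + D.
Proof.
move=> Bcol HD [[S [x Hx]] _]; apply: (weak_duality (y := fun=> 0) Hx).
move=> j; have [i ij] := Bcol j; exists (false, i); split=> // k ik.
by rewrite dbl_wE /= !addr0 lerD2l HD.
Qed.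

(** Min passes through both copies of the same row [i] in two consecutive turns: the shifts [lam]
    and the entry chosen by Max in between cancel. Starting from the node of [S] that maximizes the
    entry plus [x], the second reply cannot exceed the start, so [2 * rho <= 0]. *)
Lemma spectral_le0 lam rho : spectral lam rho -> rho <= 0.
Proof.
move=> [[S [x [Sne Hx]]] _]; have /set0Pn[j jS] := Sne.
have main (b : bool) i : j \in S -> dbl_a (b, i) j -> rho <= 0.
  move=> _ ij.
  have [j' [[j'S ij'] Hj']] := finite_max (P := fun j => j \in S /\ dbl_a (b, i) j)
    (fun j => dbl_wa 0 (b, i) j + x j) (ex_intro _ j (conj jS ij)).
  have [k [kS ik Hk]] := Hx j' (b, i) j'S ij'.
  have ik' : dbl_a (~~ b, i) k by case: b ik {ij ij' Hj' Hk}.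
  have [l [lS il Hl]] := Hx k (~~ b, i) kS ik'.
  have il' : dbl_a (b, i) l by case: b il {ij ij' Hj' Hk ik ik' Hl}.
  have := Hj' l (conj lS il'); move: Hk Hl; rewrite !dbl_wE /dbl_wa.
  by case: b {ij ij' Hj' ik ik' il il'} => /=; lra.
by have [i /orP[ij|ij]] := ABcol j; [apply: (main true i)|apply: (main false i)].
Qed.

(** By residuation, [x <= h x] says both [A x <= lam + B x] and [lam + B x <= A x]. A solution is
    thus a sub-eigenvector for [0], which together with [rho <= 0] gives equality; conversely an
    eigenvector for [0] is a solution. *)
Lemma spec_spectral lam rho : spectral lam rho ->
  spec (mx_real R A) (mx_real R B) lam <-> rho = 0.
Proof.
move=> Hr; split=> [[x xnb Hx]|r0].
  apply/eqP; rewrite eq_le (spectral_le0 Hr) /=.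
  have Hs : forall j, (0%:E + x j <= hmap (mx_real R A) (mx_real R B) lam x j)%E.
    move=> j; rewrite add0e; apply/hmap_shapley => -[[] i] ij.
      have : (x j + (intval A i j)%:~R%:E <= mpmul (mx_real R A) x i)%E.
        by apply/le_mpmul; right; exists j; rewrite addeC.
      rewrite Hx -leeBlDl // => /le_mpmul[|[k [ik Hk]]].
        by case: (x j) => // _; left.
      by right; exists k; split=> //; rewrite dbl_wE /= -ereal_shift.
    have : (x j + (intval B i j)%:~R%:E - (- lam)%:E <= mpmul (mx_real R A) x i)%E.
      rewrite Hx EFinN oppeK addeC; apply: leeD2l; apply/le_mpmul; right.
      by exists j; rewrite addeC.
    move=> /le_mpmul[|[k [ik Hk]]]; first by case: (x j) => // _; left.
    by right; exists k; split=> //; rewrite dbl_wE /= -ereal_shift.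
  have sub := shapley_subcert (@hmap_shapley lam) xnb Hs.
  by case: Hr => _ [y Hy]; apply: weak_duality sub Hy.
have [[_ [x xnb Hx]] _] := spectral_is_value Hr.
rewrite r0 in Hx; exists x => // i.
have Hx' j : (x j <= hmap (mx_real R A) (mx_real R B) lam x j)%E.
  by rewrite -Hx add0e.
apply/eqP; rewrite eq_le; apply/andP; split.
  apply/bigmax_leP; split=> [|j _]; first exact: leNye.
  rewrite mxE; case Aij: (A i j) => [z|]; last by rewrite addNye leNye.
  have ij : finite A i j by rewrite /finite Aij.
  have /hmap_shapley/(_ (true, i) ij)[->|[k [ik]]] := Hx' j.
    by rewrite addeNy leNye.
  rewrite dbl_wE /= -ereal_shift {1}/intval Aij /= => Hk.
  rewrite -leeBlDl //; apply/le_mpmul; right; exists k; split=> //.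
  by rewrite [(z%:~R%:E + _)%E]addeC.
rewrite -leeBrDl //. apply/bigmax_leP; split=> [|j _]; first exact: leNye.
rewrite mxE; case Bij: (B i j) => [z|]; last by rewrite addNye leNye.
have ij : finite B i j by rewrite /finite Bij.
rewrite leeBrDl //.
have /hmap_shapley/(_ (false, i) ij)[->|[k [ik]]] := Hx' j.
  by rewrite !addeNy leNye.
rewrite dbl_wE /= -ereal_shift EFinN oppeK {1}/intval Bij => Hk.
by apply/le_mpmul; right; exists k; split=> //; rewrite addeC [(z%:~R%:E + _)%E]addeC.
Qed.

End SpectralGame.

(** * Functions covered by lines of bounded denominator *)

Lemma int_norm_ge1 (R : realType) (P : int) : P != 0 -> 1 <= `|P%:~R : R|.
Proof. by move=> P0; rewrite -intr_norm ler1z; lia. Qed.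

Section AffinePieces.
Variables (R : realType) (s : R -> R) (k : nat) (z z' : R).
Variable Q : int -> nat -> nat -> Prop.
Hypotheses (zz' : z < z')
  (s_lip : forall x y, `|s x - s y| <= `|x - y|)
  (Q_bnd : forall a l u, Q a l u -> (0 < l <= k)%N /\ (u <= l)%N)
  (s_line : forall x, z < x < z' -> exists a l u,
     Q a l u /\ l%:R * s x = a%:~R + (l%:R - 2 * u%:R) * x)
  (no_crossing : forall a l u a' l' u' x, Q a l u -> Q a' l' u' -> z < x < z' ->
     (u' * l)%N != (u * l')%N ->
     a'%:~R * l%:R - a%:~R * l'%:R != 2 * (u'%:R * l%:R - u%:R * l'%:R) * x).

(** Up to the factor [l * l'], [f] is the difference of the two lines at [x]. With equal slopes it
    is an integer, and [h <= 1] makes it zero; with different slopes the lines meet at distance less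
    than [h] from [x], inside the interval, which is excluded. *)
Lemma crossing_gap a l u a' l' u' x (h : R) : Q a l u -> Q a' l' u' -> 0 < h ->
  h <= 1 -> z + h <= x -> x + h <= z' ->
  let f := a'%:~R * l%:R - a%:~R * l'%:R - 2 * (u'%:R * l%:R - u%:R * l'%:R) * x in
  `|f| < h -> f = 0.
Proof.
move=> Qa Qa' h0 h1 zx xz' f.
have fE : f = (a' * l - a * l')%:~R - 2 * ((u' * l)%N%:Z - (u * l')%N%:Z)%:~R * x.
  by rewrite /f !PoszM !rmorphB !rmorphM.
have [e|ne] := eqVneq (u' * l)%N (u * l')%N.
  rewrite fE e subrr mulr0 mul0r subr0; have [->//|ne0] := eqVneq (a' * l - a * l') 0.
  by have := int_norm_ge1 R ne0; lra.
move=> fh; pose T : R := u'%:R * l%:R - u%:R * l'%:R.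
have T1 : 1 <= `|T|.
  have -> : T = ((u' * l)%N%:Z - (u * l')%N%:Z)%:~R by rewrite !PoszM rmorphB !rmorphM.
  by apply: int_norm_ge1; rewrite subr_eq0 eqz_nat.
have T0 : T != 0 by rewrite -normr_gt0; lra.
have fT : `|f / (2 * T)| < h.
  rewrite normrM normfV normrM ltr_pdivrMr ?mulr_gt0 ?normr_gt0 //.
  rewrite [`|2|]ger0_norm //; have : h * 1 <= h * `|T| by rewrite ler_pM2l.
  lra.
have : z < x + f / (2 * T) < z' by move: fT; rewrite ltr_norml; lra.
move=> /(no_crossing Qa Qa')/(_ ne)/eqP[].
have -> : 2 * (u'%:R * l%:R - u%:R * l'%:R) * (x + f / (2 * T)) = 2 * T * x + f.
  by rewrite -/T; field.
by rewrite /f /T; ring.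
Qed.

(** Let [d] be the difference between [s] and its line at the midpoint. It is 2-Lipschitz and, away
    from the end points, takes no nonzero value of small absolute value; hence it stays at [0] along
    a chain of short steps. The end points follow by continuity. *)
Lemma affine_between : exists al be, forall x, z <= x <= z' -> s x = al * x + be.
Proof.
pose x0 := (z + z') / 2.
have x0in : z < x0 < z' by move: zz'; rewrite /x0; lra.
have [a [l [u [Qa s0]]]] := s_line x0in.
have [/andP[l0 lk] ul] := Q_bnd Qa.
have lR0 : 0 < l%:R :> R by rewrite ltr0n.
pose al : R := (l%:R - 2 * u%:R) / l%:R; pose be : R := a%:~R / l%:R.
have al1 : `|al| <= 1.
  rewrite /al normrM normfV [`|l%:R|]gtr0_norm // ler_pdivrMr // mul1r ler_norml.
  have : u%:R <= l%:R :> R by rewrite ler_nat.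
  have : 0 <= u%:R :> R by rewrite ler0n.
  lra.
pose d x := s x - (al * x + be).
have d0 : d x0 = 0.
  apply: (mulfI (lt0r_neq0 lR0)); rewrite mulr0 /d mulrBr s0 /al /be; field.
  exact: lt0r_neq0.
have dlip x y : `|d x - d y| <= 2 * `|x - y|.
  have -> : d x - d y = (s x - s y) - al * (x - y) by rewrite /d; ring.
  apply: le_trans (ler_normB _ _) _; rewrite normrM.
  have := s_lip x y; have : `|al| * `|x - y| <= 1 * `|x - y| by rewrite ler_wpM2r.
  lra.
have k0 : 0 < k%:R :> R by rewrite ltr0n; apply: leq_trans lk.
have kk0 : 0 < k%:R * k%:R :> R by rewrite mulr_gt0.
have gap h x : 0 < h -> h <= 1 -> z + h <= x -> x + h <= z' ->
    `|d x| < h / (k%:R * k%:R) -> d x = 0.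
  move=> h0 h1 zx xz' dx.
  have xin : z < x < z' by lra.
  have [a' [l' [u' [Qa' s1]]]] := s_line xin.
  have [/andP[l'0 l'k] _] := Q_bnd Qa'.
  have l'R0 : 0 < l'%:R :> R by rewrite ltr0n.
  have E : l%:R * l'%:R * d x = a'%:~R * l%:R - a%:~R * l'%:R -
      2 * (u'%:R * l%:R - u%:R * l'%:R) * x.
    rewrite /d mulrBr -[_ * _ * s x]mulrA s1 /al /be; field.
    exact: lt0r_neq0.
  have := crossing_gap Qa Qa' h0 h1 zx xz'; rewrite /= -E => H.
  have : l%:R * l'%:R * d x = 0.
    apply: H; rewrite normrM normrM [`|l%:R|]gtr0_norm // [`|l'%:R|]gtr0_norm //.
    rewrite ltr_pdivlMr // in dx; apply: le_lt_trans dx; rewrite mulrC.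
    by rewrite ler_wpM2l // ler_pM ?ler0n // ler_nat.
  by move/eqP; rewrite !mulf_eq0 (gt_eqF lR0) (gt_eqF l'R0) => /eqP.
have inside x : z < x < z' -> d x = 0.
  move=> zxz'.
  have [h [h0 h1 hx hx0]] : exists h, [/\ 0 < h, h <= 1, z + h <= x /\ x + h <= z' &
      z + h <= x0 /\ x0 + h <= z'].
    exists (Num.min 1 (Num.min (Num.min (x - z) (z' - x)) (Num.min (x0 - z) (z' - x0)))).
    rewrite !lt_min ge_min lexx /=.
    have M1 : forall (p q : R), Num.min p q <= p by move=> p q; rewrite ge_min lexx.
    have M2 : forall (p q : R), Num.min p q <= q by move=> p q; rewrite ge_min lexx orbT.
    set p := Num.min (x - z) (z' - x); set q := Num.min (x0 - z) (z' - x0).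
    have := M2 1 (Num.min p q); have := M1 p q; have := M2 p q.
    have := M1 (x - z) (z' - x); have := M2 (x - z) (z' - x).
    have := M1 (x0 - z) (z' - x0); have := M2 (x0 - z) (z' - x0).
    rewrite -/p -/q; split; [|done|split|split]; lra.
  pose g := h / (k%:R * k%:R); have g0 : 0 < g by rewrite divr_gt0.
  pose N := (Num.bound (3 * `|x - x0| / g)).+1.
  have NR : 0 < N%:R :> R by rewrite ltr0n.
  have HN : 2 * (`|x - x0| / N%:R) < g.
    rewrite mulrA ltr_pdivrMr // -ltr_pdivrMl // mulrC.
    have b0 : 0 <= 3 * `|x - x0| / g by rewrite divr_ge0 ?mulr_ge0 // ltW.
    apply: (@le_lt_trans _ _ (3 * `|x - x0| / g)).
      by rewrite ler_pM2r ?invr_gt0 //; have := normr_ge0 (x - x0); lra.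
    by apply: lt_trans (archi_boundP b0) _; rewrite ltr_nat.
  pose y i := x0 + i%:R / N%:R * (x - x0).
  have yh i : (i <= N)%N -> z + h <= y i /\ y i + h <= z'.
    move=> iN; have : 0 <= i%:R / N%:R :> R by rewrite divr_ge0 ?ler0n.
    have : i%:R / N%:R <= 1 :> R by rewrite ler_pdivrMr // mul1r ler_nat.
    rewrite /y; move: (i%:R / N%:R) => c c1 c0.
    have -> : x0 + c * (x - x0) = (1 - c) * x0 + c * x by ring.
    have := ler_wpM2l c0 (proj1 hx); have := ler_wpM2l c0 (proj2 hx).
    have c1' : 0 <= 1 - c by lra.
    have := ler_wpM2l c1' (proj1 hx0); have := ler_wpM2l c1' (proj2 hx0); lra.
  have dy i : (i <= N)%N -> d (y i) = 0.
    elim: i => [|i IH] iN; first by rewrite /y mul0r mul0r addr0.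
    have [y1 y2] := yh _ iN; apply: (gap h) => //.
    have := dlip (y i.+1) (y i); rewrite IH ?(ltnW iN) // subr0 => /le_lt_trans; apply.
    have -> : y i.+1 - y i = (x - x0) / N%:R by rewrite /y -addn1 natrD; field; rewrite gt_eqF.
    by rewrite normrM normfV [`|N%:R|]gtr0_norm.
  by have := dy N (leqnn N); rewrite /y divff ?gt_eqF // mul1r addrC subrK.
exists al, be => x xin; apply/eqP; rewrite -subr_eq0 -/(d x) -normr_le0.
apply/ler_addgt0Pr => eps eps0; rewrite add0r.
pose y := x + (x0 - x) * Num.min 1 (eps / (2 * (z' - z))).
have zz0 : 0 < 2 * (z' - z) by move: zz'; lra.
have t0 : 0 < Num.min 1 (eps / (2 * (z' - z))) by rewrite lt_min ltr01 divr_gt0.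
have t1 : Num.min 1 (eps / (2 * (z' - z))) <= 1 by rewrite ge_min lexx.
have t2 : Num.min 1 (eps / (2 * (z' - z))) <= eps / (2 * (z' - z)) by rewrite ge_min lexx orbT.
move: t2; rewrite ler_pdivlMr // => t2.
have dy : d y = 0.
  apply: inside; rewrite /y; move: t0 t1 {t2 y}; move: (Num.min _ _) => t t0 t1.
  have -> : x + (x0 - x) * t = (1 - t) * x + t * x0 by ring.
  have c1' : 0 <= 1 - t by lra.
  case/andP: xin => /(ler_wpM2l c1') ? /(ler_wpM2l c1') ?.
  by case/andP: x0in; rewrite -(ltr_pM2l t0) => ?; rewrite -(ltr_pM2l t0) => ?; lra.
have := dlip x y; rewrite dy subr0 => /le_trans; apply.
have -> : x - y = (x - x0) * Num.min 1 (eps / (2 * (z' - z))) by rewrite /y; ring.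
rewrite normrM (gtr0_norm t0); apply: le_trans t2.
have H : `|x - x0| <= z' - z by rewrite ler_norml /x0; lra.
by have := ler_wpM2r (ltW t0) H; lra.
Qed.

End AffinePieces.

(** * Lines and rays of the spectral function *)

Definition row_gap m n (A B : 'M[option int]_(m, n)) (D : int) :=
  forall i j k, finite A i j -> finite B i k -> `|intval A i j - intval B i k| <= D.

Lemma row_gapC m n (A B : 'M[option int]_(m, n)) D : row_gap A B D -> row_gap B A D.
Proof. by move=> H i j k ij ik; rewrite distrC; apply: H. Qed.

(** Exchanging [A] and [B] exchanges the two copies of each row; results for large [lam] thereby
    carry over to large [- lam]. *)
Lemma spectralC (R : realType) m n (A B : 'M[option int]_(m, n)) (lam rho : R) :
  spectral A B lam rho -> spectral B A (- lam) rho.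
Proof.
move=> H; have := @has_value_transport R _ _ _ (fun p : bool * 'I_m => (~~ p.1, p.2))
  _ _ _ _ (@dbl_a m n B A) (@dbl_b m n B A) (dbl_wa B A (- lam)) (dbl_wb B A (- lam))
  1 0 rho _ ler01 _ _ _ H.
rewrite mul1r addr0; apply.
- by move=> [b i]; exists (~~ b, i); rewrite /= negbK.
- by move=> [[] i].
- by move=> [[] i].
by move=> [[] i] j k _ _; rewrite !dbl_wE /=; ring.
Qed.

(** [l] is the number of turns on the cycles and [u] the number of those through rows [(false, i)],
    where the shift is [- lam]; each turn contributes to [a] a difference of absolute value at most
    [D]. *)
Lemma spectral_line (R : realType) m n (A B : 'M[option int]_(m, n)) D (lam rho : R) :
  row_gap A B D -> spectral A B lam rho -> exists (a : int) (l u : nat),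
  [/\ (0 < l <= minn (2 * m) n)%N, (u <= l)%N, `|a| <= l%:Z * D &
      l%:R * rho = a%:~R + (l%:R - 2 * u%:R) * lam].
Proof.
move=> HD /value_formula[T [t [g [T0 Tk Tg E]]]].
pose c j : int := if (t j).1 then intval B (t j).2 (g (t j)) - intval A (t j).2 j
  else intval A (t j).2 (g (t j)) - intval B (t j).2 j.
exists (\sum_(j in T) c j), #|T|, (\sum_(j in T) (~~ (t j).1))%N; split.
- by rewrite T0; move: Tk; rewrite card_prod card_bool !card_ord.
- by rewrite -sum1_card; apply: leq_sum => j _; case: (t j).1.
- apply: le_trans (ler_norm_sum _ _ _) _.
  rewrite -[l in (Posz l * _)]sum1_card -[Posz _]natz natr_sum mulr_suml.
  apply: ler_sum => j /Tg[]; rewrite mul1r /c /dbl_a /dbl_b.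
  by case: (t j).1 => ij ik; rewrite ?HD // distrC HD.
rewrite E rmorph_sum /= natr_sum -sum1_card natr_sum mulr_sumr -sumrB mulr_suml -big_split /=.
apply: eq_bigr => j _; rewrite dbl_wE /c.
by case: (t j).1; rewrite rmorphB /=; ring.
Qed.

Definition ray_affine (R : realType) (s : R -> R) X :=
  exists al be, forall x, X <= x -> s x = al * x + be.

(** The lines found on longer and longer intervals agree at [X] and [X + 1], so they coincide. *)
Lemma ray_affine_from_intervals (R : realType) (s : R -> R) X :
  (forall r, X < r -> exists al be, forall x, X <= x <= r -> s x = al * x + be) ->
  ray_affine s X.
Proof.
move=> H; have [|al [be Hab]] := H (X + 1); first by lra.
exists al, be => x Xx; have [x1|x1] := leP x (X + 1); first by apply: Hab; rewrite Xx.
have [|al' [be' Hab']] := H x; first by lra.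
have e0 := Hab X; have e1 := Hab (X + 1); have f0 := Hab' X; have f1 := Hab' (X + 1).
rewrite f0 in e0; last by lra.
rewrite f1 in e1; last by lra.
have E0 : al' * X + be' = al * X + be by apply: e0; lra.
have E1 : al' * (X + 1) + be' = al * (X + 1) + be by apply: e1; lra.
have E : al' = al by lra.
by rewrite Hab'; [rewrite E in E0 *; lra|lra].
Qed.

Section SpectralFunction.
Variables (R : realType) (m n : nat) (A B : 'M[option int]_(m, n)) (s : R -> R).
Hypothesis sP : forall lam, spectral A B lam (s lam).
Let k := minn (2 * m) n.

Lemma s_lipschitz x y : `|s x - s y| <= `|x - y|.
Proof. exact: spectral_lip (sP x) (sP y). Qed.

Lemma row_gap_exists : exists D : nat, row_gap A B D.
Proof.
exists (\sum_i \sum_j \sum_k `|intval A i j - intval B i k|)%N => i j l _ _.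
rewrite -abszE lez_nat (bigD1 i) //= (bigD1 j) //= (bigD1 l) //= -!addnA.
exact: leq_addr.
Qed.

(** Two lines meet at [(a' l - a l') / (2 (u' l - u l'))]. Both products in the denominator lie
    between [0] and [k ^ 2], so their difference is at most [k ^ 2] in absolute value. *)
Lemma s_affine_between z z' : z < z' ->
  (forall (N : int) (t : nat), (0 < t <= k ^ 2)%N ->
     ~ (z < N%:~R / (2 * t%:R) < z')) ->
  exists al be, forall x, z <= x <= z' -> s x = al * x + be.
Proof.
move=> zz' H; have [D HD] := row_gap_exists.
apply: (@affine_between R s k z z' (fun _ l u => (0 < l <= k)%N /\ (u <= l)%N)) => //.
- exact: s_lipschitz.
- move=> x _; have [a [l [u [l1 u1 _ E]]]] := spectral_line HD (sP x).
  by exists a, l, u.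
move=> a l u a' l' u' x [/andP[l0 lk] ul] [/andP[l'0 l'k] ul'] xin ne.
have K1 : (u' * l <= k ^ 2)%N by rewrite expnS expn1 leq_mul // (leq_trans ul').
have K2 : (u * l' <= k ^ 2)%N by rewrite expnS expn1 leq_mul // (leq_trans ul).
apply/eqP => E; case: (ltngtP (u' * l)%N (u * l')%N) => [lt|gt|eq]; last by rewrite eq eqxx in ne.
  apply: (H (a * l' - a' * l) (u * l' - u' * l)%N); first by lia.
  rewrite natrB 1?ltnW // !natrM rmorphB !rmorphM /=.
  have T0 : 0 < u%:R * l'%:R - u'%:R * l%:R :> R by rewrite subr_gt0 -!natrM ltr_nat.
  rewrite (_ : _ / _ = x) //; apply: (canLR (mulfK _)); last by lra.
  by rewrite mulf_neq0 ?gt_eqF // ltr0n.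
apply: (H (a' * l - a * l') (u' * l - u * l')%N); first by lia.
rewrite natrB 1?ltnW // !natrM rmorphB !rmorphM /=.
have T0 : 0 < u'%:R * l%:R - u%:R * l'%:R :> R by rewrite subr_gt0 -!natrM ltr_nat.
rewrite (_ : _ / _ = x) //; apply: (canLR (mulfK _)); last by lra.
by rewrite mulf_neq0 ?gt_eqF // ltr0n.
Qed.

(** At a crossing the numerator is at most [2 * D * k ^ 2] in absolute value, and the denominator at
    least [2]. *)
Lemma s_ray (D : int) : row_gap A B D -> ray_affine s (D * (k ^ 2)%N)%:~R.
Proof.
move=> HD; apply: ray_affine_from_intervals => r Xr.
apply: (@affine_between R s k _ r (fun a l u => [/\ (0 < l <= k)%N, (u <= l)%N &
    `|a| <= l%:Z * D])) => //.
- exact: s_lipschitz.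
- by move=> a l u [].
- move=> x _; have [a [l [u [l1 u1 a1 E]]]] := spectral_line HD (sP x).
  by exists a, l, u.
move=> a l u a' l' u' x [/andP[l0 lk] ul aD] [/andP[l'0 l'k] ul' aD'] /andP[Xx _] ne.
apply/eqP => E.
have D0 : 0 <= D by nia.
have P1 : `|a' * l%:Z - a * l'%:Z| <= 2 * (D * (k ^ 2)%N%:Z).
  have nl (q : nat) : `|q%:Z| = q%:Z by rewrite ger0_norm.
  apply: le_trans (ler_normB _ _) _; rewrite !normrM !nl.
  have : l%:Z * l'%:Z <= (k ^ 2)%N%:Z by rewrite -PoszM lez_nat expnS expn1 leq_mul.
  nia.
have T1 : 1 <= `|u'%:R * l%:R - u%:R * l'%:R| :> R.
  have -> : u'%:R * l%:R - u%:R * l'%:R = ((u' * l)%N%:Z - (u * l')%N%:Z)%:~R :> R.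
    by rewrite !PoszM rmorphB !rmorphM.
  by apply: int_norm_ge1; rewrite subr_eq0 eqz_nat.
have X0 : 0 <= (D * (k ^ 2)%N%:Z)%:~R :> R by rewrite ler0z mulr_ge0 // le0z_nat.
have : `|(a' * l%:Z - a * l'%:Z)%:~R| <= (2 * (D * (k ^ 2)%N%:Z))%:~R :> R.
  by rewrite -intr_norm ler_int.
have x0 : 0 <= x by lra.
rewrite rmorphB !rmorphM /= E !normrM (ger0_norm x0) [`|2|]ger0_norm //.
have : 1 * x <= `|u'%:R * l%:R - u%:R * l'%:R| * x by rewrite ler_wpM2r.
move: Xx; rewrite rmorphM /=; lra.
Qed.

(** The bound [s x <= - x + D] excludes every line with [u < l] once [x > D * k], since it gives
    [2 (l - u) x <= l D - a <= 2 l D]. All remaining lines have slope [-1], and parallel lines do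
    not cross. *)
Lemma s_ray_no_bottom_col (D : int) : no_bottom_col B -> row_gap A B D ->
  ray_affine s (D * k)%:~R.
Proof.
move=> Bcol HD; apply: ray_affine_from_intervals => r Xr.
apply: (@affine_between R s k _ r (fun a l u => (0 < l <= k)%N /\ u = l)) => //.
- exact: s_lipschitz.
- by move=> a l u [? ->].
- move=> x /andP[Xx _]; have [a [l [u [l1 ul a1 E]]]] := spectral_line HD (sP x).
  exists a, l, u; split=> //; split=> //; apply/eqP; rewrite eqn_leq ul leqNgt.
  apply/negP => lu; have [l0 lk] := andP l1.
  have : s x <= - x + D%:~R.
    apply: (spectral_le_minus Bcol _ (sP x)) => i j h ij ih.
    by rewrite -rmorphB /= ler_int; apply: le_trans (ler_norm _) (HD _ _ _ ij ih).
  have lR : 0 < l%:R :> R by rewrite ltr0n.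
  rewrite -(ler_pM2l lR) E => E2.
  have a2 : `|a%:~R : R| <= l%:R * D%:~R by rewrite -intr_norm -[l%:R]/((l%:Z)%:~R) -rmorphM ler_int.
  have D0 : 0 <= D by nia.
  have D0' : 0 <= D%:~R :> R by rewrite ler0z.
  have lk' : l%:R * D%:~R <= k%:R * D%:~R :> R by rewrite ler_wpM2r // ler_nat.
  have lu' : u%:R + 1 <= l%:R :> R by rewrite natr1 ler_nat.
  have Ek : (D * k)%:~R = k%:R * D%:~R :> R by rewrite rmorphM mulrC.
  have kD0 : 0 <= k%:R * D%:~R :> R by rewrite mulr_ge0 ?ler0n.
  rewrite Ek in Xx; have x0 : 0 <= x by lra.
  have := ler_wpM2r x0 lu'; move: a2; rewrite ler_norml; lra.
move=> a l u a' l' u' x [_ ->] [_ ->]; by rewrite mulnC eqxx.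
Qed.

(** At [lam = C] the rows [(true, i)] pay at least [0] and the rows [(false, i)] at most [0]. Min
    may therefore use only rows of the second kind, at no loss, and from [C] on every payment of
    these rows decreases at the rate of [lam]. *)
Lemma s_ray_finite (C : int) : (0 < n)%N -> (0 < m)%N -> all_finite A -> all_finite B ->
  (forall i j h, intval A i j - intval B i h <= C) ->
  forall x, C%:~R <= x -> s x = s C%:~R - (x - C%:~R).
Proof.
move=> n0 m0 fA fB HC x Cx; apply: (value_unique (sP x)).
have HC' i j h : (intval A i j)%:~R - (intval B i h)%:~R <= C%:~R :> R.
  by rewrite -rmorphB /= ler_int.
have [[S [u [Sne Hu]]] [y Hy]] := sP C%:~R; split.
  exists S, u; split=> // j p jS pj; have [h [hS ph Hh]] := Hu j p jS pj.
  exists h; split=> //; move: Hh; rewrite !dbl_wE; case: p.1; lra.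
exists y => j; have [[b i] [ij Hi]] := Hy j.
have yy h : y h <= s C%:~R + y j \/ b = false.
  case: b ij Hi => ij Hi; [left|by right].
  have := Hi h (fB i h); rewrite dbl_wE /=; have := HC' i j h; lra.
exists (false, i); split; first exact: fB.
move=> h ih; case: b ij Hi yy => ij Hi yy.
  have [|//] := yy h; rewrite dbl_wE /=; have := HC' i h j; lra.
by have := Hi h ih; rewrite !dbl_wE /=; lra.
Qed.

(** At [c + e] all payments are [e] or [- e], so multiplying [e] by [nu] multiplies the whole
    game. *)
Lemma s_degenerate (c : int) (e nu : R) :
  (forall i j h, finite A i j -> finite B i h -> intval A i j - intval B i h = c) ->
  0 <= nu -> s (c%:~R + nu * e) = nu * s (c%:~R + e).
Proof.
move=> Hc nu0; apply: (value_unique (sP _)); rewrite -[nu * s _]addr0.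
have := @has_value_transport R _ _ _ id _ _ _ _ (@dbl_a m n A B) (@dbl_b m n A B)
  (dbl_wa A B (c%:~R + nu * e)) (dbl_wb A B (c%:~R + nu * e)) nu 0 _ _ nu0 _ _ _
  (sP (c%:~R + e)).
apply=> //; first by move=> p; exists p.
have Hc' i j h : finite A i j -> finite B i h ->
    (intval A i j)%:~R - (intval B i h)%:~R = c%:~R :> R.
  by move=> ij ih; rewrite -rmorphB /= Hc.
move=> [[] i] j h ij ih; rewrite !dbl_wE /=.
  have -> : (intval B i h)%:~R - (intval A i j)%:~R = - c%:~R :> R.
    by rewrite -(Hc' i j h ij ih); ring.
  ring.
by rewrite (Hc' i h j ih ij); ring.
Qed.

End SpectralFunction.

(** * Value iteration *)

Section ValueIteration.
Variables (R : realType) (I J : finType).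
Variables (ea eb : I -> J -> bool) (wa wb : I -> J -> R).
Hypotheses (ea_ex : forall j, exists i, ea i j)
  (eb_ex : forall i, exists k, eb i k)
  (w1 : forall i j k, ea i j -> eb i k -> `|wb i k - wa i j| <= 1).

(** [P t] places the iterate below [t rho + y] and, on the nodes of [S], above [t rho + u - max u];
    a turn preserves both. The width [2 * #|J|] is the bound on [y] for payments at most [1]. Only
    the three listed properties are exported, to be applied to the integers of the program. *)
Lemma value_iteration rho (j0 : J) : has_value ea eb wa wb rho ->
  exists P : nat -> (J -> R) -> Prop,
  [/\ forall x, (forall j, x j = 0) -> P 0%N x,
      forall t x x', P t x -> (forall j, turn_value ea eb wa wb x j (x' j)) -> P t.+1 x' &
      forall t x, P t x -> (exists j, t%:R * rho <= x j) /\
        (forall j, x j <= t%:R * rho + 2 * #|J|%:R)].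
Proof.
move=> Hrho; have [r [S [u [y [Hu Hy yb]]]]] := duality ea_ex eb_ex w1 j0.
have -> : rho = r by apply: value_unique Hrho _; split; [exists S, u|exists y].
have [Sne HuS] := Hu; have /set0Pn Sex := Sne.
have [jm [jmS Hjm]] := finite_max u Sex.
exists (fun t x => (forall j, x j <= t%:R * r + y j) /\
  forall j, j \in S -> t%:R * r + u j - u jm <= x j); split.
- move=> x x0; split=> j; rewrite x0 mul0r add0r; first by case/andP: (yb j).
  by move=> jS; rewrite subr_le0 Hjm.
- move=> t x x' [up low] step; split=> j.
    have [i [ij Hi]] := Hy j; have [_ /(_ i ij)[k [ik Hk]]] := step j.
    by have := up k; have := Hi k ik; rewrite -natr1; lra.
  move=> jS; have [[i [ij Hi]] _] := step j; have [k [kS ik Hk]] := HuS j i jS ij.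
  by have := low k kS; have := Hi k ik; rewrite -natr1; lra.
move=> t x [up low]; split; first by exists jm; have := low jm jmS; lra.
by move=> j; have := up j; case/andP: (yb j); lra.
Qed.

(* A fraction of denominator at most [k] is recovered from an approximation
   from above of precision better than [1 / k ^ 2]. *)
Lemma best_fraction (k T : nat) (V : R) (v : int) (rho : R) (a : int) (l : nat) (N : int) (d : nat) :
  V = v%:~R -> (0 < l <= k)%N -> l%:R * rho = a%:~R ->
  T%:R * rho <= V -> V <= T%:R * rho + 2 * #|J|%:R -> (2 * #|J| * k ^ 2 < T)%N ->
  (0 < d <= k)%N -> N * T%:Z <= v * d%:Z ->
  (forall l' : nat, (0 < l' <= k)%N -> (v * l'%:Z %/ T%:Z)%Z * d%:Z <= N * l'%:Z) ->
  rho = N%:~R / d%:R.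
Proof.
move=> VE /andP[l0 lk] la TV VT TT /andP[d0 dk] NT best.
have dR : 0 < d%:R :> R by rewrite ltr0n.
have lR : 0 < l%:R :> R by rewrite ltr0n.
have T0 : (0 < T)%N by apply: leq_ltn_trans TT.
have TR : 0 < T%:R :> R by rewrite ltr0n.
have aT : a * T%:Z <= v * l%:Z.
  rewrite -(ler_int R) !rmorphM /= -VE -la -[T%:~R]/(T%:R) -[l%:~R]/(l%:R).
  by have := ler_wpM2r (ltW lR) TV; lra.
have aN : a * d%:Z <= N * l%:Z.
  have := best l; rewrite l0 lk => /(_ isT); apply: le_trans.
  apply: ler_wpM2r => //; rewrite lez_divRL ?ltz_nat //.
apply/eqP; rewrite eq_le; apply/andP; split.
  rewrite ler_pdivlMr // -(ler_pM2l lR) mulrA la.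
  by move: aN; rewrite -(ler_int R) !rmorphM /= -[d%:~R]/(d%:R) -[l%:~R]/(l%:R); lra.
rewrite leNgt; apply/negP; rewrite ltr_pdivlMr // -(ltr_pM2l lR) mulrA la => lt.
have lt1 : a * d%:Z + 1 <= N * l%:Z.
  rewrite lezD1 -(ltr_int R) !rmorphM /= -[d%:~R]/(d%:R) -[l%:~R]/(l%:R); lra.
have h1 : a%:~R * d%:R + 1 <= N%:~R * l%:R :> R.
  by move: lt1; rewrite -(ler_int R) rmorphD !rmorphM.
have h2 : N%:~R * T%:R <= V * d%:R by move: NT; rewrite -(ler_int R) !rmorphM /= VE.
have h3 : 2 * #|J|%:R * k%:R * k%:R < T%:R :> R.
  by rewrite -!natrM -mulnA ltr_nat.
have h4 : d%:R * l%:R <= k%:R * k%:R :> R by rewrite -!natrM ler_nat leq_mul.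
have := ler_wpM2r (ltW TR) h1; have := ler_wpM2r (ltW lR) h2.
have := ler_wpM2r (ltW dR) VT => g1; have := ler_wpM2r (ltW lR) g1.
have J0 : 0 <= 2 * #|J|%:R :> R by rewrite mulr_ge0 ?ler0n.
have := ler_wpM2l J0 h4.
have -> : (T%:R * rho + 2 * #|J|%:R) * d%:R * l%:R =
   T%:R * d%:R * (l%:R * rho) + 2 * #|J|%:R * (d%:R * l%:R) by ring.
rewrite la; lra.
Qed.

End ValueIteration.

(** * Queries *)

Lemma bounded_intval m n M (A : 'M[option int]_(m, n)) i j :
  bounded_by M A -> `|intval A i j| <= M%:Z.
Proof.
rewrite /intval => H; have := H i j; case: (A i j) => [z|_] //= /(_ z erefl).
by rewrite -abszE lez_nat.
Qed.

Section Answers.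
Variables (R : realType) (O : oracle) (g : game) (M : nat).
Hypotheses (OP : oracle_correct R O) (wp : well_posed g)
  (bA : bounded_by M (gameA g)) (bB : bounded_by M (gameB g)).

Lemma answer_value rho :
  has_value (finite (gameA g)) (finite (gameB g))
    (fun i j => (intval (gameA g) i j)%:~R) (fun i j => (intval (gameB g) i j)%:~R) rho ->
  ratr (answer O g) = rho :> R.
Proof.
move=> /(shapley_is_r (@sharp_comp_shapley R _ _ (gameA g) (gameB g))) H.
by have [] := is_r_unique (OP wp) H.
Qed.

(** The value is an integer [P] divided by the number of turns [#|T|], and reducing the fraction
    only makes both terms smaller. These bounds limit the registers that receive the answer. *)
Lemma answer_bounds :
  [/\ 0 < denq (answer O g), denq (answer O g) <= (cols g)%:Z &
      `|numq (answer O g)| <= 2 * (cols g)%:Z * M%:Z].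
Proof.
have [n0 Acol Brow] := wp; set q := answer O g.
have [rho Hrho] := @has_value_exists R _ _ (finite (gameA g)) (finite (gameB g))
  (fun i j => (intval (gameA g) i j)%:~R) (fun i j => (intval (gameB g) i j)%:~R)
  (Ordinal n0) Acol Brow.
have [T [t [s [T0 Tk Ts E]]]] := value_formula Hrho.
pose P := \sum_(j in T) (intval (gameB g) (t j) (s (t j)) - intval (gameA g) (t j) j).
have {}E : #|T|%:R * rho = P%:~R.
  by rewrite E rmorph_sum /=; apply: eq_bigr => j _; rewrite rmorphB.
have Tn : (#|T| <= cols g)%N by move: Tk; rewrite leq_min !card_ord => /andP[].
have PM : `|P| <= 2 * #|T|%:Z * M%:Z.
  apply: le_trans (ler_norm_sum _ _ _) _.
  apply: (@le_trans _ _ (\sum_(j in T) (2 * M%:Z))); last by rewrite sumr_const; lia.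
  apply: ler_sum => j _; apply: le_trans (ler_normB _ _) _.
  have := @bounded_intval _ _ _ _ (t j) j bA.
  have := @bounded_intval _ _ _ _ (t j) (s (t j)) bB; lia.
have Eq : numq q * #|T|%:Z = P * denq q.
  apply: (@intr_inj R); rewrite !rmorphM /= -E -(answer_value Hrho) -/q /ratr.
  by rewrite -[#|T|%:~R]/(#|T|%:R); field; rewrite intr_eq0 denq_neq0.
have q0 := denq_gt0 q.
have dT : (denq q %| #|T|%:Z)%Z.
  rewrite -(@Gauss_dvdzr _ (numq q)); first by rewrite Eq dvdz_mull.
  by rewrite coprimez_sym /coprimez /gcdz (eqP (coprime_num_den q)).
have dlT : denq q <= #|T|%:Z.
  have [c ce] := dvdzP dT.
  have : 0 < c * denq q by rewrite -ce ltz_nat.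
  by rewrite pmulr_lgt0 // ce => c0; rewrite ler_peMl // ltW.
have T0' : 0 < #|T|%:Z by rewrite ltz_nat.
have numP : `|numq q| <= `|P|.
  rewrite -(ler_pM2r T0'); apply: (@le_trans _ _ `|P * denq q|).
    by rewrite -Eq normrM (gtr0_norm T0').
  by rewrite normrM (gtr0_norm q0) ler_wpM2l.
split=> //; first by apply: le_trans dlT _; rewrite lez_nat.
apply: le_trans numP (le_trans PM _); rewrite ler_wpM2r // ler_wpM2l // lez_nat.
Qed.

End Answers.

(** * Integer games for a rational shift *)

Section ScaledGame.
Variables (R : realType) (m n : nat) (A B : 'M[option int]_(m, n)).
Variables (gA gB : 'M[option int]_(2 * m, n)) (t : nat) (n1 n2 n3 n4 : int).
Hypotheses (t0 : (0 < t)%N)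
  (gA1 : forall (p : 'I_(2 * m)) (i : 'I_m) j, p = i :> nat ->
     gA p j = omap (fun a => t%:Z * a - n1) (A i j))
  (gA2 : forall (p : 'I_(2 * m)) (i : 'I_m) j, p = (m + i)%N :> nat ->
     gA p j = omap (fun b => t%:Z * b + n3) (B i j))
  (gB1 : forall (p : 'I_(2 * m)) (i : 'I_m) j, p = i :> nat ->
     gB p j = omap (fun b => t%:Z * b + n2) (B i j))
  (gB2 : forall (p : 'I_(2 * m)) (i : 'I_m) j, p = (m + i)%N :> nat ->
     gB p j = omap (fun a => t%:Z * a - n4) (A i j)).

Lemma dbl_row_lt (p : bool * 'I_m) : ((if p.1 then p.2 : nat else m + p.2) < 2 * m)%N.
Proof.
by case: p => -[] i /=; rewrite mul2n -addnn; [apply: ltn_addr|rewrite ltn_add2l].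
Qed.

Definition dbl_row p : 'I_(2 * m) := Ordinal (dbl_row_lt p).

Lemma dbl_row_surj q : exists p, dbl_row p = q.
Proof.
have [qm|qm] := ltnP q m.
  by exists (true, Ordinal qm); apply: val_inj.
have q' : (q - m < m)%N by rewrite ltn_subLR // addnn -mul2n.
by exists (false, Ordinal q'); apply: val_inj; rewrite /= subnKC.
Qed.

Lemma scaled_a p j : gA (dbl_row p) j =
  if p.1 then omap (fun a => t%:Z * a - n1) (A p.2 j)
  else omap (fun b => t%:Z * b + n3) (B p.2 j).
Proof. by case: p => -[] i; [apply: gA1|apply: gA2]. Qed.

Lemma scaled_b p j : gB (dbl_row p) j =
  if p.1 then omap (fun b => t%:Z * b + n2) (B p.2 j)
  else omap (fun a => t%:Z * a - n4) (A p.2 j).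
Proof. by case: p => -[] i; [apply: gB1|apply: gB2]. Qed.

(** After scaling by [t], rows of the first kind receive [n1 + n2] and those of the second
    [- n3 - n4], instead of [N / 2] and [- N / 2]. Both errors equal [(n1 + n2 - n3 - n4) / 2], so
    they translate the value. *)
Lemma scaled_value rho (N : int) : N = n1 + n2 + n3 + n4 ->
  spectral A B (N%:~R / (2 * t%:R)) rho ->
  has_value (finite gA) (finite gB)
    (fun i j => (intval gA i j)%:~R) (fun i j => (intval gB i j)%:~R)
    (t%:R * rho + (n1 + n2 - n3 - n4)%:~R / 2 : R).
Proof.
move=> NE; apply: (has_value_transport (h := dbl_row)).
- exact: dbl_row_surj.
- exact: ler0n.
- by move=> [[] i] j; rewrite /finite scaled_a /dbl_a /finite /=; case: (_ i j).
- by move=> [[] i] j; rewrite /finite scaled_b /dbl_b /finite /=; case: (_ i j).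
have tR : t%:R != 0 :> R by rewrite pnatr_eq0 -lt0n.
have tN : t%:R * (N%:~R / (2 * t%:R)) = N%:~R / 2 :> R by field.
move=> p j k pj pk; rewrite dbl_wE /intval scaled_a scaled_b.
case: p pj pk => -[] i; rewrite /dbl_a /dbl_b /finite /=.
  case: (A i j) => [a _|//]; case: (B i k) => [b _|//] /=.
  by rewrite mulrDr tN NE !(rmorphD, rmorphN, rmorphM) /=; field.
case: (B i j) => [b _|//]; case: (A i k) => [a _|//] /=.
by rewrite mulrDr mulrN tN NE !(rmorphD, rmorphN, rmorphM) /=; field.
Qed.

Hypotheses (n_gt0 : (0 < n)%N) (Arow : no_bottom_row A) (Brow : no_bottom_row B)
  (ABcol : no_common_bottom_col A B).

Lemma scaled_well_posed : well_posed (Game gA gB).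
Proof.
split=> //= [j|q].
  have [p pj] := dbl_a_ex ABcol j; exists (dbl_row p); rewrite scaled_a.
  by move: pj; rewrite /dbl_a /finite; case: p.1; case: (_ p.2 j).
have [p <-] := dbl_row_surj q; have [k pk] := dbl_b_ex Arow Brow p.
exists k; rewrite scaled_b; move: pk.
by rewrite /dbl_b /finite; case: p.1; case: (_ p.2 k).
Qed.

Lemma scaled_bounded (M M' : nat) : bounded_by M A -> bounded_by M B ->
  `|n1| + t%:Z * M%:Z <= M'%:Z -> `|n2| + t%:Z * M%:Z <= M'%:Z ->
  `|n3| + t%:Z * M%:Z <= M'%:Z -> `|n4| + t%:Z * M%:Z <= M'%:Z ->
  bounded_by M' gA /\ bounded_by M' gB.
Proof.
move=> bA bB b1 b2 b3 b4.
have tx (x : int) : (`|x| <= M)%N -> `|t%:Z * x| <= t%:Z * M%:Z.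
  by move=> xM; rewrite normrM ger0_norm // ler_wpM2l // -abszE lez_nat.
split=> q j z; have [p <-] := dbl_row_surj q.
  rewrite scaled_a; case: p.1.
    case E: (A p.2 j) => [a|] //= [<-]; rewrite -lez_nat abszE.
    by apply: le_trans b1; apply: le_trans (ler_normB _ _) _; rewrite addrC lerD2l tx ?(bA _ _ _ E).
  case E: (B p.2 j) => [a|] //= [<-]; rewrite -lez_nat abszE.
  by apply: le_trans b3; apply: le_trans (ler_normD _ _) _; rewrite addrC lerD2l tx ?(bB _ _ _ E).
rewrite scaled_b; case: p.1.
  case E: (B p.2 j) => [a|] //= [<-]; rewrite -lez_nat abszE.
  by apply: le_trans b2; apply: le_trans (ler_normD _ _) _; rewrite addrC lerD2l tx ?(bB _ _ _ E).
case E: (A p.2 j) => [a|] //= [<-]; rewrite -lez_nat abszE.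
by apply: le_trans b4; apply: le_trans (ler_normB _ _) _; rewrite addrC lerD2l tx ?(bA _ _ _ E).
Qed.

End ScaledGame.

(** * Program logic *)

(** The registers that a command may write, read off its syntax, so that framing conditions reduce
    to computation. *)
Fixpoint modr (c : cmd) : seq nat :=
  match c with
  | CSet x _ => [:: x]
  | CSeq c1 c2 | CIf _ c1 c2 => modr c1 ++ modr c2
  | CWhile _ c1 => modr c1
  | CCall _ _ _ _ x y => [:: x; y]
  | CSkip | CPut _ _ _ => [::]
  end.

Fixpoint moda (c : cmd) : seq nat :=
  match c with
  | CPut a _ _ => [:: a]
  | CSeq c1 c2 | CIf _ c1 c2 => moda c1 ++ moda c2
  | CWhile _ c1 => moda c1
  | CSkip | CSet _ _ | CCall _ _ _ _ _ _ => [::]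
  end.

Definition same (xs ys : seq nat) (s s' : state) :=
  (forall x, x \notin xs -> reg s' x = reg s x) /\
  (forall a, a \notin ys -> arr s' a = arr s a).

Lemma same_refl xs ys s : same xs ys s s.
Proof. by []. Qed.

Lemma same_trans xs ys s1 s2 s3 :
  same xs ys s1 s2 -> same xs ys s2 s3 -> same xs ys s1 s3.
Proof.
move=> [r1 a1] [r2 a2]; split=> [x xi|a ai]; first by rewrite r2 ?r1.
by rewrite a2 ?a1.
Qed.

Lemma same_sub xs ys xs' ys' s s' : {subset xs <= xs'} -> {subset ys <= ys'} ->
  same xs ys s s' -> same xs' ys' s s'.
Proof.
move=> sx sy [r1 a1]; split=> [x xi|a ai]; first by apply: r1; apply: contra xi; apply: sx.
by apply: a1; apply: contra ai; apply: sy.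
Qed.

Lemma set_arr_same xs s a k v : same xs [:: a] s (set_arr s a k v).
Proof.
split=> // b; rewrite inE => /negPf ba /=; apply/boolp.funext => l; by rewrite ba.
Qed.

Lemma exec_same O c s s' tr w : exec O c s s' tr w -> same (modr c) (moda c) s s'.
Proof.
elim=> {c s s' tr w} //=.
- by move=> s x e; split=> // y; rewrite inE => /negPf /= ->.
- by move=> s a e1 e2; apply: set_arr_same.
- move=> c1 c2 s1 s2 s3 _ _ _ _ _ H1 _ H2; apply: (same_trans (s2 := s2)).
    by apply: same_sub H1 => x xi; rewrite mem_cat xi.
  by apply: same_sub H2 => x xi; rewrite mem_cat xi orbT.
- move=> s e c1 c2 s' tr w _; case: ifP => _; apply: same_sub => x xi;
  by rewrite mem_cat xi ?orbT.
- by move=> s1 s2 s3 e c _ _ _ _ _ _ H1 _ H2; apply: same_trans H1 H2.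
- move=> s em en a b x y; split=> // z; rewrite !inE negb_or => /andP[/negPf zx /negPf zy].
  by rewrite /= zx zy.
Qed.

Lemma absz_divz_le (u v : int) : (`|(u %/ v)%Z| <= `|u|)%N.
Proof.
case: v => [[|v]|v].
- by rewrite divz0.
- case: u => u; first by rewrite divz_nat leq_div.
  by rewrite NegzE divNz_nat //= ltnS leq_div.
rewrite NegzE divzN abszN.
case: u => u; first by rewrite divz_nat leq_div.
by rewrite NegzE divNz_nat //= ltnS leq_div.
Qed.

(** * Hoare triples with bounds on sizes and costs *)

Section Logic.
Variables (O : oracle) (Y : nat) (dr da : nat -> nat) (U0 : nat).
Hypothesis Y8 : (8 <= Y)%N.

Definition fits d (z : int) := (`|z| <= Y ^ d)%N.

Definition bnd s := (forall x, fits (dr x) (reg s x)) /\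
  forall a i, fits (da a) (arr s a i).

(** An exponent of [Y] bounding the value, by syntax alone. A sum costs one more factor [Y], a
    quotient is no larger than its dividend, and a comparison is at most [1 = Y ^ 0]. *)
Fixpoint edeg (e : expr) : nat :=
  match e with
  | ECst _ => 1
  | EReg x => dr x
  | EArr a _ => da a
  | EOp OMul e1 e2 => edeg e1 + edeg e2
  | EOp ODiv e1 _ => edeg e1
  | EOp OLe _ _ => 0
  | EOp _ e1 e2 => (maxn (edeg e1) (edeg e2)).+1
  end.

(** The cost in units of [L], the binary length of [Y]: a number of exponent [d] has at most
    [(d + 1) * L] binary digits. *)
Fixpoint ecost (e : expr) : nat :=
  (edeg e).+1 +
  match e with
  | ECst _ | EReg _ => 0
  | EArr _ e1 => ecost e1
  | EOp _ e1 e2 => ecost e1 + ecost e2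
  end.

Fixpoint econst (e : expr) : bool :=
  match e with
  | ECst z => (`|z| <= 8)%N
  | EReg _ => true
  | EArr _ e1 => econst e1
  | EOp _ e1 e2 => econst e1 && econst e2
  end.

Definition affordable e := econst e && (ecost e < U0)%N.

Lemma small_le d d' z : (d <= d')%N -> fits d z -> fits d' z.
Proof. by move=> dd /leq_trans; apply; rewrite leq_pexp2l //; lia. Qed.

Lemma Ypow2 d1 d2 : (Y ^ d1 + Y ^ d2 <= Y ^ (maxn d1 d2).+1)%N.
Proof.
have H1 : (Y ^ d1 <= Y ^ maxn d1 d2)%N by rewrite leq_pexp2l ?leq_maxl //; lia.
have H2 : (Y ^ d2 <= Y ^ maxn d1 d2)%N by rewrite leq_pexp2l ?leq_maxr //; lia.
by rewrite expnS; nia.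
Qed.

Lemma eval_small s e : bnd s -> econst e -> fits (edeg e) (eval s e).
Proof.
move=> [br ba]; elim: e => [z|x|a e IH|o e1 IH1 e2 IH2] //=.
  by rewrite /fits expn1 => H; apply: leq_trans H _.
case/andP=> /IH1 H1 /IH2 H2; case: o => /=.
- apply: leq_trans (Ypow2 _ _); apply: leq_trans (leq_add H1 H2).
  by rewrite -lez_nat PoszD !abszE ler_normD.
- apply: leq_trans (Ypow2 _ _); apply: leq_trans (leq_add H1 H2).
  by rewrite -lez_nat PoszD !abszE ler_normB.
- by rewrite /fits abszM expnD leq_mul.
- exact: leq_trans (absz_divz_le _ _) H1.
- by case: ifP; rewrite /fits expn0.
Qed.

Let L := (trunc_log 2 Y).+1.

Lemma bitlen_small d z : fits d z -> (bitlen z <= d.+1 * L)%N.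
Proof.
move=> H; rewrite /bitlen mulSn.
have : (trunc_log 2 `|z| <= d * L)%N.
  apply: leq_trans (leq_trunc_log 2 H) _.
  have YL : (Y <= 2 ^ L)%N by apply: ltnW; apply: trunc_log_ltn.
  have : (Y ^ d <= 2 ^ (d * L))%N.
    by rewrite mulnC expnM; case: (d) => // d'; rewrite leq_exp2r.
  by move=> /(leq_trunc_log 2); rewrite trunc_expnK.
by move=> /leq_trans H'; rewrite {1}/L addSn ltnS; apply: H'; apply: leq_addl.
Qed.

Lemma cost_le s e : bnd s -> econst e -> (cost s e <= ecost e * L)%N.
Proof.
move=> bs; elim: e => [z|x|a e IH|o e1 IH1 e2 IH2] ce /=; rewrite mulnDl;
  have H := bitlen_small (eval_small bs ce); apply: leq_add => //.
- exact: IH.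
- by case/andP: ce => /IH1 ? /IH2 ?; rewrite mulnDl leq_add.
Qed.

Definition unit_cost := (U0 * L)%N.
Let U := unit_cost.

Lemma cost_lt s e : bnd s -> affordable e -> (cost s e < U)%N.
Proof.
move=> bs /andP[ce eU]; apply: leq_ltn_trans (cost_le bs ce) _.
by rewrite ltn_pmul2r.
Qed.

Lemma bnd_set s x v : bnd s -> fits (dr x) v -> bnd (set_reg s x v).
Proof. by move=> [br ba] sv; split=> //= y; case: eqP => [->|]. Qed.

Lemma bnd_put s a k v : bnd s -> fits (da a) v -> bnd (set_arr s a k v).
Proof. by move=> [br ba] sv; split=> //= b l; case: andP => [[/eqP-> _]|]. Qed.

(** A total-correctness triple: termination within [b] units of cost, preservation of the size
    bounds and framing are built in, and the postcondition sees the queries submitted. *)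
Definition hoare c s (b : nat) (Q : state -> seq game -> Prop) :=
  exists s' tr w, [/\ exec O c s s' tr w, (w <= b * U)%N, bnd s',
    same (modr c) (moda c) s s' & Q s' tr].

Definition pure (Q : state -> Prop) s (tr : seq game) := tr = [::] /\ Q s.

Lemma hoare_intro c s b Q s' tr w : exec O c s s' tr w -> (w <= b * U)%N ->
  bnd s' -> Q s' tr -> hoare c s b Q.
Proof. by move=> H *; exists s', tr, w; split=> //; apply: exec_same H. Qed.

Lemma hoare_weaken c s b b' (Q Q' : state -> seq game -> Prop) :
  hoare c s b Q -> (b <= b')%N ->
  (forall s' tr, bnd s' -> same (modr c) (moda c) s s' -> Q s' tr -> Q' s' tr) ->
  hoare c s b' Q'.
Proof.
move=> [s' [tr [w [ex wb bs' sm q]]]] bb HQ; exists s', tr, w; split=> //.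
  by apply: leq_trans wb _; rewrite leq_mul2r bb orbT.
exact: HQ.
Qed.

Lemma hoare_set x e s Q : bnd s -> affordable e -> fits (dr x) (eval s e) ->
  Q (set_reg s x (eval s e)) [::] -> hoare (CSet x e) s 1 Q.
Proof.
move=> bs ok sm q; apply: hoare_intro (exec_set _ _ _ _) _ _ q.
  by rewrite mul1n cost_lt.
exact: bnd_set.
Qed.

Lemma hoare_put a e1 e2 s Q : bnd s -> affordable (EOp OAdd e1 e2) -> fits (da a) (eval s e2) ->
  Q (set_arr s a (eval s e1) (eval s e2)) [::] -> hoare (CPut a e1 e2) s 1 Q.
Proof.
move=> bs ok sm q; apply: hoare_intro (exec_put _ _ _ _ _) _ _ q.
  rewrite mul1n; apply: leq_trans (cost_lt bs ok); rewrite ltnS /=; lia.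
exact: bnd_put.
Qed.

Lemma hoare_skip s Q : bnd s -> (0 < U0)%N -> Q s [::] -> hoare CSkip s 1 Q.
Proof.
move=> bs U00 q; apply: hoare_intro (exec_skip _ _) _ _ q => //.
by rewrite mul1n /U /unit_cost muln_gt0 U00.
Qed.

Lemma hoare_seq c1 c2 s b1 b2 Q : (0 < U0)%N ->
  hoare c1 s b1 (fun s1 tr1 => hoare c2 s1 b2 (fun s2 tr2 => Q s2 (tr1 ++ tr2))) ->
  hoare (CSeq c1 c2) s (b1 + b2).+1 Q.
Proof.
move=> U00 [s1 [tr1 [w1 [ex1 wb1 bs1 sm1 [s2 [tr2 [w2 [ex2 wb2 bs2 sm2 q]]]]]]]].
apply: hoare_intro (exec_seq ex1 ex2) _ _ q => //.
rewrite mulSn mulnDl -add1n leq_add ?leq_add //.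
by rewrite /U /unit_cost muln_gt0 U00.
Qed.

Lemma hoare_if e c1 c2 s b Q : bnd s -> affordable e ->
  (eval s e != 0 -> hoare c1 s b Q) -> (eval s e = 0 -> hoare c2 s b Q) ->
  hoare (CIf e c1 c2) s b.+1 Q.
Proof.
move=> bs ok H1 H2.
have : hoare (if eval s e != 0 then c1 else c2) s b Q.
  by case: eqP => [/H2|/eqP/H1].
move=> [s1 [tr1 [w1 [ex1 wb1 bs1 sm1 q]]]].
apply: hoare_intro (exec_if ex1) _ _ q => //.
by rewrite mulSn -addSn leq_add // cost_lt.
Qed.

Lemma hoare_call em en a b x y s g (Q : state -> seq game -> Prop) : bnd s ->
  query s em en a b = g -> [&& econst em, econst en & (ecost em + ecost en + 6 <= U0)%N] ->
  fits 1 (numq (answer O g)) -> fits 1 (denq (answer O g)) ->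
  (0 < dr x)%N -> (0 < dr y)%N ->
  Q (set_reg (set_reg s x (numq (answer O g))) y (denq (answer O g))) [:: g] ->
  hoare (CCall em en a b x y) s 1 Q.
Proof.
move=> bs gE /and3P[cm cn cU] s1 s2 dx dy q.
have ex := exec_call O s em en a b x y; rewrite gE in ex.
apply: hoare_intro ex _ _ q.
  have := cost_le bs cm; have := cost_le bs cn.
  have := bitlen_small s1; have := bitlen_small s2.
  have : ((ecost em + ecost en + 6) * L <= U)%N by rewrite leq_mul2r cU orbT.
  have : (0 < L)%N by [].
  rewrite mul1n !mulnDl; lia.
by do 2 (apply: bnd_set; last exact: small_le s1 || exact: small_le s2).
Qed.

(** For loops that submit exactly one query per round: the measure bounds the number of queries, and
    the cost is expressed through the length of the trace. *)
Lemma hoare_while e body s b (good : game -> Prop) (I : state -> Prop)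
    (mu : state -> nat) : affordable e ->
  (forall s1, bnd s1 -> I s1 -> eval s1 e != 0 -> hoare body s1 b
     (fun s2 tr => exists g, [/\ tr = [:: g], good g, I s2 & (mu s2 < mu s1)%N])) ->
  bnd s -> I s -> exists s' tr w,
    [/\ exec O (CWhile e body) s s' tr w, (w <= ((size tr).+1 * b.+2) * U)%N, bnd s',
        I s' /\ eval s' e = 0 & (size tr <= mu s)%N /\ List.Forall good tr].
Proof.
move=> ok step; move: {2}(mu s) (leqnn (mu s)) => M; elim: M s => [|M IH] s sM bs Is.
  have [e0|e1] := eqVneq (eval s e) 0.
    exists s, [::], (cost s e).+1; split=> //; first exact: exec_while_stop.
    by rewrite mul1n mulSn; apply: leq_trans (cost_lt bs ok) _; rewrite leq_addr.
  by have [s2 [tr [w [_ _ _ _ [g [_ _ _]]]]]] := step s bs Is e1; lia.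
have [e0|e1] := eqVneq (eval s e) 0.
  exists s, [::], (cost s e).+1; split=> //; first exact: exec_while_stop.
  by rewrite mul1n mulSn; apply: leq_trans (cost_lt bs ok) _; rewrite leq_addr.
have [s2 [tr [w [ex wb bs2 _ [g [trE gg Is2 mu2]]]]]] := step s bs Is e1.
rewrite {}trE in ex.
have [|s3 [tr3 [w3 [ex3 wb3 bs3 I3 [sz3 F3]]]]] := IH s2 _ bs2 Is2; first lia.
exists s3, (g :: tr3), (cost s e + w + w3).+1; split=> //.
- by apply: (exec_while_loop e1 ex ex3).
- rewrite [size (g :: tr3)]/= [((size tr3).+2 * _)%N]mulSn mulnDl -addSn leq_add //.
  by have := cost_lt bs ok; rewrite -/U !mulSn; move: wb; rewrite -/U; lia.
- by split; [apply: leq_trans mu2|constructor].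
Qed.

(** The guard [x + 1 <= r] expresses [x < r], comparison being available only as [<=]. *)
Definition For x r body :=
  CSeq (CSet x (ECst 0))
    (CWhile (EOp OLe (EOp OAdd (EReg x) (ECst 1)) (EReg r))
       (CSeq body (CSet x (EOp OAdd (EReg x) (ECst 1))))).

(** The body must establish the invariant at [i + 1] for the state with the counter already
    increased, which absorbs the assignment that ends a round. *)
Lemma hoare_for x r body s nb b (I : nat -> state -> Prop) :
  reg s r = nb%:Z -> bnd s ->
  affordable (EOp OLe (EOp OAdd (EReg x) (ECst 1)) (EReg r)) ->
  x \notin modr body -> r \notin x :: modr body -> (dr r <= dr x)%N ->
  I 0%N (set_reg s x 0) ->
  (forall i s1, (i < nb)%N -> bnd s1 -> same (x :: modr body) (moda body) s s1 ->
     reg s1 x = i%:Z -> I i s1 ->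
     hoare body s1 b (pure (fun s2 => I i.+1 (set_reg s2 x i.+1%:Z)))) ->
  hoare (For x r body) s (nb * (b + 4) + 4)
    (pure (fun s' => I nb s' /\ reg s' x = nb%:Z)).
Proof.
move=> rs bs ok xb rb drx I0 step.
have U00 : (0 < U0)%N by apply: leq_ltn_trans (andP ok).2.
have ok1 : affordable (EOp OAdd (EReg x) (ECst 1)).
  by move/andP: ok => [ce cl]; rewrite /affordable /=; apply: leq_ltn_trans cl; rewrite /=; lia.
have ok0 : affordable (ECst 0) by move/andP: ok1 => [_ cl]; rewrite /affordable /=; apply: leq_ltn_trans cl; rewrite /=; lia.
have snb i : (i <= nb)%N -> fits (dr x) i%:Z.
  move=> ib; apply: (small_le drx); have := proj1 bs r; rewrite rs /fits /=.
  exact: leq_trans.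
rewrite /For; set W := CWhile _ _.
have main j i s1 : (i + j = nb)%N -> bnd s1 -> same (x :: modr body) (moda body) s s1 ->
    reg s1 x = i%:Z -> I i s1 ->
    hoare W s1 (j * (b + 4) + 1) (pure (fun s' => I nb s' /\ reg s' x = nb%:Z)).
  elim: j i s1 => [|j IH] i s1 ij bs1 sm xi Ii.
    have e0 : eval s1 (EOp OLe (EOp OAdd (EReg x) (ECst 1)) (EReg r)) = 0.
      by rewrite /= xi (proj1 sm r rb) rs; case: ifP => //; lia.
    apply: (hoare_intro (exec_while_stop _ _ e0)) => //.
      by rewrite mul1n cost_lt.
    by split=> //; rewrite -ij addn0.
  have e1 : eval s1 (EOp OLe (EOp OAdd (EReg x) (ECst 1)) (EReg r)) != 0.
    by rewrite /= xi (proj1 sm r rb) rs; case: ifP => //; lia.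
  have ib : (i < nb)%N by lia.
  have [s2 [tr2 [w2 [ex2 wb2 bs2 sm2 [tr2E I2]]]]] := step i s1 ib bs1 sm xi Ii.
  rewrite {}tr2E in ex2.
  have x2 : reg s2 x = i%:Z by rewrite (proj1 sm2 x xb).
  have ev : eval s2 (EOp OAdd (EReg x) (ECst 1)) = i.+1%:Z by rewrite /= x2; lia.
  pose s3 := set_reg s2 x i.+1%:Z.
  have ex3 : exec O (CSet x (EOp OAdd (EReg x) (ECst 1))) s2 s3 [::]
     (cost s2 (EOp OAdd (EReg x) (ECst 1))).+1.
    by rewrite /s3 -ev; apply: exec_set.
  have bs3 : bnd s3 by apply: bnd_set => //; apply: snb.
  have sm3 : same (x :: modr body) (moda body) s s3.
    apply: same_trans sm _; apply: (same_trans (s2 := s2)).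
      by apply: same_sub sm2 => // y yb; rewrite inE yb orbT.
    by split=> // y; rewrite inE negb_or => /andP[/negPf /= ->].
  have [||s4 [tr4 [w4 [ex4 wb4 bs4 sm4 [tr40 q]]]]] := IH i.+1 s3 _ bs3 sm3 _ I2.
  - by lia.
  - by rewrite /= eqxx.
  rewrite {}tr40 in ex4.
  apply: (hoare_intro (exec_while_loop e1 (exec_seq ex2 ex3) ex4)) => //.
    have := cost_lt bs1 ok; have := cost_lt bs2 ok1; move: wb2 wb4; rewrite -/U.
    have -> : (j.+1 * (b + 4) + 1 = (j * (b + 4) + 1) + (b + 4))%N by lia.
    rewrite [((_ + (b + 4)) * _)%N]mulnDl [((b + 4) * _)%N]mulnDl; lia.
have -> : (nb * (b + 4) + 4 = (1 + (nb * (b + 4) + 1)).+2)%N by lia.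
apply: (hoare_weaken (b := (1 + (nb * (b + 4) + 1)).+1)
  (Q := pure (fun s' => I nb s' /\ reg s' x = nb%:Z))) => //.
apply: hoare_seq => //; apply: hoare_set => //.
apply: (main nb 0%N) => //.
- exact: bnd_set.
- by split=> // y; rewrite inE negb_or => /andP[/negPf /= ->].
- by rewrite /= eqxx.
Qed.

End Logic.

(** * Rules for recurring program fragments *)

Section Macros.
Variables (O : oracle) (Y : nat) (dr da : nat -> nat) (U0 : nat).
Hypotheses (Y8 : (8 <= Y)%N) (U00 : (0 < U0)%N).
Notation hoare := (hoare O Y dr da U0).
Notation bnd := (bnd Y dr da).
Notation small := (fits Y).
Notation eok := (affordable dr da U0).

Lemma hoare_seq_set x e c s b Q : bnd s -> eok e -> small (dr x) (eval s e) ->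
  (bnd (set_reg s x (eval s e)) -> hoare c (set_reg s x (eval s e)) b Q) ->
  hoare (CSeq (CSet x e) c) s b.+2 Q.
Proof.
move=> bs ok sm H; apply: (@hoare_seq O Y dr da U0 _ _ _ 1 b) => //.
by apply: hoare_set => //; apply: H; apply: bnd_set.
Qed.

Lemma hoare_seq_put a e1 e2 c s b Q : bnd s -> eok (EOp OAdd e1 e2) ->
  small (da a) (eval s e2) ->
  (bnd (set_arr s a (eval s e1) (eval s e2)) ->
   hoare c (set_arr s a (eval s e1) (eval s e2)) b Q) ->
  hoare (CSeq (CPut a e1 e2) c) s b.+2 Q.
Proof.
move=> bs ok sm H; apply: (@hoare_seq O Y dr da U0 _ _ _ 1 b) => //.
by apply: hoare_put => //; apply: H; apply: bnd_put.
Qed.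

Lemma hoare_seq_setv v x e c s b Q : bnd s -> eok e -> eval s e = v -> small (dr x) v ->
  (bnd (set_reg s x v) -> hoare c (set_reg s x v) b Q) ->
  hoare (CSeq (CSet x e) c) s b.+2 Q.
Proof. by move=> bs ok <-; apply: hoare_seq_set. Qed.

Lemma hoare_seq_aset x e c s b Q : bnd s -> eok e && (edeg dr da e <= dr x)%N ->
  (bnd (set_reg s x (eval s e)) -> hoare c (set_reg s x (eval s e)) b Q) ->
  hoare (CSeq (CSet x e) c) s b.+2 Q.
Proof.
move=> bs /andP[ok deg]; apply: hoare_seq_set => //.
by apply: small_le deg _ => //; apply: eval_small => //; case/andP: ok.
Qed.

Lemma hoare_seq_aput a e1 e2 c s b Q : bnd s ->
  eok (EOp OAdd e1 e2) && (edeg dr da e2 <= da a)%N ->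
  (bnd (set_arr s a (eval s e1) (eval s e2)) ->
   hoare c (set_arr s a (eval s e1) (eval s e2)) b Q) ->
  hoare (CSeq (CPut a e1 e2) c) s b.+2 Q.
Proof.
move=> bs /andP[ok deg]; apply: hoare_seq_put => //.
apply: small_le deg _ => //; apply: eval_small => //.
by case/andP: ok => /andP[].
Qed.

Lemma hoare_aset x e s b (Q : state -> seq game -> Prop) : bnd s -> (0 < b)%N ->
  eok e && (edeg dr da e <= dr x)%N ->
  Q (set_reg s x (eval s e)) [::] -> hoare (CSet x e) s b Q.
Proof.
move=> bs b0 /andP[ok deg] q; apply: (hoare_weaken (b := 1) (Q := Q)) => //.
apply: hoare_set => //.
by apply: small_le deg _ => //; apply: eval_small => //; case/andP: ok.
Qed.

Lemma hoare_seq_pure c1 c2 s b1 b2 P Q : hoare c1 s b1 (pure P) ->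
  (forall s1, bnd s1 -> same (modr c1) (moda c1) s s1 -> P s1 -> hoare c2 s1 b2 Q) ->
  hoare (CSeq c1 c2) s (b1 + b2).+1 Q.
Proof.
move=> H1 H2; apply: hoare_seq => //; apply: hoare_weaken H1 _ _ => // s1 tr1 bs1 sm [-> P1].
exact: H2.
Qed.

Lemma small1 d : small d 1.
Proof. by rewrite /small /= expn_gt0; apply/orP; left; apply: leq_trans Y8. Qed.

Definition for_ok p r := eok (EOp OLe (EOp OAdd (EReg p) (ECst 1)) (EReg r)) &&
  (dr r <= dr p)%N.

Definition Fill p r a base e := For p r (CPut a (EOp OAdd base (EReg p)) e).

Lemma hoare_fill p r a base e s nb b0 (v : nat -> int) :
  reg s r = nb%:Z -> bnd s -> for_ok p r -> r != p ->
  eok (EOp OAdd (EOp OAdd base (EReg p)) e) ->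
  (forall s1, same [:: p] [:: a] s s1 -> eval s1 base = b0) ->
  (forall i s1, (i < nb)%N -> bnd s1 -> same [:: p] [:: a] s s1 -> reg s1 p = i%:Z ->
     eval s1 e = v i /\ small (da a) (v i)) ->
  hoare (Fill p r a base e) s (nb * 5 + 4) (pure (fun s' => forall l : int,
    arr s' a l = if (b0 <= l) && (l < b0 + nb%:Z) then v (absz (l - b0)) else arr s a l)).
Proof.
move=> rs bs /andP[ok drp] rp oke Hb Hv.
pose I (i : nat) s' := forall l : int,
  arr s' a l = if (b0 <= l) && (l < b0 + i%:Z) then v (absz (l - b0)) else arr s a l.
apply: hoare_weaken (hoare_for Y8 (I := I) (b := 1) rs bs ok _ _ drp _ _) _ _ => //.
- by rewrite /= inE.
- by move=> l /=; case: ifP => //; lia.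
- move=> i s1 ib bs1 sm pi Ii; have [ev sv] := Hv i s1 ib bs1 sm pi.
  apply: hoare_put => //; first by rewrite ev.
  split=> // l; rewrite [arr _ a]/= eqxx /= (Hb s1 sm) pi ev (Ii l).
  have [->|ne] := eqVneq l (b0 + i%:Z).
    rewrite ifT; last by lia.
    by have -> : absz (b0 + i%:Z - b0)%R = i :> nat by lia.
  by have -> : (l < b0 + i.+1%:Z) = (l < b0 + i%:Z) by lia.
- by move=> s' tr _ _ [-> [II _]].
Qed.

(** Maxima of [ve] over the [p] satisfying [ce], collected by target cell [de]; a zero flag stands
    for the initial value [-oo]. The sum of two comparisons acts as their disjunction. *)
Definition Relax p r ce ve de Dst g tmp :=
  For p r (CIf ce
    (CSeq (CSet tmp ve)
      (CIf (EOp OAdd (EOp OLe (EArr g de) (ECst 0))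
              (EOp OLe (EOp OAdd (EArr Dst de) (ECst 1)) (EReg tmp)))
         (CSeq (CPut Dst de (EReg tmp)) (CPut g de (ECst 1)))
         CSkip))
    CSkip).

Lemma hoare_relax p r ce ve de Dst g tmp s nb (F : nat -> bool) (w D : nat -> int) :
  reg s r = nb%:Z -> bnd s -> for_ok p r -> r != p -> r != tmp -> p != tmp -> Dst != g ->
  [&& eok ce, eok ve, eok (EOp OAdd (EOp OLe (EArr g de) (ECst 0))
     (EOp OLe (EOp OAdd (EArr Dst de) (ECst 1)) (EReg tmp))),
     eok (EOp OAdd de (EReg tmp)) & eok (EOp OAdd de (ECst 1))] ->
  (forall i s1, (i < nb)%N -> bnd s1 -> same [:: p; tmp] [:: Dst; g] s s1 ->
     reg s1 p = i%:Z ->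
     [/\ (eval s1 ce != 0) = F i, eval s1 de = D i & F i ->
        [/\ eval s1 ve = w i, small (dr tmp) (w i) & small (da Dst) (w i)]]) ->
  (forall i, (i < nb)%N -> F i -> arr s g (D i) = 0) ->
  hoare (Relax p r ce ve de Dst g tmp) s (nb * 11 + 4) (pure (fun s' =>
    forall i, (i < nb)%N -> F i -> w i <= arr s' Dst (D i) /\
      exists i', [/\ (i' < nb)%N, F i', D i' = D i & arr s' Dst (D i) = w i'])).
Proof.
move=> rs bs /andP[ok drp] rp rt pt Dg /and5P[okc okv okt okp okq] Hev g0.
pose I (i : nat) s' := (forall j, (j < i)%N -> F j ->
      arr s' g (D j) = 1 /\ w j <= arr s' Dst (D j)) /\
  (forall l, arr s' g l = arr s g l \/
     exists j, [/\ (j < i)%N, F j, D j = l & arr s' Dst l = w j]).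
have gD : g != Dst by rewrite eq_sym.
apply: hoare_weaken (hoare_for Y8 (I := I) (b := 7) rs bs ok _ _ drp _ _) _ _ => //.
- by rewrite /= inE.
- by rewrite /= !inE (negPf rp) (negPf rt).
- by split=> // l; left.
- move=> i s1 ib bs1 sm pi [I1 I2].
  have sm' : same [:: p; tmp] [:: Dst; g] s s1 by [].
  have [Fc De Fw] := Hev i s1 ib bs1 sm' pi.
  apply: (@hoare_weaken O Y dr da U0 _ _ 7 7 (pure (fun s2 => I i.+1 s2))) => //; last first.
  apply: hoare_if => // [|c0]; last first.
    apply: (@hoare_weaken O Y dr da U0 _ _ 1 6 (pure (fun s2 => I i.+1 s2))) => //.
    apply: hoare_skip => //; split=> //; split=> [j|l].
      rewrite ltnS leq_eqVlt => /orP[/eqP->|ji]; last exact: I1.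
      by rewrite -Fc c0.
    have [?|[j [ji Fj Dj wj]]] := I2 l; first by left.
    by right; exists j; split=> //; apply: ltnW.
  rewrite Fc => Fi; have [wE sw sw'] := Fw Fi.
  apply: (@hoare_seq_set _ _ _ _ 4) => //; first by rewrite wE.
  rewrite wE => bs2; set s2 := set_reg s1 tmp (w i).
  have sm2 : same [:: p; tmp] [:: Dst; g] s s2.
    apply: same_trans sm' _; split=> // x; rewrite !inE negb_or => /andP[_ /negPf xt].
    by rewrite /s2 /= xt.
  have pi2 : reg s2 p = i%:Z by rewrite /s2 /= (negPf pt).
  have t2 : reg s2 tmp = w i by rewrite /s2 /= eqxx.
  have [_ De2 _] := Hev i s2 ib bs2 sm2 pi2.
  have cE : eval s2 (EOp OAdd (EOp OLe (EArr g de) (ECst 0))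
      (EOp OLe (EOp OAdd (EArr Dst de) (ECst 1)) (EReg tmp))) =
    (if arr s1 g (D i) <= 0 then 1 else 0) +
    (if arr s1 Dst (D i) + 1 <= w i then 1 else 0).
    by move: t2 De2; rewrite /= => -> ->.
  apply: hoare_if => //; rewrite cE => cnd.
    apply: (@hoare_seq_put _ _ _ _ _ 1) => //; first exact: (eq_ind_r (small (da Dst)) sw' t2).
    rewrite (t2 : eval s2 (EReg tmp) = w i) De2 => bs3; set s3 := set_arr s2 Dst (D i) (w i).
    have sm3 : same [:: p; tmp] [:: Dst; g] s s3.
      apply: same_trans sm2 _; apply: same_sub (set_arr_same [:: p; tmp] _ _ _ _) => //.
      by move=> x; rewrite !inE => ->.
    have [_ De3 _] := Hev i s3 ib bs3 sm3 pi2.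
    apply: hoare_put => //; first exact: small1.
    rewrite De3; split=> //; set s4 := set_arr s3 _ _ _.
    have gE l : arr s4 g l = if l == D i then 1 else arr s1 g l.
      by rewrite /s4 /= eqxx /= (negPf gD).
    have DE l : arr s4 Dst l = if l == D i then w i else arr s1 Dst l.
      by rewrite /s4 /= eqxx (negPf Dg).
    split=> [j|l].
      rewrite ltnS leq_eqVlt => /orP[/eqP->|ji] Fj; first by rewrite gE DE eqxx.
      have [g1 wj] := I1 j ji Fj; rewrite gE DE; case: eqP => [Dji|_]; last by split.
      split=> //; move: cnd; rewrite -Dji g1 /=; case: ifP => // h _.
      by apply: le_trans wj (ltW _); rewrite -lezD1.
    rewrite gE DE; case: eqP => [->|_]; first by right; exists i.
    have [?|[j [ji Fj Dj wj]]] := I2 l; first by left.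
    by right; exists j; split=> //; apply: ltnW.
  move: cnd => c0; apply: (@hoare_weaken O Y dr da U0 _ _ 1 3 (pure (fun s2 => I i.+1 s2))) => //.
  have gi : 0 < arr s1 g (D i).
    by rewrite ltNge; apply/negP => h; move: c0; rewrite h; case: ifP.
  have wi : w i <= arr s1 Dst (D i).
    by rewrite leNgt -lezD1; apply/negP => h; move: c0; rewrite h; case: ifP.
  apply: hoare_skip => //; split=> //; split=> [j|l].
    rewrite ltnS leq_eqVlt => /orP[/eqP->|ji] Fj; last exact: I1.
    split=> //; have [gg|[j' [j'i Fj' Dj' _]]] := I2 (D i); first by move: gi; rewrite gg g0.
    by rewrite -Dj'; case: (I1 j' j'i Fj').
  have [?|[j [ji Fj Dj wj]]] := I2 l; first by left.
  by right; exists j; split=> //; apply: ltnW.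
- by move=> s' tr _ _ [-> [[I1 I2] _]]; split=> // i ib Fi; have [g1 wi] := I1 i ib Fi;
   split=> //; have [|[j [? ? ? ?]]] := I2 (D i); [rewrite g1 g0|exists j].
Qed.

(** Keeps the largest fraction [ce / (p + 1)]. The denominators are positive, so fractions are
    compared by cross multiplication, and the term [+ 1] makes the comparison strict. *)
Definition BestFrac p r ce bn bd tmp :=
  CSeq (CSet p (ECst 0)) (CSeq (CSet bn ce) (CSeq (CSet bd (ECst 1))
  (For p r (CSeq (CSet tmp ce)
    (CIf (EOp OLe (EOp OAdd (EOp OMul (EReg bn) (EOp OAdd (EReg p) (ECst 1))) (ECst 1))
            (EOp OMul (EReg tmp) (EReg bd)))
       (CSeq (CSet bn (EReg tmp)) (CSet bd (EOp OAdd (EReg p) (ECst 1))))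
       CSkip))))).

Lemma hoare_bestfrac p r ce bn bd tmp s nb (v : nat -> int) :
  reg s r = nb%:Z -> (0 < nb)%N -> bnd s -> for_ok p r -> uniq [:: p; r; bn; bd; tmp] ->
  [&& eok ce, eok (EOp OLe (EOp OAdd (EOp OMul (EReg bn) (EOp OAdd (EReg p) (ECst 1)))
     (ECst 1)) (EOp OMul (EReg tmp) (EReg bd))), (dr r <= dr bd)%N & (dr tmp == dr bn)] ->
  (forall i s1, (i < nb)%N -> same [:: p; bn; bd; tmp] [::] s s1 ->
     reg s1 p = i%:Z -> eval s1 ce = v i /\ small (dr bn) (v i)) ->
  hoare (BestFrac p r ce bn bd tmp) s (nb * 10 + 10) (pure (fun s' => exists i,
    [/\ (i < nb)%N, reg s' bn = v i, reg s' bd = i.+1%:Z &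
      forall j, (j < nb)%N -> v j * i.+1%:Z <= v i * j.+1%:Z])).
Proof.
move=> rs nb0 bs okf /=; rewrite !inE !negb_or.
move=> /and5P[/and4P[pr pn pd pt] /and3P[rn rd rt] /andP[nd nt] dt _].
move=> /and4P[okc okb drd /eqP dtn] Hv.
have /andP[okf1 drp] := okf.
have ok1 : eok (EOp OAdd (EReg p) (ECst 1)).
  by move/andP: okf1 => [ce' cl]; rewrite /affordable /=; apply: leq_ltn_trans cl; rewrite /=; lia.
have okk z : (`|z| <= 8)%N -> eok (ECst z).
  by move=> z8; move/andP: ok1 => [_ cl]; rewrite /affordable /= z8; apply: leq_ltn_trans cl; rewrite /=; lia.
have okt : eok (EReg tmp).
  by move/andP: okb => [_ cl]; rewrite /affordable /=; apply: leq_ltn_trans cl; rewrite /=; lia.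
have -> : (nb * 10 + 10 = (nb * 10 + 4).+2.+2.+2)%N by lia.
have s0 d : small d 0 by [].
apply: hoare_seq_set => //; first exact: okk.
set s1 := set_reg s p 0 => bs1.
have sm1 : same [:: p; bn; bd; tmp] [::] s s1.
  by split=> // x; rewrite inE negb_or => /andP[/negPf /= ->].
have [|ev0 sv0] := Hv 0%N s1 nb0 sm1; first by rewrite /= eqxx.
apply: hoare_seq_set => //; first by rewrite ev0.
rewrite ev0; set s2 := set_reg s1 bn (v 0%N) => bs2.
apply: hoare_seq_set => //; [exact: okk|exact: small1|].
set s3 := set_reg s2 bd _ => bs3.
pose I (i : nat) s' := exists q, [/\ (q < nb)%N, reg s' bn = v q, reg s' bd = q.+1%:Z &
      forall j, (j < i)%N -> v j * q.+1%:Z <= v q * j.+1%:Z].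
have nE (a b : nat) : (a == b) = (b == a) by rewrite eq_sym.
apply: hoare_weaken (hoare_for Y8 (I := I) (b := 6) (nb := nb) _ bs3 okf1 _ _ drp _ _) _ _ => //.
- by rewrite /s3 /s2 /s1 /= (negPf rd) (negPf rn) eq_sym (negPf pr).
- by rewrite /= !inE !negb_or pn pd pt.
- by rewrite /= !inE !negb_or rn rd rt nE pr.
- exists 0%N; split=> //.
    by rewrite /s3 /s2 /= nE (negPf pn) (negPf nd) eqxx.
  by rewrite /s3 /= nE (negPf pd) eqxx.
- move=> i s4 ib bs4 sm4 pi [q [qb bnE bdE Hq]].
  have sm4' : same [:: p; bn; bd; tmp] [::] s s4.
    apply: (same_trans (s2 := s3)); last first.
      apply: same_sub sm4 => // x; rewrite /= !inE; do !case: (x == _) => //=.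
    split=> // x; rewrite !inE !negb_or => /and4P[/negPf xp /negPf xn /negPf xd _].
    by rewrite /s3 /s2 /s1 /= xd xn xp.
  have [ev sv] := Hv i s4 ib sm4' pi.
  apply: (@hoare_weaken O Y dr da U0 _ _ 6 6 (pure (fun s2 => I i.+1 (set_reg s2 p i.+1%:Z)))) => //.
  apply: (@hoare_seq_set _ _ _ _ 4) => //; first by rewrite ev dtn.
  rewrite ev; set s5 := set_reg s4 tmp (v i) => bs5.
  have t5 : reg s5 tmp = v i by rewrite /= eqxx.
  have p5 : reg s5 p = i%:Z by rewrite /= (negPf pt).
  have n5 : reg s5 bn = v q by rewrite /= (negPf nt).
  have d5 : reg s5 bd = q.+1%:Z by rewrite /= (negPf dt).
  have cE : eval s5 (EOp OLe (EOp OAdd (EOp OMul (EReg bn)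
      (EOp OAdd (EReg p) (ECst 1))) (ECst 1)) (EOp OMul (EReg tmp) (EReg bd))) =
    if v q * (i%:Z + 1) + 1 <= v i * q.+1%:Z then 1 else 0.
    by move: t5 p5 n5 d5; rewrite /= => -> -> -> ->.
  apply: hoare_if => //; rewrite cE; case: ifP => // cnd _.
    apply: (@hoare_seq_set _ _ _ _ 1) => //; first exact: (eq_ind_r (small (dr bn)) sv t5).
    rewrite (t5 : eval s5 (EReg tmp) = v i); set s6 := set_reg s5 bn (v i) => bs6.
    have p6 : reg s6 p = i%:Z by move: p5; rewrite /s6 /= (negPf pn).
    have e6 : eval s6 (EOp OAdd (EReg p) (ECst 1)) = i.+1%:Z.
      by rewrite -addn1 PoszD -p6.
    apply: hoare_set => //; rewrite e6.
      apply: (small_le Y8 drd).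
      have := proj1 bs r; rewrite rs /fits /=; apply: leq_trans; lia.
    split=> //; exists i; split=> //.
    - by rewrite /s6 /= nE (negPf pn) (negPf nd) eqxx.
    - by rewrite /= nE (negPf pd) eqxx.
    move=> j; rewrite ltnS leq_eqVlt => /orP[/eqP->|ji]; first by [].
    have := Hq j ji; have q0 : 0 < q.+1%:Z by [].
    move=> H; rewrite -(ler_pM2r q0).
    have : v q * j.+1%:Z * i.+1%:Z <= v i * q.+1%:Z * j.+1%:Z.
      have -> : v q * j.+1%:Z * i.+1%:Z = v q * i.+1%:Z * j.+1%:Z by ring.
      by rewrite ler_wpM2r //; lia.
    have : v j * q.+1%:Z * i.+1%:Z <= v q * j.+1%:Z * i.+1%:Z by rewrite ler_wpM2r.
    lia.
  apply: (@hoare_weaken O Y dr da U0 _ _ 1 3 (pure (fun s2 => I i.+1 (set_reg s2 p i.+1%:Z)))) => //.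
  apply: hoare_skip => //; split=> //; exists q; split=> //.
  - by rewrite /s5 /= nE (negPf pn) (negPf nt).
  - by rewrite /s5 /= nE (negPf pd) (negPf dt).
  move=> j; rewrite ltnS leq_eqVlt => /orP[/eqP->|ji]; last exact: Hq.
  by rewrite leNgt -lezD1 -addn1 PoszD cnd.
- by move=> s' tr _ _ [-> [II _]].
Qed.

End Macros.

(** * The program *)

Declare Scope prog_scope.
Delimit Scope prog_scope with P.
Notation "e1 + e2" := (EOp OAdd e1 e2) : prog_scope.
Notation "e1 - e2" := (EOp OSub e1 e2) : prog_scope.
Notation "e1 * e2" := (EOp OMul e1 e2) : prog_scope.
Notation "e1 / e2" := (EOp ODiv e1 e2) : prog_scope.
Notation "e1 <= e2" := (EOp OLe e1 e2) : prog_scope.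
Notation "x :<- e" := (CSet x%N e%P) (at level 75) : prog_scope.
Notation "c1 ;; c2" := (CSeq c1%P c2%P) (at level 80, right associativity) : prog_scope.
Notation "# z" := (ECst z%Z) (at level 8, format "# z") : prog_scope.
Notation "$ x" := (EReg x) (at level 8, format "$ x") : prog_scope.
Notation "a .{ e }" := (EArr a e%P) (at level 9, format "a .{ e }") : prog_scope.
Notation "'put' a .{ e } e'" := (CPut a%N e%P e'%P)
  (at level 75, a at level 8, e' at level 74) : prog_scope.

Notation rn := 1%N (only parsing).
Notation rm2 := 2%N (only parsing).
Notation rmn := 3%N (only parsing).
Notation rmn2 := 4%N (only parsing).
Notation rK := 5%N (only parsing).
Notation rk := 6%N (only parsing).
Notation rlow := 7%N (only parsing).
Notation rup := 8%N (only parsing).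
Notation rcells := 9%N (only parsing).
Notation rlo := 10%N (only parsing).
Notation rhi := 11%N (only parsing).
Notation rN := 12%N (only parsing).
Notation rt := 13%N (only parsing).
Notation rvn := 14%N (only parsing).
Notation rvd := 15%N (only parsing).
Notation rN' := 16%N (only parsing).
Notation rt' := 17%N (only parsing).
Notation rvn' := 18%N (only parsing).
Notation rvd' := 19%N (only parsing).
Notation rsn := 20%N (only parsing).
Notation rsd := 21%N (only parsing).
Notation rsn' := 22%N (only parsing).
Notation rsd' := 23%N (only parsing).
Notation rP := 24%N (only parsing).
Notation rp := 25%N (only parsing).
Notation rnum := 27%N (only parsing).
Notation rden := 28%N (only parsing).
Notation rtmp := 29%N (only parsing).
Notation rT := 30%N (only parsing).
Notation rtau := 31%N (only parsing).
Notation rV := 32%N (only parsing).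
Notation rbn := 33%N (only parsing).
Notation rbd := 34%N (only parsing).
Notation rc := 35%N (only parsing).
Notation rp1n := 36%N (only parsing).
Notation rp1d := 37%N (only parsing).
Notation rp2n := 38%N (only parsing).
Notation rp2d := 39%N (only parsing).

Local Open Scope prog_scope.

(* Arrays 2 and 3 hold copies of [A] and [B], since the output overwrites arrays
   0 and 1; arrays 4 and 5 hold the game submitted to the oracle; arrays 9, 10
   and 11 flag the maxima in arrays 8, 7 and 6 that are already initialized.
   Registers [rlo] and [rhi] hold twice the bounds of the scan. A point of the
   scan is [rN / (2 rt)], with value [rvn / rvd]; primes mark the next point. *)
Definition odd_index := $rp - #2 * ($rp / #2).

Definition Init :=
  rm2 :<- #2 * $0;;
  rmn :<- $0 * $rn;;
  rmn2 :<- #2 * $rmn;;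
  rcells :<- $rmn * $rn;;
  Fill rp rmn2 2 (#0) (0.{$rp});;
  Fill rp rmn2 3 (#0) (1.{$rp});;
  CIf ($rm2 <= $rn) (rk :<- $rm2) (rk :<- $rn);;
  rK :<- $rk * $rk.

(* The cell [p = (i n + j) n + k] ranges over the differences [a_ij - b_ik]. *)
Definition a_index := $rp / $rn.
Definition b_index := $rn * ($rp / ($rn * $rn)) + ($rp - $rn * ($rp / $rn)).
Definition has_gap := 2.{#2 * a_index} * 3.{#2 * b_index}.
Definition gap := 2.{#2 * a_index + #1} - 3.{#2 * b_index + #1}.

Definition Gaps :=
  Relax rp rcells has_gap gap (#0) 8 9 rtmp;;
  rup :<- 8.{#0};;
  put 9.{#0} #0;;
  Relax rp rcells has_gap (#0 - gap) (#0) 8 9 rtmp;;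
  rlow :<- #0 - 8.{#0}.

(** Even cells are flags: they are only multiplied by the positive scale, which preserves being
    nonzero. The factor [odd_index] confines the shift to the cells of the values. *)
Definition Build :=
  Fill rp rmn2 4 (#0) ($rt' * 2.{$rp} - odd_index * ($rN' / #4));;
  Fill rp rmn2 4 ($rmn2) ($rt' * 3.{$rp} + odd_index * (($rN' + #2) / #4));;
  Fill rp rmn2 5 (#0) ($rt' * 3.{$rp} + odd_index * (($rN' + #1) / #4));;
  Fill rp rmn2 5 ($rmn2) ($rt' * 2.{$rp} - odd_index * (($rN' + #3) / #4)).

(** The last two commands undo the scaling: the answer [rnum / rden] is
    [t s + (n1 + n2 - n3 - n4) / 2]. *)
Definition Query :=
  Build;;
  CCall ($rm2) ($rn) 4 5 rnum rden;;
  rvn' :<- #2 * $rnum -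
     ($rN' / #4 + ($rN' + #1) / #4 - ($rN' + #2) / #4 - ($rN' + #3) / #4) * $rden;;
  rvd' :<- #2 * $rt' * $rden.

(** For each denominator [p + 1], the least fraction beyond [N / t] has numerator
    [floor (N (p + 1) / t) + 1]. The least of these fractions is found as the greatest of the
    opposites. *)
Definition Next :=
  BestFrac rp rK (#0 - ($rN * ($rp + #1) / $rt + #1)) rbn rt' rc;;
  rN' :<- #0 - $rbn.

Definition Shift :=
  rN :<- $rN';; rt :<- $rt';; rvn :<- $rvn';; rvd :<- $rvd'.

(** The slope through two consecutive points is compared with the current one by cross
    multiplication; a change opens a new piece. For the first piece, where [rP = 0], the cut lands
    in cells of negative index, outside the output. *)
Definition Emit :=
  rsn' :<- #2 * $rt * $rt' * ($rvn' * $rvd - $rvn * $rvd');;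
  rsd' :<- $rvd * $rvd' * ($rN' * $rt - $rN * $rt');;
  CIf ($rsn' * $rsd - $rsn * $rsd')
    (put 0.{#2 * $rP - #2} $rN;;
     put 0.{#2 * $rP - #1} #2 * $rt;;
     put 1.{#4 * $rP} $rsn';;
     put 1.{#4 * $rP + #1} $rsd';;
     put 1.{#4 * $rP + #2} $rvn * (#2 * $rt) * $rsd' - $rsn' * $rN * $rvd;;
     put 1.{#4 * $rP + #3} $rvd * (#2 * $rt) * $rsd';;
     rP :<- $rP + #1;;
     rsn :<- $rsn';;
     rsd :<- $rsd')
    CSkip.

(** The initial slope [2] is impossible for a 1-Lipschitz function, so the first interval always
    opens a piece. *)
Definition ScanStart :=
  rN' :<- $rlo;; rt' :<- #1;;
  Query;; Shift;;
  rsn :<- #2;; rsd :<- #1;; rP :<- #0.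

Definition Scan :=
  ScanStart;;
  CWhile ($rN + #1 <= $rhi * $rt) (Next;; Query;; Emit;; Shift);;
  0 :<- $rP - #1.

(* Value iteration for payments [eps] and [- eps], where array 6 holds the
   opposite of the current value of the nodes of Min. *)
Definition col_index := $rp - $rn * ($rp / $rn).

(** Two half-turns: array 7 receives for each row the maximum over the replies of Max, then array 6
    the minimum over the rows of Min, computed as a maximum of opposites. The factor of [eps] is
    [-1] on the first half of the rows and [1] on the second. *)
Definition Sweep (eps : int) :=
  Fill rp rm2 10 (#0) (#0);;
  Relax rp rmn2 (5.{#2 * $rp}) (#0 - 6.{col_index}) ($rp / $rn) 7 10 rtmp;;
  Fill rp rn 11 (#0) (#0);;
  Relax rp rmn2 (4.{#2 * $rp})
    ((ECst eps) * (#2 * ($rmn <= $rp) - #1) - 7.{$rp / $rn}) col_index 6 11 rtmp.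

(** After [rT] turns the largest coordinate divided by [rT] is at least the value, and so close to
    it that the value is the largest fraction of denominator at most [k] not exceeding this
    quotient. *)
Definition Iterate (eps : int) :=
  Fill rp rn 6 (#0) (#0);;
  For rtau rT (Sweep eps);;
  put 9.{#0} (#0);;
  Relax rp rn (#1) (#0 - 6.{$rp}) (#0) 8 9 rtmp;;
  rV :<- 8.{#0};;
  BestFrac rp rk ($rV * ($rp + #1) / $rT) rbn rbd rc.

(** [Build] provides the flags in arrays 4 and 5 that mark the moves. The two pieces meet at [c],
    with slopes [- s (c - 1)] and [s (c + 1)]; if these are equal, the number of cuts is [0] and the
    first piece is the whole function. *)
Definition Degenerate :=
  rN' :<- #0;; rt' :<- #1;; Build;;
  rT :<- #2 * $rn * $rK + #1;;
  Iterate 1;;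
  rp1n :<- $rbn;; rp1d :<- $rbd;;
  Iterate (-1);;
  rp2n :<- $rbn;; rp2d :<- $rbd;;
  put 0.{#0} ($rlow);; put 0.{#1} (#1);;
  put 1.{#0} (#0 - $rp2n);; put 1.{#1} ($rp2d);;
  put 1.{#2} ($rlow * $rp2n);; put 1.{#3} ($rp2d);;
  put 1.{#4} ($rp1n);; put 1.{#5} ($rp1d);;
  put 1.{#6} (#0 - $rlow * $rp1n);; put 1.{#7} ($rp1d);;
  CIf ($rp1n * $rp2d + $rp2n * $rp1d) (0 :<- #1) (0 :<- #0).

(** The range exceeds the bound on the breakpoints by one on either side, which leaves room to
    recognize the unbounded pieces. *)
Definition DeltaRange (e : expr) :=
  CIf (#0 <= $rlow + $rup) (rhi :<- $rup) (rhi :<- #0 - $rlow);;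
  rhi :<- #2 * ($rhi * e + #1);;
  rlo :<- #0 - $rhi.

Definition FiniteRange :=
  rlo :<- #2 * $rlow - #2;;
  rhi :<- #2 * $rup + #2.

Definition Reconstruct (Range : cmd) :=
  Init;; Gaps;; CIf ($rup <= $rlow) Degenerate (Range;; Scan).

Local Close Scope prog_scope.

(* Every register and every cell of an array stays below a power of a large
   number; these are the exponents. *)
Definition dr (x : nat) : nat :=
  nth 1%N [:: 1; 1; 1; 1; 1; 1; 1; 1; 1; 1; 1; 1; 1; 1; 7; 3; 1; 1; 7; 3;
    14; 9; 14; 9; 1; 1; 1; 1; 1; 1; 1; 1; 1; 5; 1; 5; 5; 1; 5; 1]%N x.
Definition da (a : nat) : nat := nth 1%N [:: 2; 19; 1; 1; 6; 6]%N a.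
(** Large enough for the weight [ecost] of every expression of the program. *)
Definition U0 := 500%N.

Lemma U0_gt0 : (0 < U0)%N. Proof. by []. Qed.

Lemma sub0z (x : int) : 0%Z - x = - x. Proof. exact: sub0r. Qed.

(** * Initialization, extremal differences and construction of the games *)

Section Run.
Variables (O : oracle) (m n M : nat) (A B : 'M[option int]_(m, n)) (Y : nat).
Hypothesis adm : admissible M A B.
Let k := minn (2 * m) n.
Hypotheses (Y8 : (8 <= Y)%N) (Ycells : (2 * (m * n * n) <= Y)%N)
  (YK : (k * k <= Y)%N) (YM : (2 * M <= Y)%N).
Notation hoare := (hoare O Y dr da U0).
Notation bnd := (bnd Y dr da).
Notation small := (fits Y).

Let m_gt0 : (0 < m)%N. Proof. by case: adm. Qed.
Let n_gt0 : (0 < n)%N. Proof. by case: adm. Qed.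
Let k_gt0 : (0 < k)%N. Proof. by rewrite /k leq_min muln_gt0 m_gt0. Qed.

Definition stored a (X : 'M[option int]_(m, n)) s := forall (i : 'I_m) (j : 'I_n),
  arr s a (2 * (i * n + j))%N%:Z = (finite X i j : nat)%:Z /\
  arr s a (2 * (i * n + j)).+1%N%:Z = intval X i j.

Definition based s :=
  [/\ reg s rn = n%:Z, reg s rm2 = (2 * m)%N%:Z, reg s rmn = (m * n)%N%:Z &
      reg s rmn2 = (2 * (m * n))%N%:Z] /\
  [/\ reg s rK = (k * k)%N%:Z, reg s rk = k%:Z, stored 2 A s & stored 3 B s].

Lemma based_same xs ys s s' :
  all (fun x => x \notin xs) [:: rn; rm2; rmn; rmn2; rK; rk] ->
  all (fun a => a \notin ys) [:: 2; 3]%N -> same xs ys s s' -> based s -> based s'.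
Proof.
rewrite /= !andbT => /and5P[x1 x2 x3 x4 /andP[x5 x6]] /andP[y2 y3] [sr sa].
move=> [[b1 b2 b3 b4] [b5 b6 b7 b8]].
by split; split; rewrite ?sr // /stored sa.
Qed.

Lemma cell_lt (i : 'I_m) (j : 'I_n) : (i * n + j < m * n)%N.
Proof.
apply: (@leq_trans (i.+1 * n)); last by rewrite leq_mul2r ltn_ord orbT.
by rewrite mulSn addnC ltn_add2r.
Qed.

Lemma write_mx_stored (X : 'M[option int]_(m, n)) (i : 'I_m) (j : 'I_n) :
  write_mx X (2 * (i * n + j))%N%:Z = (finite X i j : nat)%:Z /\
  write_mx X (2 * (i * n + j)).+1%N%:Z = intval X i j.
Proof.
have dv : ((i * n + j) %/ n = i)%N by rewrite divnMDl // divn_small ?addn0.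
have md : ((i * n + j) %% n = j)%N by rewrite modnMDl modn_small.
have h1 : ((2 * (i * n + j))./2 = i * n + j)%N by rewrite mul2n doubleK.
have h2 : ((2 * (i * n + j)).+1./2 = i * n + j)%N.
  by rewrite -[(2 * _).+1]/(true + (2 * _))%N mul2n half_bit_double.
rewrite /write_mx h1 h2 dv md (valK i) (valK j) /finite /intval mul2n /= odd_double.
by case: (X i j).
Qed.

Lemma write_mx_small (X : 'M[option int]_(m, n)) (z : int) d : (0 < d)%N ->
  bounded_by M X -> small d (write_mx X z).
Proof.
move=> d0 bX; apply: (small_le Y8 d0); rewrite /fits expn1.
have Y1 : (`|1%Z| <= Y)%N by apply: leq_trans Y8.
have Y00 : (`|0%Z| <= Y)%N by [].
case: z => // c /=; case: insub => // i; case: insub => // j.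
case E: (X i j) => [v|] //; case: odd => //.
by have := bX _ _ _ E; lia.
Qed.

Lemma Ymn : (2 * (m * n) <= Y)%N.
Proof. by apply: leq_trans Ycells; rewrite leq_mul2l /= leq_pmulr. Qed.

Lemma Ym : (2 * m <= Y)%N.
Proof. by apply: leq_trans Ymn; rewrite leq_mul2l /= leq_pmulr. Qed.

Lemma Yn : (2 * n <= Y)%N.
Proof. by apply: leq_trans Ymn; rewrite leq_mul2l /= leq_pmull. Qed.

Lemma input_bnd : bnd (input A B).
Proof.
have [_ _ _ _ [bA bB]] := adm; split=> [x|a i].
  rewrite /=; case: x => [|[|x]] /=; rewrite /fits ?expn1.
  - by have := Ym; lia.
  - by have := Yn; lia.
  - by rewrite nth_nil.
by case: a => [|[|a]] //=; apply: write_mx_small.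
Qed.

Local Arguments write_mx : simpl never.

Lemma small_nat d (z : nat) : (z <= Y)%N -> (0 < d)%N -> small d z%:Z.
Proof. by move=> zY d0; apply: (small_le Y8 d0); rewrite /fits expn1. Qed.

Lemma init_spec : hoare Init (input A B) (20 * (m * n) + 30)
  (pure (fun s => based s /\ reg s rcells = (m * n * n)%N%:Z)).
Proof.
have b0 := input_bnd.
eapply (hoare_weaken (Q := pure (fun s =>
  based s /\ reg s rcells = (m * n * n)%N%:Z))); [|  | by []].
rewrite /Init.
apply: (hoare_seq_setv Y8 U0_gt0 (v := (2 * m)%N%:Z)) => //; first exact: small_nat Ym _.
move=> {}b0; apply: (hoare_seq_setv Y8 U0_gt0 (v := (m * n)%N%:Z)) => //.
  by apply: small_nat => //; have := Ymn; lia.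
move=> {}b0; apply: (hoare_seq_setv Y8 U0_gt0 (v := (2 * (m * n))%N%:Z)) => //.
  exact: small_nat Ymn _.
move=> {}b0; apply: (hoare_seq_setv Y8 U0_gt0 (v := (m * n * n)%N%:Z)) => //.
  by apply: small_nat => //; have := Ycells; lia.
set s1 := set_reg _ _ _ => b1.
apply: (hoare_seq_pure U0_gt0 (hoare_fill O Y8 U0_gt0 (nb := (2 * (m * n))%N) (b0 := 0)
   (v := fun c => write_mx A c%:Z) _ b1 _ _ _ _ _)) => //.
  move=> i s2 _ _ [_ sa] /= ->; rewrite sa //.
  by split=> //; apply: write_mx_small; case: adm => _ _ _ _ [].
move=> s2 b2 sm2 A2.
apply: (hoare_seq_pure U0_gt0 (hoare_fill O Y8 U0_gt0 (nb := (2 * (m * n))%N) (b0 := 0)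
   (v := fun c => write_mx B c%:Z) _ b2 _ _ _ _ _)) => //.
- by rewrite (proj1 sm2).
- move=> i s3 _ _ [_ sa] /= ->; rewrite sa // (proj2 sm2) //.
  by split=> //; apply: write_mx_small; case: adm => _ _ _ _ [].
move=> s3 b3 sm3 B3.
apply: (hoare_seq_pure U0_gt0 (b1 := 2) (P := fun s => reg s rk = k%:Z)).
  have r2 : reg s3 2%N = (2 * m)%N%:Z by rewrite (proj1 sm3) // (proj1 sm2).
  have r1 : reg s3 1%N = n%:Z by rewrite (proj1 sm3) // (proj1 sm2).
  apply: hoare_if => //= [|]; rewrite r1 r2; case: ifP => // le _.
    apply: hoare_aset => //; split=> //=; rewrite r2 /k; congr Posz; lia.
  apply: hoare_aset => //; split=> //=; rewrite r1 /k; congr Posz; lia.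
move=> s4 b4 sm4 rk4; apply: hoare_set => //=.
  by rewrite rk4 small_nat.
have R x : x \notin [:: rk; rp] -> reg s4 x = reg s1 x.
  rewrite !inE negb_or => /andP[x1 x2].
  by rewrite (proj1 sm4) ?(proj1 sm3) ?(proj1 sm2) // ?inE ?negb_or ?x1 ?x2.
split=> //; split; last by rewrite /= R.
have lt2 (i : 'I_m) (j : 'I_n) := cell_lt i j.
split; split; try by rewrite /= R.
- by rewrite /= rk4.
- by rewrite /= rk4.
- have E l : arr s4 2%N l = arr s2 2%N l by rewrite (proj2 sm4) ?(proj2 sm3).
  move=> i j; have := lt2 i j => ij; have [w1 w2] := write_mx_stored A i j.
  by rewrite /stored /= !E !A2 !ifT ?subr0 //; lia.
- have E l : arr s4 3%N l = arr s3 3%N l by rewrite (proj2 sm4).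
  move=> i j; have := lt2 i j => ij; have [w1 w2] := write_mx_stored B i j.
  by rewrite /stored /= !E !B3 !ifT ?subr0 //; lia.
by lia.
Qed.

(** The bounds are required to be attained, which makes them unique and equal to [Clow] and
    [Cup]. *)
Definition gap_range (lo up : int) :=
  [/\ forall i j h, finite A i j -> finite B i h ->
        lo <= intval A i j - intval B i h <= up,
      exists i j h, [/\ finite A i j, finite B i h & intval A i j - intval B i h = lo] &
      exists i j h, [/\ finite A i j, finite B i h & intval A i j - intval B i h = up]].

Definition triple (i : 'I_m) (j h : 'I_n) : nat := (i * n + j) * n + h.

Lemma triple_lt i j h : (triple i j h < m * n * n)%N.
Proof.
have := cell_lt i j; rewrite /triple => H; apply: (@leq_trans ((i * n + j).+1 * n)).
  by rewrite mulSn addnC ltn_add2r.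
by rewrite leq_mul2r H orbT.
Qed.

Lemma triple_surj p : (p < m * n * n)%N -> exists i j h, p = triple i j h.
Proof.
move=> pm.
have p1 : (p %/ n < m * n)%N by rewrite ltn_divLR.
have p2 : (p %/ n %/ n < m)%N by rewrite ltn_divLR.
exists (Ordinal p2), (Ordinal (ltn_pmod (p %/ n) n_gt0)), (Ordinal (ltn_pmod p n_gt0)).
by rewrite /triple /= -!divn_eq.
Qed.

Lemma eval_triple s i j h : based s -> reg s rp = (triple i j h)%:Z ->
  eval s has_gap = (finite A i j && finite B i h : nat)%:Z /\
  eval s gap = intval A i j - intval B i h.
Proof.
move=> [[nE _ _ _] [_ _ sA sB]] pE.
have d1 : (triple i j h %/ n = i * n + j)%N.
  by rewrite /triple divnMDl // divn_small ?addn0.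
have d2 : (triple i j h %/ (n * n) = i)%N.
  by rewrite divnMA d1 divnMDl // divn_small ?addn0.
have ea : eval s a_index = (i * n + j)%N%:Z by rewrite /= nE pE divz_nat d1.
have eb : eval s b_index = (i * n + h)%N%:Z.
  rewrite /= nE pE !divz_nat d2 d1 /triple; lia.
have [a1 a2] := sA i j; have [b1 b2] := sB i h.
have e1 : 2 * (i * n + j)%N%:Z = (2 * (i * n + j))%N%:Z by lia.
have e2 : 2 * (i * n + h)%N%:Z = (2 * (i * n + h))%N%:Z by lia.
have e3 (z : nat) : z%:Z + 1 = z.+1%:Z by lia.
split; move: ea eb; rewrite /= => -> ->; rewrite e1 e2 ?e3 ?a1 ?a2 ?b1 ?b2 //.
by case: finite; case: finite.
Qed.

(** The minimum is the opposite of a second maximum, with the flag of cell [0] lowered in between.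
    Some difference exists because no row is identically [-oo]. *)
Lemma gaps_spec s : bnd s -> based s -> reg s rcells = (m * n * n)%N%:Z ->
  arr s 9%N 0 = 0 ->
  hoare Gaps s (22 * (m * n * n) + 30) (pure (fun s' =>
    exists lo up, [/\ reg s' rlow = lo, reg s' rup = up & gap_range lo up])).
Proof.
move=> bs Bs rc g0.
have [_ _ [Ar Br] _ [bA bB]] := adm.
pose F (p : nat) := eval (set_reg s rp p%:Z) has_gap != 0.
pose w (p : nat) := eval (set_reg s rp p%:Z) gap.
have based_sub p s1 : based s1 -> based (set_reg s1 rp p).
  by apply: based_same (_ : same [:: rp] [::] s1 _) => //; split=> // x; rewrite inE /= => /negPf ->.
have FE i j h : F (triple i j h) = finite A i j && finite B i h.
  have [e1 _] := @eval_triple _ i j h (based_sub (triple i j h)%:Z s Bs) erefl.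
  by rewrite /F e1; case: (_ && _).
have wE i j h : w (triple i j h) = intval A i j - intval B i h.
  by have [_ e1] := @eval_triple _ i j h (based_sub (triple i j h)%:Z s Bs) erefl.
have wY p : (p < m * n * n)%N -> small 1 (w p).
  move=> /triple_surj[i [j [h ->]]]; rewrite wE /fits expn1.
  have := bounded_intval i j bA; have := bounded_intval i h bB; lia.
have tr s1 p : based s1 -> (p < m * n * n)%N -> reg s1 rp = p%:Z ->
    (eval s1 has_gap != 0) = F p /\ eval s1 gap = w p.
  move=> Bs1 /triple_surj[i [j [h ->]]] rp1; have [-> ->] := eval_triple Bs1 rp1.
  by rewrite FE wE; case: (_ && _).
have ex : exists i j h, finite A i j /\ finite B i h.
  have i : 'I_m by exists 0%N.
  by have [j Hj] := Ar i; have [h Hh] := Br i; exists i, j, h.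
have [i0 [j0 [h0 [f1 f2]]]] := ex.
have F0 : F (triple i0 j0 h0) by rewrite FE f1 f2.
eapply (hoare_weaken (Q := pure (fun s' =>
    exists lo up, [/\ reg s' rlow = lo, reg s' rup = up & gap_range lo up]))); [|  | by []].
apply: (hoare_seq_pure U0_gt0 (hoare_relax O Y8 U0_gt0 (F := F) (w := w) (D := fun=> 0)
  rc bs _ _ _ _ _ _ _ _)) => //.
  move=> p s1 pm b1 sm1 rp1; have Bs1 : based s1 by apply: based_same sm1 Bs.
  by have [-> ->] := tr s1 p Bs1 pm rp1; split=> // _; split=> //; apply: wY.
move=> s1 b1 sm1 P1; have Bs1 : based s1 by apply: based_same sm1 Bs.
have [_ [q [qm Fq _ upE]]] := P1 _ (triple_lt i0 j0 h0) F0.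
apply: (hoare_seq_setv Y8 U0_gt0 (v := w q)) => //; first exact: wY.
move=> {}b1; apply: hoare_seq_aput => // b2.
set s2 := set_arr _ _ _ _ in b2 *.
have Bs2 : based s2 by [].
apply: (hoare_seq_pure U0_gt0 (hoare_relax O Y8 U0_gt0 (s := s2) (nb := (m * n * n)%N) (F := F)
  (w := fun p => - w p) (D := fun=> 0) _ b2 _ _ _ _ _ _ _ _)) => //.
- by rewrite /= (proj1 sm1).
- move=> p s3 pm b3 sm3 rp3; have Bs3 : based s3 by apply: based_same sm3 Bs2.
  have [e1 e2] := tr s3 p Bs3 pm rp3; rewrite e1; split=> // _.
  have w1 := wY p pm; have w1' : small 1 (- w p) by rewrite /fits abszN.
  split=> //; have -> : eval s3 (#0 - gap)%P = - eval s3 gap by rewrite -sub0r.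
  by rewrite e2.
move=> s3 b3 sm3 P3.
have [_ [q' [qm' Fq' _ lowE]]] := P3 _ (triple_lt i0 j0 h0) F0.
apply: hoare_set => //.
  by rewrite /= lowE sub0z opprK; apply: wY.
split=> //; exists (w q'), (w q); split.
- by rewrite /= lowE sub0z opprK.
- by rewrite /= (proj1 sm3).
split.
- move=> i j h fi fj; have tl := triple_lt i j h.
  have Ft : F (triple i j h) by rewrite FE fi fj.
  have [w1 _] := P1 _ tl Ft; have [w3 _] := P3 _ tl Ft.
  by rewrite -wE -upE w1 andbT -lerN2 -lowE.
- have [i [j [h qE]]] := triple_surj qm'; rewrite qE in Fq' *.
  by exists i, j, h; move: Fq'; rewrite FE wE => /andP[? ?].
have [i [j [h qE]]] := triple_surj qm; rewrite qE in Fq *.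
by exists i, j, h; move: Fq; rewrite FE wE => /andP[? ?].
by lia.
Qed.

Lemma read_scaled (f : int -> int) a X s (base t : nat) (d : int) :
  stored a X s -> (0 < t)%N ->
  (forall c : nat, (c < 2 * (m * n))%N ->
     f (2 * base + c)%N%:Z = t%:Z * arr s a c%:Z + (odd c : nat)%:Z * d) ->
  forall (i : 'I_m) (j : 'I_n),
    read_entry f (base + (i * n + j)) = omap (fun x => t%:Z * x + d) (X i j).
Proof.
move=> sX t0 Hf i j; have ij := cell_lt i j; have [x1 x2] := sX i j.
rewrite /read_entry mulnDr.
have -> : f (2 * base + 2 * (i * n + j))%N%:Z = t%:Z * (finite X i j : nat)%:Z.
  by rewrite Hf ?x1 ?mul2n ?odd_double ?mul0r ?addr0 //; lia.
have -> : f (2 * base + 2 * (i * n + j)).+1%N%:Z = t%:Z * intval X i j + d.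
  by rewrite -addnS Hf ?x2 /= ?mul2n ?odd_double ?mul1r //; lia.
rewrite /finite /intval; case: (X i j) => [z|] /=; last by rewrite mulr0.
by rewrite mulr1 ifF //; lia.
Qed.

Lemma eval_odd s (c : nat) : reg s rp = c%:Z -> eval s odd_index = (odd c : nat)%:Z.
Proof.
move=> E; rewrite /= E divz_nat divn2; have := odd_double_half c; rewrite -mul2n.
by case: odd => /=; lia.
Qed.

Definition scaled_query (gA gB : 'M[option int]_(2 * m, n)) (t : nat) (n1 n2 n3 n4 : int) :=
  [/\ forall (p : 'I_(2 * m)) (i : 'I_m) j, p = i :> nat ->
        gA p j = omap (fun a => t%:Z * a - n1) (A i j),
      forall (p : 'I_(2 * m)) (i : 'I_m) j, p = (m + i)%N :> nat ->
        gA p j = omap (fun b => t%:Z * b + n3) (B i j),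
      forall (p : 'I_(2 * m)) (i : 'I_m) j, p = i :> nat ->
        gB p j = omap (fun b => t%:Z * b + n2) (B i j) &
      forall (p : 'I_(2 * m)) (i : 'I_m) j, p = (m + i)%N :> nat ->
        gB p j = omap (fun a => t%:Z * a - n4) (A i j)].

Lemma fill_same p r a base e s s' :
  same (modr (Fill p r a base e)) (moda (Fill p r a base e)) s s' -> same [:: p] [:: a] s s'.
Proof. by apply: same_sub => x; rewrite /= !inE ?orbb ?orbF. Qed.

Lemma build_spec s N t : bnd s -> based s -> reg s rN' = N -> reg s rt' = t%:Z ->
  (0 < t)%N ->
  hoare Build s (40 * (m * n) + 19) (pure (fun s' =>
    scaled_query (read_mx (arr s' 4%N) (2 * m) n) (read_mx (arr s' 5%N) (2 * m) n) t
      (N %/ 4)%Z ((N + 1) %/ 4)%Z ((N + 2) %/ 4)%Z ((N + 3) %/ 4)%Z)).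
Proof.
move=> bs Bs NE tE t0.
pose v a (d : int) (c : nat) := t%:Z * arr s a c%:Z + (odd c : nat)%:Z * d.
have bsub s1 : same [:: rp] [:: 4; 5]%N s s1 ->
    [/\ based s1, reg s1 rN' = N, reg s1 rt' = t%:Z, arr s1 2%N = arr s 2%N & arr s1 3%N = arr s 3%N].
  move=> sm; split; first by apply: based_same sm Bs.
  - by rewrite (proj1 sm).
  - by rewrite (proj1 sm).
  - by rewrite (proj2 sm).
  by rewrite (proj2 sm).
have sub4 s1 s2 : same [:: rp] [:: 4]%N s1 s2 -> same [:: rp] [:: 4; 5]%N s1 s2.
  by apply: same_sub => // x; rewrite !inE => ->.
have sub5 s1 s2 : same [:: rp] [:: 5]%N s1 s2 -> same [:: rp] [:: 4; 5]%N s1 s2.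
  by apply: same_sub => // x; rewrite !inE => ->; rewrite orbT.
have fill a e base b0 d (src : nat) s1 : same [:: rp] [:: 4; 5]%N s s1 -> bnd s1 ->
    a \in [:: 4; 5]%N ->
    affordable dr da U0 (EOp OAdd (EOp OAdd base (EReg rp)) e) -> (edeg dr da e <= 6)%N ->
    (forall s2, same [:: rp] [:: 4; 5]%N s s2 -> eval s2 base = b0) ->
    (forall s2 c, same [:: rp] [:: 4; 5]%N s s2 -> reg s2 rp = c%:Z -> eval s2 e = v src d c) ->
    hoare (Fill rp rmn2 a base e) s1 ((2 * (m * n)) * 5 + 4) (pure (fun s' => forall l : int,
     arr s' a l = if (b0 <= l) && (l < b0 + (2 * (m * n))%N%:Z) then v src d (absz (l - b0)) else arr s1 a l)).
  move=> sm1 b1 a45 ok deg Hb He.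
  have a6 : da a = 6%N by move: a45; rewrite !inE => /orP[] /eqP->.
  have sma s2 : same [:: rp] [:: a] s1 s2 -> same [:: rp] [:: 4; 5]%N s s2.
    move=> sm2; apply: same_trans sm1 _; apply: same_sub sm2 => // x.
    by rewrite inE => /eqP->.
  apply: (hoare_fill O Y8 U0_gt0) => //.
  - by have [[[_ _ _ ->] _] _ _ _ _] := bsub s1 sm1.
  - by move=> s2 /sma; apply: Hb.
  move=> c s2 _ b2 /sma sm2 pc; have E := He s2 c sm2 pc; split=> //.
  by rewrite -E a6; apply: (small_le Y8 deg); apply: eval_small => //; case/andP: ok => /andP[].
eapply (hoare_weaken (Q := pure (fun s' =>
    scaled_query (read_mx (arr s' 4%N) (2 * m) n) (read_mx (arr s' 5%N) (2 * m) n) t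
      (N %/ 4)%Z ((N + 1) %/ 4)%Z ((N + 2) %/ 4)%Z ((N + 3) %/ 4)%Z))); [|  | by []].
apply: (hoare_seq_pure U0_gt0 (fill 4%N _ _ 0 (- (N %/ 4)%Z) 2%N s _ bs _ _ _ _ _)) => //.
  move=> s2 c sm2 pc; have [_ n2 t2 a2 a3] := bsub s2 sm2; have o2 := eval_odd pc.
  by move: o2; rewrite /= n2 t2 a2 pc => ->; rewrite /v mulrN.
move=> s1 b1 sm1 P1; have {}sm1 : same [:: rp] [:: 4; 5]%N s s1 by apply: sub4; apply: fill_same sm1.
apply: (hoare_seq_pure U0_gt0 (fill 4%N _ _ (2 * (m * n))%N%:Z ((N + 2) %/ 4)%Z 3%N s1 _ b1 _ _ _ _ _)) => //.
- by move=> s2 /bsub[[[_ _ _ E] _] _ _ _ _].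
- move=> s2 c sm2 pc; have [_ n2 t2 a2 a3] := bsub s2 sm2; have o2 := eval_odd pc.
  by move: o2; rewrite /= n2 t2 a3 pc => ->.
move=> s2 b2 /fill_same sm2' P2; have sm2 : same [:: rp] [:: 4; 5]%N s s2 by apply: same_trans sm1 (sub4 _ _ sm2').
apply: (hoare_seq_pure U0_gt0 (fill 5%N _ _ 0 ((N + 1) %/ 4)%Z 3%N s2 _ b2 _ _ _ _ _)) => //.
  move=> s3 c sm3 pc; have [_ n2 t2 a2 a3] := bsub s3 sm3; have o2 := eval_odd pc.
  by move: o2; rewrite /= n2 t2 a3 pc => ->.
move=> s3 b3 /fill_same sm3' P3; have sm3 : same [:: rp] [:: 4; 5]%N s s3 by apply: same_trans sm2 (sub5 _ _ sm3').
apply: hoare_weaken (fill 5%N _ _ (2 * (m * n))%N%:Z (- ((N + 3) %/ 4)%Z) 2%N s3 _ b3 _ _ _ _ _) (leqnn _) _ => //.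
- by move=> s4 /bsub[[[_ _ _ E] _] _ _ _ _].
- move=> s4 c sm4 pc; have [_ n2 t2 a2 a3] := bsub s4 sm4; have o2 := eval_odd pc.
  by move: o2; rewrite /= n2 t2 a2 pc => ->; rewrite /v mulrN.
- move=> s4 tr b4 /fill_same sm4' [-> P4]; split=> //.
  have a4 l : arr s4 4%N l = arr s2 4%N l by rewrite (proj2 sm4') ?(proj2 sm3').
  have [[_ [_ _ sA sB]] _ _ _ _] := bsub s (same_refl _ _ _).
  have row1 (p : 'I_(2 * m)) (i : 'I_m) (j : 'I_n) : p = i :> nat -> (p * n + j = 0 + (i * n + j))%N.
    by move=> ->.
  have row2 (p : 'I_(2 * m)) (i : 'I_m) (j : 'I_n) : p = (m + i)%N :> nat -> (p * n + j = m * n + (i * n + j))%N.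
    by move=> ->; rewrite mulnDl addnA.
  split=> p i j pi; rewrite mxE ?(row1 p i j pi) ?(row2 p i j pi).
  + apply: (read_scaled sA t0) => c cm; rewrite a4 P2 ifF; last by lia.
    by rewrite P1 ifT; [congr (v 2%N _ _); lia|lia].
  + apply: (read_scaled sB t0) => c cm; rewrite a4 P2 ifT; last by lia.
    by congr (v 3%N _ _); lia.
  + apply: (read_scaled sB t0) => c cm; rewrite P4 ifF; last by lia.
    by rewrite P3 ifT; [congr (v 3%N _ _); lia|lia].
  + apply: (read_scaled sA t0) => c cm; rewrite P4 ifT; last by lia.
    by congr (v 2%N _ _); lia.
by lia.
Qed.

End Run.

(** * Assembling the pieces *)

Section Pieces.
Variables (R : realType) (s : R -> R) (lo : R).

(** The state of the output when the scan has reached [x]: the last piece is still open, so its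
    right end is [x] and only the cuts [i] with [i + 1 < P] exist. *)
Record pieces_upto (P : nat) (cut sl ic : nat -> R) (x : R) : Prop := PiecesUpto {
  cut_lo : forall i, (i.+1 < P)%N -> lo < cut i;
  cut_lt : forall i, (i.+1 < P)%N -> cut i < x;
  cut_sorted : forall i, (i.+2 < P)%N -> cut i < cut i.+1;
  slope_neq : forall i, (i.+1 < P)%N -> sl i != sl i.+1;
  piece_val : forall i y, (i < P)%N -> ((0 < i)%N -> cut i.-1 <= y) ->
    ((i.+1 < P)%N -> y <= cut i) -> lo <= y <= x -> s y = sl i * y + ic i }.

Lemma pieces_same P cut sl ic x y : pieces_upto P cut sl ic x -> (0 < P)%N ->
  lo <= x -> x <= y ->
  (forall z, x <= z <= y -> s z = s x + sl P.-1 * (z - x)) ->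
  pieces_upto P cut sl ic y.
Proof.
move=> [H1 H2 H3 H4 H5] P0 lox xy Hs; split=> //.
  by move=> i iP; apply: lt_le_trans xy; apply: H2.
move=> i z iP cl cr /andP[loz zy]; have [zx|xz] := leP z x.
  by apply: H5 => //; rewrite loz.
have iE : i.+1 = P.
  apply/eqP; rewrite eqn_leq iP /= leqNgt; apply/negP => iP'.
  by have := H2 i iP'; have := cr iP'; lra.
rewrite Hs ?zy ?ltW // -iE /= (H5 i x) //; first by lra.
- by case: i iE iP cl cr => // i iE iP _ _ _; apply/ltW/H2; rewrite iE.
- by rewrite iE ltnn.
by rewrite lox lexx.
Qed.

(** Piece [P] opens at [x], which becomes the cut [P - 1]; for [P = 0] there is no cut, and [x] is
    the left end [lo]. *)
Lemma pieces_new P cut sl ic cut' sl' ic' x y a b : pieces_upto P cut sl ic x ->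
  lo <= x -> x < y -> ((0 < P)%N -> lo < x) -> (P = 0%N -> x = lo) ->
  ((0 < P)%N -> sl P.-1 != a) ->
  (forall z, x <= z <= y -> s z = a * z + b) ->
  (forall i, (i.+1 < P)%N -> cut' i = cut i) -> ((0 < P)%N -> cut' P.-1 = x) ->
  (forall i, (i < P)%N -> sl' i = sl i /\ ic' i = ic i) -> sl' P = a -> ic' P = b ->
  pieces_upto P.+1 cut' sl' ic' y.
Proof.
move=> [H1 H2 H3 H4 H5] lox xy Plo P0 aP Hs c1 c2 s1 sP iP; split.
- move=> i iP'; have [iP2|iP2] := ltnP i.+1 P; first by rewrite c1 // H1.
  have PP : (0 < P)%N by lia.
  have -> : i = P.-1 by lia.
  by rewrite c2 //; apply: Plo.
- move=> i iP'; have [iP2|iP2] := ltnP i.+1 P.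
    by rewrite c1 //; apply: lt_trans (H2 i iP2) xy.
  have PP : (0 < P)%N by lia.
  have -> : i = P.-1 by lia.
  by rewrite c2.
- move=> i iP'; have [iP2|iP2] := ltnP i.+2 P.
    by rewrite !c1 ?H3 // ltnW.
  have PP : (0 < P)%N by lia.
  have iP3 : (i.+1 < P)%N by lia.
  have e : i.+1 = P.-1 by lia.
  by rewrite e c2 // c1 // H2.
- move=> i iP'; have [iP2|iP2] := ltnP i.+1 P.
    by rewrite (proj1 (s1 i (ltnW iP2))) (proj1 (s1 i.+1 iP2)) H4.
  have PP : (0 < P)%N by lia.
  have e1 : (P.-1 < P)%N by lia.
  have e2 : i.+1 = P by lia.
  have e3 : i = P.-1 by lia.
  by rewrite e2 sP e3 (proj1 (s1 _ e1)) aP.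
move=> i z iP' cl cr /andP[loz zy]; have [ilt|ige] := ltnP i P.
  have [-> ->] := s1 i ilt; have PP : (0 < P)%N by lia.
  have iP1 : (i.+1 < P.+1)%N by [].
  have zx : z <= x.
    have [iP2|iP2] := ltnP i.+1 P.
      by apply: le_trans (ltW (H2 i iP2)); rewrite -c1 // cr.
    have e : P.-1 = i by lia.
    by rewrite -(c2 PP) e cr.
  apply: H5 => //; last by rewrite loz.
    by move=> i0; rewrite -c1 ?cl // prednK.
  by move=> iP2; rewrite -c1 ?cr.
have iE : i = P by lia.
rewrite iE sP iP Hs // zy andbT.
have [P00|PP] := posnP P; first by rewrite (P0 P00).
by rewrite -(c2 PP) -iE cl // iE.
Qed.

Lemma line_unique (a b a' b' x y : R) : x != y -> a * x + b = a' * x + b' ->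
  a * y + b = a' * y + b' -> a = a' /\ b = b'.
Proof.
move=> xy e1 e2; have : (a - a') * (x - y) = 0 by lra.
move/eqP; rewrite mulf_eq0 !subr_eq0 (negPf xy) orbF => /eqP aa; split=> //.
by move: e1; rewrite aa => /addrI.
Qed.

(** An outer piece and the unbounded line agree at two points: the end of the scan, and a point [z]
    within one unit of it that still belongs to the piece. Hence they coincide beyond the scan as
    well. *)
Lemma pieces_final P cut sl ic hi : (0 < P)%N -> lo < hi ->
  (exists al be, forall x, hi - 1 <= x -> s x = al * x + be) ->
  (exists al be, forall x, x <= lo + 1 -> s x = al * x + be) ->
  pieces_upto P cut sl ic hi ->
  forall i y, (i < P)%N -> ((0 < i)%N -> cut i.-1 <= y) ->
    ((i.+1 < P)%N -> y <= cut i) -> s y = sl i * y + ic i.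
Proof.
move=> P0 lohi [a1 [b1 R1]] [a2 [b2 R2]] [H1 H2 H3 H4 H5] i y iP cl cr.
have [ylo|loy] := ltP y lo.
  have i0 : i = 0%N.
    case: i iP cl cr => // i iP cl _.
    by have := lt_le_trans (H1 i iP) (cl isT); rewrite ltNge ltW.
  pose z := Num.min (Num.min (lo + 1) hi) (if (1 < P)%N then cut 0%N else hi).
  have zlo : lo < z.
    by rewrite !lt_min lohi (_ : lo < lo + 1) /=; [case: ifP => // /H1|lra].
  have z1 : z <= lo + 1 by rewrite !ge_min lexx.
  have z2 : z <= hi by rewrite !ge_min lexx !orbT.
  have z3 : (1 < P)%N -> z <= cut 0%N by move=> P1; rewrite ge_min P1 lexx orbT.
  have E1 : s lo = sl 0%N * lo + ic 0%N.
    by apply: H5 => // [P1|]; [apply/ltW/H1|rewrite lexx ltW].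
  have E2 : s z = sl 0%N * z + ic 0%N by apply: H5 => //; rewrite z2 ltW.
  rewrite R2 in E1; last by lra.
  rewrite R2 // in E2.
  have [] := line_unique (_ : lo != z) E1 E2; first by rewrite lt_eqF.
  by move=> aE bE; rewrite i0 R2; [rewrite aE bE|lra].
have [yhi|hiy] := leP y hi; first by apply: H5 => //; rewrite loy.
have iE : i.+1 = P.
  apply/eqP; rewrite eqn_leq iP leqNgt; apply/negP => iP'.
  by have := H2 i iP'; have := cr iP'; lra.
pose z := Num.max (Num.max (hi - 1) lo) (if (0 < i)%N then cut i.-1 else lo).
have cz : (0 < i)%N -> cut i.-1 < hi by case: (i) iP => // j jP _; apply: H2.
have zhi : z < hi.
  by rewrite !gt_max lohi (_ : hi - 1 < hi) /=; [case: ifP => // /cz|lra].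
have z1 : hi - 1 <= z by rewrite !le_max lexx.
have z2 : lo <= z by rewrite !le_max lexx !orbT.
have z3 : (0 < i)%N -> cut i.-1 <= z by move=> i0; rewrite le_max i0 lexx orbT.
have E1 : s hi = sl i * hi + ic i.
  apply: H5 => //; [by move=> /cz/ltW|by rewrite iE ltnn|by rewrite lexx ltW].
have E2 : s z = sl i * z + ic i.
  by apply: H5 => //; [by rewrite iE ltnn|rewrite z2 ltW].
rewrite R1 in E1; last by lra.
rewrite R1 // in E2.
have [] := line_unique (_ : hi != z) E1 E2; first by rewrite gt_eqF.
by move=> aE bE; rewrite R1; [rewrite aE bE|lra].
Qed.

End Pieces.

Definition cell_ratio (R : realType) (f : int -> int) (i : nat) : R :=
  (f (2 * i)%N%:Z)%:~R / (f (2 * i).+1%N%:Z)%:~R.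

Lemma ratr_read_rat (R : realType) f i : ratr (read_rat f i) = cell_ratio R f i.
Proof. by rewrite /read_rat fmorph_div /= !ratr_int. Qed.

Lemma identifies_output (R : realType) m n (A B : 'M[option int]_(m, n)) (s : R -> R)
    (st : state) (P : nat) :
  no_common_bottom_col A B ->
  (forall lam, spectral A B lam (s lam)) ->
  reg st 0%N = P%:Z ->
  let cut := cell_ratio R (arr st 0%N) in
  let sl := fun i => cell_ratio R (arr st 1%N) (2 * i) in
  let ic := fun i => cell_ratio R (arr st 1%N) (2 * i).+1 in
  (forall i, (i.+1 < P)%N -> cut i < cut i.+1) ->
  (forall i, (i < P)%N -> (sl i, ic i) != (sl i.+1, ic i.+1)) ->
  (forall i y, (i <= P)%N -> ((0 < i)%N -> cut i.-1 <= y) ->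
    ((i < P)%N -> y <= cut i) -> s y = sl i * y + ic i) ->
  identifies (mx_real R A) (mx_real R B) (output st).
Proof.
move=> ABc sP PE cut sl ic Hsort Hneq Hval.
have cE i : (i < P)%N -> ratr (nth 0 (cuts (output st)) i) = cut i.
  by move=> iP; rewrite /output PE /= nth_mkseq // ratr_read_rat.
have nE j : (j <= P)%N -> nth (0, 0) (pieces (output st)) j =
    (read_rat (arr st 1%N) (2 * j), read_rat (arr st 1%N) (2 * j).+1).
  by move=> jP; rewrite /output PE; apply: nth_mkseq.
have pE i x : (i <= P)%N -> piece_at (output st) i x = sl i * x + ic i.
  by move=> iP; rewrite /piece_at nE // !ratr_read_rat.
have sizeE : size (cuts (output st)) = P by rewrite /output PE /= size_mkseq.
have onE i x : on_piece (output st) i x -> [/\ (i <= P)%N, (0 < i)%N -> cut i.-1 <= x &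
    (i < P)%N -> x <= cut i].
  move=> []; rewrite sizeE => iP H1 H2; split=> // [i0|iP'].
    by rewrite -cE ?H1 //; lia.
  by rewrite -cE ?H2.
have valE i x : on_piece (output st) i x -> s x = piece_at (output st) i x.
  by move=> /onE[iP H1 H2]; rewrite pE //; apply: Hval.
split.
- by rewrite sizeE /output PE; apply: size_mkseq.
- apply/(sortedP 0) => i; rewrite sizeE => iP; rewrite -(ltr_rat R) !cE ?Hsort //; lia.
- move=> i; rewrite sizeE => iP; apply: contra (Hneq i iP) => /eqP.
  rewrite !nE ?(ltnW iP) // => -[e1 e2].
  by rewrite /sl /ic -!ratr_read_rat e1 e2.
- by move=> i lam on; rewrite -(valE i lam on); apply: spectral_is_value.
apply/seteqP; split=> lam /=.
  move=> /(spec_spectral ABc (sP lam)) s0.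
  have [i on] : exists i, on_piece (output st) i lam.
    (* The first piece whose right cut is not exceeded contains [lam], as the previous cut is
       smaller. *)
    have ex : exists i, (i == P) || (lam <= cut i) by exists P; rewrite eqxx.
    case: (ex_minnP ex) => i Hi mini; have iP : (i <= P)%N by apply: mini; rewrite eqxx.
    exists i; split; rewrite ?sizeE // => i0.
      have i1 : (i.-1 < P)%N by lia.
      rewrite cE // leNgt; apply/negP => lt; have := mini i.-1; rewrite (ltW lt) orbT; lia.
    by rewrite cE //; move: Hi; rewrite (ltn_eqF i0).
  by exists i => //; rewrite -valE.
by move=> [i on p0]; apply/(spec_spectral ABc (sP lam)); rewrite (valE _ _ on).
Qed.

(** * The scan *)

Section Scanning.
Variables (R : realType) (O : oracle) (m n M : nat) (A B : 'M[option int]_(m, n)) (Y : nat).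
Hypotheses (OP : oracle_correct R O) (adm : admissible M A B).
Let k := minn (2 * m) n.
Hypotheses (Y8 : (8 <= Y)%N) (Ycells : (2 * (m * n * n) <= Y)%N)
  (YK : (k * k <= Y)%N) (YM : (2 * M <= Y)%N).
Variables (sf : R -> R) (lo hi : int) (M' : nat).
Hypotheses (sfP : forall lam, spectral A B lam (sf lam)) (lohi : lo < hi).

(* The candidates for the breakpoints are the numbers [N / (2 t)]. *)
Definition candidate (N : int) (t : nat) :=
  (0 < t <= k * k)%N /\ 2 * lo * t%:Z <= N <= 2 * hi * t%:Z.

Hypotheses (candM' : forall N t (d : int), candidate N t -> 0 <= d <= 3 ->
    `|((N + d) %/ 4)%Z| + t%:Z * M%:Z <= M'%:Z)
  (candY : forall N t, candidate N t -> `|N| <= Y%:Z) (YM' : (2 * n * M' <= Y)%N).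
Notation hoare := (hoare O Y dr da U0).
Notation bnd := (bnd Y dr da).
Notation small := (fits Y).
Notation based := (based A B).

Let m_gt0 : (0 < m)%N. Proof. by case: adm. Qed.
Let n_gt0 : (0 < n)%N. Proof. by case: adm. Qed.

Lemma small_int d (z : int) : `|z| <= Y%:Z -> (0 < d)%N -> small d z.
Proof. by move=> zY d0; apply: (small_le Y8 d0); rewrite /fits expn1 -lez_nat abszE. Qed.

Definition good g := games (2 * m) n M' g.

Lemma query_read s (em en : expr) a b (m' n' : nat) :
  eval s em = m'%:Z -> eval s en = n'%:Z ->
  query s em en a b = Game (read_mx (arr s a) m' n') (read_mx (arr s b) m' n').
Proof. by rewrite /query => -> ->. Qed.

Lemma query_spec s N t : bnd s -> based s -> reg s rN' = N -> reg s rt' = t%:Z ->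
  candidate N t ->
  hoare Query s (40 * (m * n) + 25) (fun s' tr => exists g, [/\ tr = [:: g], good g,
    0 < reg s' rvd' & (reg s' rvn')%:~R / (reg s' rvd')%:~R = sf (N%:~R / (2 * t%:R))]).
Proof.
move=> bs Bs NE tE cand; have [/andP[t0 tK] _] := cand.
have [_ _ [Ar Br] ABc [bA bB]] := adm.
pose QQ := fun (s' : state) tr => exists g, [/\ tr = [:: g], good g,
    0 < reg s' rvd' & (reg s' rvn')%:~R / (reg s' rvd')%:~R = sf (N%:~R / (2 * t%:R))].
apply: (hoare_weaken (b := (40 * (m * n) + 19 + 5).+1) (Q := QQ)) => //; last by lia.
apply: (hoare_seq_pure U0_gt0 (build_spec O adm Y8 Ycells YK YM bs Bs NE tE t0)).
move=> s1 b1 sm1 [gA1 gA2 gB1 gB2].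
have Bs1 : based s1 by apply: based_same sm1 Bs.
have [[nE m2E _ _] _] := Bs1.
set gA := read_mx (arr s1 4%N) _ _ in gA1 gA2 *.
set gB := read_mx (arr s1 5%N) _ _ in gB1 gB2 *.
pose g := Game gA gB.
have qE : query s1 (EReg rm2) (EReg rn) 4 5 = g by apply: query_read.
have wp : well_posed g by apply: (scaled_well_posed gA1 gA2 gB1 gB2 _ Ar Br ABc).
have cb d : 0 <= d <= 3 -> `|((N + d) %/ 4)%Z| + t%:Z * M%:Z <= M'%:Z by apply: candM'.
have [gbA gbB] : bounded_by M' gA /\ bounded_by M' gB.
  apply: (scaled_bounded gA1 gA2 gB1 gB2 bA bB); try exact: cb.
  by have := cb 0; rewrite addr0; apply.
have gg : good g by split.
have NE4 : N = (N %/ 4)%Z + ((N + 1) %/ 4)%Z + ((N + 2) %/ 4)%Z + ((N + 3) %/ 4)%Z by lia.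
have aE := answer_value OP wp (scaled_value t0 gA1 gA2 gB1 gB2 NE4 (sfP (N%:~R / (2 * t%:R)))).
have [d0 dn nM] := answer_bounds OP wp gbA gbB.
set num := numq (answer O g) in nM; set den := denq (answer O g) in d0 dn.
have snum : `|num| <= Y%:Z by apply: le_trans nM _; rewrite /=; lia.
have sden : `|den| <= Y%:Z.
  by rewrite gtr0_norm //; apply: le_trans dn _; rewrite /=; have := Yn adm Ycells; lia.
apply: (@hoare_seq O Y dr da U0 _ _ _ 1 3) => //.
apply: (hoare_call Y8 b1 qE) => //.
rewrite -/num -/den; set s2 := set_reg _ _ _.
have b2 : bnd s2 by do 2 (apply: bnd_set; last exact: small_int).
have n1 : reg s1 rN' = N by rewrite (proj1 sm1).
have t1 : reg s1 rt' = t%:Z by rewrite (proj1 sm1).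
apply: hoare_seq_aset => // b3; set s3 := set_reg _ _ _ in b3 *.
apply: hoare_aset => //; rewrite /QQ cats0; exists g; split=> //.
  by rewrite /= t1 mulr_gt0 // mulr_gt0.
have {}aE : num%:~R = den%:~R * (t%:R * sf (N%:~R / (2 * t%:R)) +
    ((N %/ 4)%Z + ((N + 1) %/ 4)%Z - ((N + 2) %/ 4)%Z - ((N + 3) %/ 4)%Z)%:~R / 2) :> R.
  rewrite -aE /ratr -/num -/den mulrCA divff ?mulr1 // intr_eq0; lia.
have t0R : t%:R != 0 :> R by rewrite pnatr_eq0; lia.
have d0R : den%:~R != 0 :> R by rewrite intr_eq0; lia.
rewrite /= n1 t1.
move: aE; set d := _ - _ - _; set x := sf _ => aE.
rewrite rmorphB rmorphM /= aE; rewrite !rmorphM /=; field.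
by rewrite t0R d0R.
Qed.

Lemma next_spec s N t : bnd s -> based s -> reg s rN = N -> reg s rt = t%:Z ->
  candidate N t -> reg s rhi = 2 * hi -> N < 2 * hi * t%:Z ->
  hoare Next s (10 * (k * k) + 12) (pure (fun s' => exists N' t',
    [/\ reg s' rN' = N', reg s' rt' = t'%:Z, candidate N' t', N * t'%:Z < N' * t%:Z &
      forall N'' t'', (0 < t'' <= k * k)%N -> N * t''%:Z < N'' * t%:Z ->
        N' * t''%:Z <= N'' * t'%:Z])).
Proof.
move=> bs Bs NE tE cand hiE Nhi; have [/andP[t0 tK] /andP[Nlo _]] := cand.
have kk0 : (0 < k * k)%N by apply: leq_trans tK.
have [_ [KE _ _ _]] := Bs.
pose v (i : nat) : int := - ((N * i.+1%:Z %/ t%:Z)%Z + 1).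
have tZ : 0 < t%:Z by rewrite ltz_nat.
have fl (i : nat) : (N * i.+1%:Z %/ t%:Z)%Z * t%:Z <= N * i.+1%:Z <
    ((N * i.+1%:Z %/ t%:Z)%Z + 1) * t%:Z.
  have := divz_eq (N * i.+1%:Z) t%:Z; have := ltz_pmod (N * i.+1%:Z) tZ.
  have := modz_ge0 (N * i.+1%:Z) (lt0r_neq0 tZ); rewrite mulrDl; lia.
eapply (hoare_weaken (Q := pure (fun s' => exists N' t',
    [/\ reg s' rN' = N', reg s' rt' = t'%:Z, candidate N' t', N * t'%:Z < N' * t%:Z &
      forall N'' t'', (0 < t'' <= k * k)%N -> N * t''%:Z < N'' * t%:Z ->
        N' * t''%:Z <= N'' * t'%:Z]))); [| |by []].
apply: (hoare_seq_pure U0_gt0 (hoare_bestfrac O Y8 U0_gt0 (v := v) KE kk0 bs _ _ _ _)) => //.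
  move=> i s1 ik sm1 pE; split.
    have iE : i.+1%:Z = i%:Z + 1%Z by rewrite -addn1 PoszD.
    by rewrite /= pE (proj1 sm1 rN isT) (proj1 sm1 rt isT) NE tE sub0z /v iE.
  have NY := candY cand; have : (i.+1 <= Y)%N by apply: leq_trans YK.
  rewrite /fits /v abszN => iY.
  have h1 : (`|((N * i.+1%:Z) %/ t%:Z)%Z| <= Y ^ 2)%N.
    apply: leq_trans (absz_divz_le _ _) _; rewrite abszM leq_mul //; lia.
  apply: (@leq_trans (Y ^ 2 + Y ^ 0)); first by rewrite expn0; lia.
  apply: leq_trans (Ypow2 Y8 _ _) _; rewrite leq_pexp2l //; lia.
move=> s1 b1 sm1 [i [ik bnE tE' best]].
have N'E : 0%Z - reg s1 rbn = (N * i.+1%:Z %/ t%:Z)%Z + 1 by rewrite bnE sub0z opprK.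
have ft := fl i; move: N'E; set N' := (_ + 1) => N'E.
have [ft1 ft2] := andP ft.
have minimal N'' t'' : (0 < t'' <= k * k)%N -> N * t''%:Z < N'' * t%:Z ->
    N' * t''%:Z <= N'' * i.+1%:Z.
  case: t'' => // j /andP[_ jk] H; have := best j jk; rewrite /v -/N' !mulNr lerN2.
  have : (N * j.+1%:Z %/ t%:Z)%Z + 1 <= N'' by rewrite lezD1 ltz_divLR.
  move=> h /le_trans; apply; exact: ler_wpM2r.
have candN : candidate N' i.+1.
  split; first by [].
  (* The end of the range is itself a competitor, with denominator [1], so the next point does not
     overshoot [hi]. *)
  have := minimal (2 * hi) 1%N; rewrite kk0 !mulr1 => /(_ isT Nhi) ->; rewrite andbT.
  have h1 : 2 * lo * t%:Z * i.+1%:Z <= N * i.+1%:Z by apply: ler_wpM2r.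
  have h2 : 2 * lo * i.+1%:Z * t%:Z < N' * t%:Z.
    by apply: le_lt_trans ft2; rewrite mulrAC.
  by move: h2; rewrite ltr_pM2r // => /ltW.
apply: hoare_set => //.
  by rewrite (N'E : eval s1 (EOp OSub (ECst 0) (EReg rbn)) = N'); apply: small_int => //; apply: candY candN.
split=> //; exists N', i.+1; split=> //; by rewrite /= N'E.
by lia.
Qed.

Definition new_slope_num s := 2 * reg s rt * reg s rt' * (reg s rvn' * reg s rvd - reg s rvn * reg s rvd').
Definition new_slope_den s := reg s rvd * reg s rvd' * (reg s rN' * reg s rt - reg s rN * reg s rt').

Lemma emit_spec s (P : nat) : bnd s -> reg s rP = P%:Z -> (P < Y)%N ->
  let sn := new_slope_num s in let sd := new_slope_den s in
  hoare Emit s 30 (pure (fun s' =>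
    if sn * reg s rsd - reg s rsn * sd == 0 then
      [/\ reg s' rP = P, reg s' rsn = reg s rsn, reg s' rsd = reg s rsd,
          arr s' 0%N = arr s 0%N & arr s' 1%N = arr s 1%N]
    else
      [/\ reg s' rP = P.+1, reg s' rsn = sn, reg s' rsd = sd,
          forall l, arr s' 0%N l = if l == 2 * P%:Z - 1 then 2 * reg s rt else
             if l == 2 * P%:Z - 2 then reg s rN else arr s 0%N l &
          forall l, arr s' 1%N l = if l == 4 * P%:Z + 3 then reg s rvd * (2 * reg s rt) * sd else
             if l == 4 * P%:Z + 2 then reg s rvn * (2 * reg s rt) * sd - sn * reg s rN * reg s rvd
             else if l == 4 * P%:Z + 1 then sd else if l == 4 * P%:Z then sn else arr s 1%N l])).
Proof.
move=> bs PE PY sn sd.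
set QQ := pure _.
eapply (hoare_weaken (Q := QQ)); [| |by []].
apply: hoare_seq_aset => // {}bs; apply: hoare_seq_aset => // {}bs.
set s1 := set_reg _ _ _ in bs *.
have nE : reg s1 rsn' = sn by [].
have dE : reg s1 rsd' = sd by [].
have cE : eval s1 ($rsn' * $rsd - $rsn * $rsd')%P = sn * reg s rsd - reg s rsn * sd by [].
apply: (hoare_if Y8 (b := 17)) => //; rewrite cE => c1; last first.
  apply: (@hoare_weaken _ _ _ _ _ _ _ 1 17 QQ) => //.
  by apply: hoare_skip => //; split=> //; rewrite c1 eqxx.
do 6 (apply: hoare_seq_aput => // {}bs).
have P1 : 0 <= P%:Z + 1 <= Y%:Z by lia.
apply: (hoare_seq_setv Y8 U0_gt0 (v := P.+1%:Z)) => //.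
  by rewrite -[in RHS]addn1 PoszD -PE.
move=> {}bs; apply: hoare_seq_aset => // {}bs.
apply: hoare_aset => //; split=> //; rewrite (negPf c1); split=> //.
- by move=> l; rewrite /= PE.
by move=> l; rewrite /= PE.
by [].
Qed.

End Scanning.

Lemma absz_sub_le (a b c : int) : a <= b -> b <= c -> (absz (c - b) <= absz (c - a))%N.
Proof. lia. Qed.

Lemma absz_sub_lt (a b c : int) : a < b -> b <= c -> (absz (c - b) < absz (c - a))%N.
Proof. lia. Qed.

Lemma cell_ratio_eq (R : realType) f g i : f (2 * i)%N%:Z = g (2 * i)%N%:Z ->
  f (2 * i).+1%N%:Z = g (2 * i).+1%N%:Z -> cell_ratio R f i = cell_ratio R g i.
Proof. by rewrite /cell_ratio => -> ->. Qed.

Lemma pushed_piece (f g : int -> int) (P : nat) (a b c d : int) :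
  (forall l, g l = if l == 4 * P%:Z + 3 then d else if l == 4 * P%:Z + 2 then c else
     if l == 4 * P%:Z + 1 then b else if l == 4 * P%:Z then a else f l) ->
  [/\ g (2 * (2 * P))%N%:Z = a, g (2 * (2 * P)).+1%N%:Z = b,
      g (2 * (2 * P).+1)%N%:Z = c, g (2 * (2 * P).+1).+1%N%:Z = d &
      forall j, (j < 4 * P)%N -> g j%:Z = f j%:Z].
Proof.
move=> gE; split=> [||||j jP]; rewrite gE.
- by do 3 (rewrite ifF; last by lia); rewrite ifT //; lia.
- by do 2 (rewrite ifF; last by lia); rewrite ifT //; lia.
- by rewrite ifF ?ifT //; lia.
- by rewrite ifT //; lia.
by do 4 (rewrite ifF; last by lia).
Qed.

Lemma pushed_cut (f g : int -> int) (P : nat) (a b : int) :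
  (forall l, g l = if l == 2 * P%:Z - 1 then b else if l == 2 * P%:Z - 2 then a else f l) ->
  ((0 < P)%N -> g (2 * P.-1)%N%:Z = a /\ g (2 * P.-1).+1%N%:Z = b) /\
  forall j, (j < 2 * P.-1)%N -> g j%:Z = f j%:Z.
Proof.
move=> gE; split=> [P0|j jP]; rewrite !gE.
  split; first by rewrite ifF ?ifT //; lia.
  by rewrite ifT //; lia.
by do 2 (rewrite ifF; last by lia).
Qed.

(** * The scan loop and its invariant *)

Section ScanLoop.
Variables (R : realType) (O : oracle) (m n M : nat) (A B : 'M[option int]_(m, n)) (Y : nat).
Hypotheses (OP : oracle_correct R O) (adm : admissible M A B).
Let k := minn (2 * m) n.
Hypotheses (Y8 : (8 <= Y)%N) (Ycells : (2 * (m * n * n) <= Y)%N)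
  (YK : (k * k <= Y)%N) (YM : (2 * M <= Y)%N).
Variables (sf : R -> R) (lo hi : int) (M' : nat).
Hypotheses (sfP : forall lam, spectral A B lam (sf lam)) (lohi : lo < hi).
Notation candidate := (candidate m n lo hi).
Hypotheses (candM' : forall N t (d : int), candidate N t -> 0 <= d <= 3 ->
    `|((N + d) %/ 4)%Z| + t%:Z * M%:Z <= M'%:Z)
  (candY : forall N t, candidate N t -> `|N| <= Y%:Z) (YM' : (2 * n * M' <= Y)%N).
Notation hoare := (hoare O Y dr da U0).
Notation bnd := (bnd Y dr da).
Notation small := (fits Y).
Notation based := (based A B).
Notation good := (good m n M').

Let m_gt0 : (0 < m)%N. Proof. by case: adm. Qed.
Let n_gt0 : (0 < n)%N. Proof. by case: adm. Qed.

Definition frac (N : int) (t : nat) : R := N%:~R / (2 * t%:R).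

(* Counts the fractions [N' / t'] with [t' <= k ^ 2] between [N / t] and [2 hi]. *)
Definition remaining (N : int) (t : nat) : nat :=
  \sum_(j < k * k) absz (2 * hi * j.+1%:Z - (N * j.+1%:Z %/ t%:Z)%Z)%R.

(** The sum of [2 * (hi - lo) * t] over [t <= k ^ 2], which is [remaining] at the left end. *)
Definition max_calls : nat := absz (hi - lo)%R * (k * k * (k * k).+1).

Hypothesis YP : (max_calls < Y)%N.

Definition cuts_of s := cell_ratio R (arr s 0%N).
Definition slopes_of s i := cell_ratio R (arr s 1%N) (2 * i).
Definition intercepts_of s i := cell_ratio R (arr s 1%N) (2 * i).+1.

(** The bound on [P + remaining N t] keeps the number of pieces below [Y]. As long as [P = 0], the
    scan is at its left end and the recorded slope is the impossible [2]. *)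
Definition scanned s N t P :=
  [/\ reg s rN = N, reg s rt = t%:Z, candidate N t & reg s rP = P%:Z] /\
  [/\ 0 < reg s rvd, (reg s rvn)%:~R / (reg s rvd)%:~R = sf (frac N t),
      (P + remaining N t <= max_calls)%N & 0 < reg s rsd] /\
  [/\ P = 0%N -> [/\ N = 2 * lo * t%:Z, reg s rsn = 2 & reg s rsd = 1],
      (0 < P)%N -> 2 * lo * t%:Z < N /\
        (reg s rsn)%:~R / (reg s rsd)%:~R = slopes_of s P.-1 &
      pieces_upto sf lo%:~R P (cuts_of s) (slopes_of s) (intercepts_of s) (frac N t)].

Definition scan_inv s := [/\ based s, reg s rlo = 2 * lo, reg s rhi = 2 * hi &
  exists N t P, scanned s N t P].

Lemma frac_lt N t N' t' : (0 < t)%N -> (0 < t')%N ->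
  (frac N t < frac N' t') = (N * t'%:Z < N' * t%:Z).
Proof.
move=> t0 t0'; rewrite /frac ltr_pdivrMr ?mulr_gt0 ?ltr0n // mulrAC ltr_pdivlMr ?mulr_gt0 ?ltr0n //.
rewrite [2 * _]mulrC [2 * t%:R]mulrC !mulrA ltr_pM2r //.
by rewrite -(ltr_int R) !rmorphM.
Qed.

Lemma frac_le N t N' t' : (0 < t)%N -> (0 < t')%N ->
  (frac N t <= frac N' t') = (N * t'%:Z <= N' * t%:Z).
Proof. by move=> t0 t0'; rewrite leNgt frac_lt // -leNgt. Qed.

Lemma frac_int (z : int) : frac (2 * z) 1 = z%:~R.
Proof. by rewrite /frac rmorphM /= mulr1; field. Qed.

(** No term increases, and the term of denominator [t'] drops strictly: the floor is exact there,
    since [N' / t'] has this denominator and lies beyond [N / t]. *)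
Lemma remaining_lt N t N' t' : candidate N t -> candidate N' t' ->
  N * t'%:Z < N' * t%:Z -> (remaining N' t' < remaining N t)%N.
Proof.
move=> [/andP[t0 tK] /andP[_ Nhi]] [/andP[t0' tK'] /andP[_ Nhi']] lt.
have tZ : 0 < t%:Z by rewrite ltz_nat.
have tZ' : 0 < t'%:Z by rewrite ltz_nat.
have mono (j : nat) : (N * j.+1%:Z %/ t%:Z)%Z <= (N' * j.+1%:Z %/ t'%:Z)%Z.
  rewrite lez_divRL // -(ler_pM2r tZ).
  have h : (N * j.+1%:Z %/ t%:Z)%Z * t%:Z <= N * j.+1%:Z by apply: lez_floor; rewrite lt0r_neq0.
  have h1 := ler_wpM2r (ltW tZ') h; have j0 : 0 < j.+1%:Z by [].
  have h2 : N * t'%:Z * j.+1%:Z <= N' * t%:Z * j.+1%:Z by rewrite ler_pM2r // ltW.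
  lia.
have ub (j : nat) : (N' * j.+1%:Z %/ t'%:Z)%Z <= 2 * hi * j.+1%:Z.
  rewrite -ltzD1 ltz_divLR //.
  have j0 : 0 <= j.+1%:Z by [].
  by have := ler_wpM2r j0 Nhi'; lia.
have tK1 : (t'.-1 < k * k)%N by rewrite prednK.
rewrite /remaining (bigD1 (Ordinal tK1)) //= [X in (_ < X)%N](bigD1 (Ordinal tK1)) //=.
rewrite -addSn leq_add //; last first.
  by apply: leq_sum => j _; apply: absz_sub_le.
have := ub t'.-1; rewrite !prednK // mulzK ?lt0r_neq0 // => ubt.
by apply: absz_sub_lt => //; rewrite ltz_divLR.
Qed.

Lemma remaining_start : remaining (2 * lo) 1 = max_calls.
Proof.
rewrite /remaining /max_calls.
rewrite (eq_bigr (fun j : 'I_(k * k) => (absz (hi - lo)%R * (2 * j.+1))%N)); last first.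
  move=> j _; rewrite divz1.
  have -> : 2 * hi * j.+1%:Z - 2 * lo * j.+1%:Z = (hi - lo) * (2 * j.+1)%N%:Z.
    by rewrite PoszM; ring.
  by rewrite abszM.
rewrite -big_distrr /= -big_distrr /=; congr (_ * _)%N.
by elim: (k * k)%N => [|q IH]; rewrite ?big_ord0 // big_ord_recr /= mulnDr IH; lia.
Qed.

(** By minimality of the next point, no candidate lies strictly between the two, so [sf] is affine
    there and the slope through the end points is its slope. *)
Lemma scan_step s : bnd s -> scan_inv s -> eval s ($rN + #1 <= $rhi * $rt)%P != 0 ->
  hoare (Next;; Query;; Emit;; Shift)%P s (40 * (m * n) + 10 * (k * k) + 90)
    (fun s2 tr => exists g, [/\ tr = [:: g], good g, scan_inv s2 &
      (remaining (reg s2 rN) (absz (reg s2 rt)) < remaining (reg s rN) (absz (reg s rt)))%N]).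
Proof.
move=> bs [Bs loE hiE [N [t [P [[NE tE cand PE] [[vd0 vE PM sd0] [P0 PS pcs]]]]]]].
rewrite /= NE tE hiE; case: ifP => // Nhi _.
set QQ := fun s2 : state => _.
have [/andP[t0 tK] _] := cand.
eapply (hoare_weaken (Q := QQ)); [| |by []].
apply: (hoare_seq_pure U0_gt0 (next_spec O adm Y8 Ycells YK YM lohi candY YM' bs Bs NE tE cand hiE _)); first by lia.
move=> s1 b1 sm1 [N' [t' [NE' tE' cand' lt minimal]]].
have Bs1 : based s1 by apply: based_same sm1 Bs.
have [/andP[t0' tK'] _] := cand'.
apply: (hoare_seq U0_gt0); apply: hoare_weaken
  (query_spec OP adm Y8 Ycells YK YM sfP lohi candM' YM' b1 Bs1 NE' tE' cand') (leqnn _) _.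
move=> s2 tr b2 sm2 [g [-> gg vd0' vE']].
have S12 x : x \notin modr Next -> x \notin modr Query -> reg s2 x = reg s x.
  by move=> x1 x2; rewrite (proj1 sm2 x x2) (proj1 sm1 x x1).
have A12 a : a \in [:: 0; 1]%N -> arr s2 a = arr s a.
  by rewrite !inE => /orP[] /eqP->; rewrite (proj2 sm2) ?(proj2 sm1).
have N2 : reg s2 rN = N by rewrite S12.
have t2 : reg s2 rt = t%:Z by rewrite S12.
have P2 : reg s2 rP = P%:Z by rewrite S12.
have vn2 : reg s2 rvn = reg s rvn by rewrite S12.
have vd2 : reg s2 rvd = reg s rvd by rewrite S12.
have sn2 : reg s2 rsn = reg s rsn by rewrite S12.
have sd2 : reg s2 rsd = reg s rsd by rewrite S12.
have N2' : reg s2 rN' = N' by rewrite (proj1 sm2).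
have t2' : reg s2 rt' = t'%:Z by rewrite (proj1 sm2).
have rem := remaining_lt cand cand' lt.
have PY : (P < Y)%N by apply: leq_ltn_trans YP; lia.
apply: (hoare_seq_pure U0_gt0 (emit_spec O adm Y8 Ycells YK YM lohi YM' b2 P2 PY)).
move=> s3 b3 sm3 H3.
have Bs3 : based s3 by apply: based_same sm3 (based_same _ _ sm2 Bs1).
have F3 x : x \notin modr Emit -> reg s3 x = reg s2 x by apply: (proj1 sm3).
set sn := new_slope_num s2 in H3; set sd := new_slope_den s2 in H3.
have N3 : reg s3 rN' = N' by rewrite F3.
have t3 : reg s3 rt' = t'%:Z by rewrite F3.
have vn3 : reg s3 rvn' = reg s2 rvn' by rewrite F3.
have vd3 : reg s3 rvd' = reg s2 rvd' by rewrite F3.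
have snE : sn = 2 * t%:Z * t'%:Z * (reg s2 rvn' * reg s rvd - reg s rvn * reg s2 rvd').
  by rewrite /sn /new_slope_num t2 t2' vd2 vn2.
have sdE : sd = reg s rvd * reg s2 rvd' * (N' * t%:Z - N * t'%:Z).
  by rewrite /sd /new_slope_den t2 t2' vd2 N2 N2'.
move: vE' vd0' vn3 vd3 snE sdE; set vn' := reg s2 rvn'; set vd' := reg s2 rvd'.
move: vE vd0; rewrite vn2 vd2 N2 t2 sn2 sd2 !A12 // in H3 *; set vn := reg s rvn; set vd := reg s rvd.
move=> vE vd0 vE' vd0' vn3 vd3 snE sdE.
have sd'0 : 0 < sd by rewrite sdE !mulr_gt0 // subr_gt0.
have tR : t%:R != 0 :> R by rewrite pnatr_eq0 -lt0n.
have tR' : t'%:R != 0 :> R by rewrite pnatr_eq0 -lt0n.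
have vdR : vd%:~R != 0 :> R by rewrite intr_eq0 gt_eqF.
have vdR' : vd'%:~R != 0 :> R by rewrite intr_eq0 gt_eqF.
have sdR : sd%:~R != 0 :> R by rewrite intr_eq0 gt_eqF.
have xy : frac N t < frac N' t' by rewrite frac_lt.
have nocand (N'' : int) (t'' : nat) : (0 < t'' <= minn (2 * m) n ^ 2)%N ->
    ~ (frac N t < N''%:~R / (2 * t''%:R) < frac N' t').
  rewrite -/(frac N'' t'') -/k -mulnn => tb; have [t0'' _] := andP tb.
  by rewrite !frac_lt // => /andP[h1]; rewrite ltNge (minimal N'' t'' tb h1).
have [al [be Hab]] := s_affine_between sfP xy nocand.
have yE : frac N' t' - frac N t = (N' * t%:Z - N * t'%:Z)%:~R / (2 * t%:R * t'%:R).
  by rewrite /frac rmorphB !rmorphM /=; field; rewrite tR tR'.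
have alE : al * (frac N' t' - frac N t) = sf (frac N' t') - sf (frac N t).
  by rewrite !Hab ?lexx ?ltW //; ring.
have dR : N'%:~R * t%:R - N%:~R * t'%:R != 0 :> R.
  have : (N' * t%:Z - N * t'%:Z)%:~R != 0 :> R by rewrite intr_eq0 subr_eq0 gt_eqF.
  by rewrite rmorphB !rmorphM.
have aR : sn%:~R / sd%:~R = al :> R.
  have xy0 : frac N' t' - frac N t != 0 by rewrite subr_eq0 gt_eqF.
  apply: (mulIf xy0); rewrite alE -vE -vE' yE snE sdE !rmorphM rmorphB !rmorphM /=.
  by field; rewrite tR tR' vdR vdR' dR.
have beE : sf (frac N t) = al * frac N t + be by rewrite Hab // lexx ltW.
have al1 : al <= 1.
  have xy0 : 0 < frac N' t' - frac N t by rewrite subr_gt0.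
  rewrite -(ler_pM2r xy0) alE mul1r; apply: le_trans (ler_norm _) _.
  by apply: le_trans (s_lipschitz sfP _ _) _; rewrite gtr0_norm.
have lox : lo%:~R <= frac N t.
  by rewrite -frac_int frac_le // mulr1; case: cand => _ /andP[].
have [_ /andP[Nlo Nhi']] := cand.
have shift_end s4 P' : [/\ reg s4 rN = N', reg s4 rt = t'%:Z, reg s4 rvn = vn' &
    reg s4 rvd = vd'] -> (forall x, x \in [:: rP; rsn; rsd; rlo; rhi] -> reg s4 x = reg s3 x) ->
    arr s4 = arr s3 -> based s4 -> reg s3 rP = P'%:Z ->
    (P' + remaining N' t' <= max_calls)%N -> 0 < reg s3 rsd -> (0 < P')%N ->
    (reg s3 rsn)%:~R / (reg s3 rsd)%:~R = slopes_of s3 P'.-1 ->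
    pieces_upto sf lo%:~R P' (cuts_of s3) (slopes_of s3) (intercepts_of s3) (frac N' t') ->
    scan_inv s4.
  move=> [e1 e2 e3 e4] eX eA Bs4 e5 e6 e7 e8 e9 e10.
  split=> //; first by rewrite eX // F3 // S12.
    by rewrite eX // F3 // S12.
  exists N', t', P'; split; first by split=> //; rewrite eX.
  split; first by rewrite e3 e4 !eX.
  rewrite /cuts_of /slopes_of /intercepts_of eA; split=> //; first by move=> P'0; rewrite P'0 in e8.
  move=> _; rewrite !eX //; split=> //.
  have tZ : 0 < t%:Z by rewrite ltz_nat.
  by rewrite -(ltr_pM2r tZ); apply: le_lt_trans lt; rewrite mulrAC ler_wpM2r.
pose s4 := set_reg (set_reg (set_reg (set_reg s3 rN N') rt t'%:Z) rvn vn') rvd vd'.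
have goal4 : scan_inv s4 -> hoare Shift s3 7 (fun s tr => QQ s (([:: g] ++ [::]) ++ tr)).
  move=> I4; apply: hoare_seq_aset => // {}b3; apply: hoare_seq_aset => // {}b3.
  apply: hoare_seq_aset => // {}b3; apply: hoare_aset => //.
  rewrite /= N3 t3 vn3 vd3; by exists g.
apply: hoare_weaken (goal4 _) (leqnn _) _; last by move=> s5 tr5 _ _; rewrite /= .
have Bs4 : based s4 by [].
have [eq0|ne0] := eqVneq (sn * reg s rsd - reg s rsn * sd) 0.
  move: H3; rewrite eq0 eqxx => -[P3 sn3 sd3 a30 a31].
  have aE : al = (reg s rsn)%:~R / (reg s rsd)%:~R.
    have sd0R : (reg s rsd)%:~R != 0 :> R by rewrite intr_eq0 gt_eqF.
    rewrite -aR; apply/eqP; rewrite eqr_div // -!rmorphM eqr_int -subr_eq0.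
    by rewrite eq0.
  (* The slope is at most [1], so agreement with the recorded slope excludes the initial value
     [2]. *)
  have Ppos : (0 < P)%N.
    by rewrite lt0n; apply/eqP => /P0[_ e1 e2]; move: al1; rewrite aE e1 e2 divr1 (ler_int R 2 1).
  have [_ slE] := PS Ppos.
  have eqs : [/\ cuts_of s3 = cuts_of s, slopes_of s3 = slopes_of s &
      intercepts_of s3 = intercepts_of s].
    by rewrite /cuts_of /slopes_of /intercepts_of a30 a31.
  have [eq1 eq2 eq3] := eqs.
  apply: (shift_end _ P) => //.
  - by move=> x; rewrite !inE => /or4P[/eqP->|/eqP->|/eqP->|/orP[/eqP->|/eqP->]].
  - by apply: leq_trans PM; rewrite leq_add2l ltnW.
  - by rewrite sd3.
  - by rewrite sn3 sd3 slE eq2.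
  rewrite eq1 eq2 eq3; apply: (pieces_same pcs) => //; first by rewrite ltW.
  by move=> z zz; rewrite -slE -aE Hab // beE; ring.
move: H3; rewrite (negPf ne0) => -[P3 sn3 sd3 a30 a31].
have [p0 p1 p2 p3 p4] := pushed_piece a31.
have [c0 c1] := pushed_cut a30.
apply: (shift_end _ P.+1) => //.
- by move=> x; rewrite !inE => /or4P[/eqP->|/eqP->|/eqP->|/orP[/eqP->|/eqP->]].
- by apply: leq_trans PM; rewrite addSnnS leq_add2l.
- by rewrite sd3.
- by rewrite sn3 sd3 /slopes_of /cell_ratio p0 p1.
apply: (pieces_new (a := al) (b := be) pcs) => //.
- by move=> /PS[h _]; rewrite -frac_int frac_lt // mulr1.
- move=> /P0[h _ _]; rewrite -frac_int; apply/eqP; rewrite eq_le !frac_le //.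
  by rewrite !mulr1 h lexx.
- move=> Ppos; rewrite -(proj2 (PS Ppos)) -aR; apply: contra ne0.
  have sd0R : (reg s rsd)%:~R != 0 :> R by rewrite intr_eq0 gt_eqF.
  by rewrite eqr_div // -!rmorphM eqr_int subr_eq0 eq_sym.
- by move=> i iP; apply: cell_ratio_eq; apply: c1; move: iP; clear; lia.
- move=> Ppos; have [e1 e2] := c0 Ppos.
  by rewrite /cuts_of /cell_ratio e1 e2 /frac rmorphM.
- move=> i iP; split; apply: cell_ratio_eq; apply: p4; move: iP; clear; lia.
- by rewrite /slopes_of /cell_ratio p0 p1.
rewrite /intercepts_of /cell_ratio p2 p3.
have -> : be = sf (frac N t) - al * frac N t by rewrite beE; ring.
rewrite -vE -aR /frac; clearbody sn sd; rewrite rmorphB !rmorphM /=; field.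
by rewrite tR vdR sdR.
by lia.
Qed.

Lemma scan_start s : bnd s -> based s -> reg s rlo = 2 * lo -> reg s rhi = 2 * hi ->
  hoare ScanStart s (40 * (m * n) + 60) (fun s' tr => exists g,
    [/\ tr = [:: g], good g, scan_inv s' & remaining (reg s' rN) (absz (reg s' rt)) = max_calls]).
Proof.
move=> bs Bs loE hiE.
set QQ := fun s2 : state => _.
have kk0 : (0 < k * k)%N by rewrite muln_gt0 andbb /k leq_min muln_gt0 m_gt0 n_gt0.
have cand : candidate (2 * lo) 1.
  split; first by rewrite kk0.
  by rewrite !mulr1 lexx /= ler_pM2l // ltW.
eapply (hoare_weaken (Q := QQ)); [| |by []].
apply: (hoare_seq_setv Y8 U0_gt0 (v := 2 * lo)) => //.
  by apply: (small_int Y8) => //; apply: candY cand.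
move=> {}bs; apply: hoare_seq_aset => // {}bs.
set s1 := set_reg _ _ _ in bs *.
have Bs1 : based s1 by [].
apply: (hoare_seq U0_gt0); apply: hoare_weaken
  (query_spec (N := 2 * lo) (t := 1) OP adm Y8 Ycells YK YM sfP lohi candM' YM' bs Bs1 _ _ cand) (leqnn _) _ => //.
move=> s2 tr b2 sm2 [g [-> gg vd0 vE]].
have Bs2 : based s2 by apply: based_same sm2 Bs1.
have N2 : reg s2 rN' = 2 * lo by rewrite (proj1 sm2).
have t2 : reg s2 rt' = 1 by rewrite (proj1 sm2).
have lo2 : reg s2 rlo = 2 * lo by rewrite (proj1 sm2).
have hi2 : reg s2 rhi = 2 * hi by rewrite (proj1 sm2).
apply: (hoare_seq_pure U0_gt0 (b1 := 7) (P := fun s3 => [/\ reg s3 rN = 2 * lo, reg s3 rt = 1,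
   reg s3 rvn = reg s2 rvn', reg s3 rvd = reg s2 rvd' & arr s3 = arr s2])).
  do 3 (apply: hoare_seq_aset => // {}b2).
  by apply: hoare_aset => //; split=> //=; rewrite N2 t2.
move=> s3 b3 sm3 [N3 t3 vn3 vd3 a3].
have Bs3 : based s3 by apply: based_same sm3 Bs2.
apply: hoare_seq_aset => // {}b3; apply: hoare_seq_aset => // {}b3.
apply: (hoare_aset O Y8 (b := 1)) => //; exists g; split=> //; last first.
  by rewrite /= N3 t3 remaining_start.
split; [by []|by rewrite /= (proj1 sm3)|by rewrite /= (proj1 sm3)|].
exists (2 * lo), 1%N, 0%N; split=> //; split=> //.
  by rewrite /= vd3 vn3 add0n remaining_start.
  by split; [move=> _; rewrite mulr1|by []|split].
by lia.
Qed.

Hypotheses (hi_ray : exists al be, forall x, hi%:~R - 1 <= x -> sf x = al * x + be)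
  (lo_ray : exists al be, forall x, x <= lo%:~R + 1 -> sf x = al * x + be).

Lemma scan_spec s : bnd s -> based s -> reg s rlo = 2 * lo -> reg s rhi = 2 * hi ->
  exists s' tr w, [/\ exec O Scan s s' tr w,
    (w <= (size tr).+1 * (80 * (m * n) + 10 * (k * k) + 200) * unit_cost Y U0)%N,
    (size tr <= max_calls.+1)%N, List.Forall good tr &
    identifies (mx_real R A) (mx_real R B) (output s')].
Proof.
move=> bs Bs loE hiE.
have [s1 [tr1 [w1 [ex1 wb1 b1 _ [g [tr1E gg I1 rem1]]]]]] := scan_start bs Bs loE hiE.
have okc : affordable dr da U0 ($rN + #1 <= $rhi * $rt)%P by [].
have [s2 [tr2 [w2 [ex2 wb2 b2 [I2 c2] [sz2 F2]]]]] :=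
  hoare_while Y8 okc (fun s bs I e => scan_step bs I e) b1 I1.
have ok3 : affordable dr da U0 ($rP - #1)%P by [].
have ex3 := exec_set O s2 0 ($rP - #1)%P.
have ex := exec_seq ex1 (exec_seq ex2 ex3).
exists (set_reg s2 0 (eval s2 ($rP - #1)%P)), (tr1 ++ tr2 ++ [::]).
have c3 := cost_lt Y8 b2 ok3.
eexists; split; first exact: ex.
- rewrite tr1E cats0 [size _]/=; move: wb1 wb2 c3; set U := unit_cost _ _; set W := cost _ _.
  set T := (80 * _ + _ + _)%N => wb1 wb2 c3.
  apply: (@leq_trans (((40 * (m * n) + 60) + (size tr2).+1 * (40 * (m * n) + 10 * (k * k) + 90).+2 + 3) * U)).
    move: wb1 wb2 c3; move: (40 * (m * n) + 60)%N ((size tr2).+1 * _)%N => a b.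
    by rewrite mulnDl mulnDl; clear; lia.
  rewrite leq_mul2r; apply/orP; right; rewrite [((size tr2).+2 * T)%N]mulSn addnAC leq_add //.
    by rewrite /T; lia.
  by rewrite leq_mul2l; apply/orP; right; rewrite /T; lia.
- by rewrite tr1E cats0 /= ltnS; move: sz2; rewrite rem1.
- by rewrite tr1E cats0; constructor.
have [Bs2 lo2 hi2 [N [t [P [[NE tE cand PE] [[vd0 vE PM sd0] [P0 PS pcs]]]]]]] := I2.
have [/andP[t0 tK] /andP[Nlo Nhi]] := cand.
(* The scan stops exactly at the right end: a candidate never exceeds [2 * hi * t], and below it the
   guard holds. *)
have NtE : N = 2 * hi * t%:Z.
  apply/eqP; rewrite eq_le Nhi /= leNgt -lezD1; apply/negP => h.
  by move: c2; rewrite /= NE tE hi2 h.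
have hiE' : frac N t = hi%:~R.
  by rewrite -frac_int; apply/eqP; rewrite eq_le !frac_le // !mulr1 NtE lexx.
rewrite hiE' in pcs.
have lohiR : lo%:~R < hi%:~R :> R by rewrite ltr_int.
have Ppos : (0 < P)%N.
  rewrite lt0n; apply/eqP => /P0[e _ _]; move: NtE; rewrite e => /(mulIf _).
  rewrite lt0r_neq0 ?ltz_nat // => /(_ isT) /(mulfI (isT : (2 : int) != 0)) e'.
  by move: lohi; rewrite e' ltxx.
have fin := pieces_final Ppos lohiR hi_ray lo_ray pcs.
have [H1 H2 H3 H4 _] := pcs.
have [_ _ _ ABc _] := adm.
have idf := @identifies_output R m n A B sf (set_reg s2 0 (eval s2 ($rP - #1)%P)) P.-1 ABc sfP.
cbv zeta in idf; apply: idf.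
- by rewrite /= PE; move: Ppos; clear; lia.
- by move=> i iP; apply: H3; lia.
- move=> i iP; have iP' : (i.+1 < P)%N by move: iP; clear; lia.
  by apply: contra (H4 i iP') => /eqP[e _]; apply/eqP.
move=> i y iP cl cr; apply: fin => //; first by move: iP Ppos; clear; lia.
by move=> iP'; apply: cr; move: iP'; clear; lia.
Qed.

End ScanLoop.

(** * Identical differences *)

Section Degenerate.
Variables (R : realType) (O : oracle) (m n M : nat) (A B : 'M[option int]_(m, n)) (Y : nat).
Hypothesis adm : admissible M A B.
Let k := minn (2 * m) n.
Hypotheses (Y8 : (8 <= Y)%N) (Ycells : (2 * (m * n * n) <= Y)%N)
  (YK : (k * k <= Y)%N) (YM : (2 * M <= Y)%N).
Variables (sf : R -> R) (c : int).
Hypotheses (sfP : forall lam, spectral A B lam (sf lam))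
  (Hc : forall i j h, finite A i j -> finite B i h -> intval A i j - intval B i h = c).
(** After [T] turns the largest coordinate exceeds [T s] by at most [2 n]; [T > 2 n k ^ 2] makes
    this error, divided by [T], smaller than [1 / k ^ 2]. *)
Definition steps := (2 * n * (k * k) + 1)%N.
Hypothesis YT : (steps < Y)%N.
Notation hoare := (hoare O Y dr da U0).
Notation bnd := (bnd Y dr da).
Notation small := (fits Y).
Notation based := (based A B).

Let m_gt0 : (0 < m)%N. Proof. by case: adm. Qed.
Let n_gt0 : (0 < n)%N. Proof. by case: adm. Qed.
Let k_gt0 : (0 < k)%N. Proof. by rewrite /k leq_min muln_gt0 m_gt0. Qed.

(* The doubled game has payments [eps] and [- eps] at [lam = c + eps]. *)
Definition side (p : bool * 'I_m) : int := if p.1 then 1 else -1.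

(** The relation [turn_value] of the doubled game at [lam = c + eps], on integers. *)
Definition unit_turn (eps : int) (x x' : 'I_n -> int) := forall j,
  (exists p, dbl_a A B p j /\ forall h, dbl_b A B p h -> side p * eps + x h <= x' j) /\
  (forall p, dbl_a A B p j -> exists h, dbl_b A B p h /\ x' j <= side p * eps + x h).

Lemma unit_weight (eps : int) p j h : dbl_a A B p j -> dbl_b A B p h ->
  dbl_wb A B (c + eps)%:~R p h - dbl_wa A B (c + eps)%:~R p j = (side p * eps)%:~R :> R.
Proof.
case: p => -[] i; rewrite dbl_wE /side /dbl_a /dbl_b /= => ij ih.
  rewrite -rmorphB -rmorphD; congr (_%:~R); have := Hc ij ih; lia.
rewrite -rmorphN -rmorphB -rmorphD; congr (_%:~R); have := Hc ih ij; lia.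
Qed.

Lemma unit_turn_value eps x x' : unit_turn eps x x' -> forall j,
  turn_value (dbl_a A B) (dbl_b A B) (dbl_wa A B (c + eps)%:~R)
    (dbl_wb A B (c + eps)%:~R) (fun j => (x j)%:~R : R) j (x' j)%:~R.
Proof.
move=> H j; have [[p [pj Hp]] H2] := H j; split.
  exists p; split=> // h ph; rewrite unit_weight // -rmorphD ler_int; exact: Hp.
move=> q qj; have [h [qh Hh]] := H2 q qj; exists h; split=> //.
by rewrite unit_weight // -rmorphD ler_int.
Qed.

(** The moves are read off the flags, which are nonzero at the same cells for every scaling and
    shift; these are therefore left existential. *)
Definition flagged s := exists t n1 n2 n3 n4, (0 < t)%N /\
  scaled_query A B (read_mx (arr s 4%N) (2 * m) n) (read_mx (arr s 5%N) (2 * m) n) t n1 n2 n3 n4.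

Lemma flagged_cells s : flagged s -> forall (p : bool * 'I_m) (j : 'I_n),
  (arr s 4%N (2 * (dbl_row p * n + j))%N%:Z != 0) = dbl_a A B p j /\
  (arr s 5%N (2 * (dbl_row p * n + j))%N%:Z != 0) = dbl_b A B p j.
Proof.
move=> [t [n1 [n2 [n3 [n4 [t0 [gA1 gA2 gB1 gB2]]]]]]] p j.
have ea := scaled_a gA1 gA2 p j; have eb := scaled_b gB1 gB2 p j.
rewrite !mxE /read_entry in ea eb; rewrite /dbl_a /dbl_b /finite; split.
  by move: ea; case: eqP; case: p.1; case: (_ p.2 j).
by move: eb; case: eqP; case: p.1; case: (_ p.2 j).
Qed.

Lemma dbl_row_inj : injective (@dbl_row m).
Proof.
move=> [b1 i1] [b2 i2] /(congr1 val) /=.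
have l1 := ltn_ord i1; have l2 := ltn_ord i2.
case: b1 b2 => -[] /= e; try (exfalso; clear -e l1 l2; lia).
  by congr (_, _); apply: val_inj.
by congr (_, _); apply: val_inj; apply: (@addnI m).
Qed.

Lemma cell_bound (r N h : nat) : (r < N)%N -> (h < n)%N -> (r * n + h < N * n)%N.
Proof.
move=> rN hn; apply: (@leq_trans (r.+1 * n)); first by rewrite mulSn addnC ltn_add2r.
by rewrite leq_mul2r rN orbT.
Qed.

Lemma dbl_cell_lt (q : bool * 'I_m) (h : 'I_n) : (dbl_row q * n + h < 2 * (m * n))%N.
Proof. by rewrite mulnA; apply: cell_bound. Qed.

Lemma dbl_cell_surj p : (p < 2 * (m * n))%N ->
  exists (q : bool * 'I_m) (h : 'I_n), p = (dbl_row q * n + h)%N.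
Proof.
move=> pm; have p1 : (p %/ n < 2 * m)%N by rewrite ltn_divLR // -mulnA.
have [q qE] := dbl_row_surj (Ordinal p1).
exists q, (Ordinal (ltn_pmod p n_gt0)).
by rewrite qE /= -divn_eq.
Qed.

Lemma dbl_cell_div (q : bool * 'I_m) (h : 'I_n) : ((dbl_row q * n + h) %/ n = dbl_row q)%N.
Proof. by rewrite divnMDl // divn_small ?addn0. Qed.

Lemma dbl_cell_side (q : bool * 'I_m) (h : 'I_n) : (m * n <= dbl_row q * n + h)%N = ~~ q.1.
Proof.
case: q => -[] i /=; last by rewrite mulnDl -addnA leq_addr.
by apply/negbTE; rewrite -ltnNge; apply: cell_lt.
Qed.

Lemma eval_row s (q : bool * 'I_m) (h : 'I_n) : reg s rn = n%:Z ->
  reg s rp = (dbl_row q * n + h)%N%:Z -> eval s ($rp / $rn)%P = (dbl_row q : nat)%:Z.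
Proof. by move=> nE pE; rewrite /= nE pE divz_nat dbl_cell_div. Qed.

Lemma eval_col s (q : bool * 'I_m) (h : 'I_n) : reg s rn = n%:Z ->
  reg s rp = (dbl_row q * n + h)%N%:Z -> eval s col_index = h%:Z.
Proof.
move=> nE pE; rewrite /= nE pE divz_nat dbl_cell_div.
by rewrite mulnC PoszD PoszM; ring.
Qed.

Definition holds_values s (x : 'I_n -> int) := forall j : 'I_n, arr s 6%N j%:Z = - x j.

(** Every row and every node has a flagged cell, so both passes produce maxima over actual moves.
    Payments have absolute value [1], whence the bound on the values grows by one per turn. *)
Lemma sweep_spec (eps : int) s x t : `|eps| = 1 -> bnd s -> based s -> flagged s ->
  holds_values s x -> (forall j, `|x j| <= t%:Z) -> (t < steps)%N ->
  hoare (Sweep eps) s (60 * (m * n) + 30) (pure (fun s' => exists x',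
    [/\ unit_turn eps x x', holds_values s' x' & forall j, `|x' j| <= t.+1%:Z])).
Proof.
move=> e1 bs Bs fs xs xt tT.
have [_ _ [Ar Br] ABc _] := adm.
have eps8 : (`|eps| <= 8)%N by rewrite -lez_nat abszE e1.
have smallY z : `|z| <= t.+1%:Z -> small 1 z.
  by move=> zt; apply: (small_int Y8) => //; apply: le_trans zt _; rewrite lez_nat ltnW // (leq_ltn_trans tT).
set QQ := pure _; eapply (hoare_weaken (Q := QQ)); [| |by []].
have [[nE m2E mnE mn2E] _] := Bs.
apply: (hoare_seq_pure U0_gt0 (hoare_fill O Y8 U0_gt0 (nb := (2 * m)%N) (b0 := 0) (v := fun=> 0)
  m2E bs _ _ _ _ _)) => //.
move=> s1 b1 /fill_same sm1 Z1.
have Bs1 : based s1 by apply: based_same sm1 Bs.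
pose F5 (p : nat) := arr s 5%N (2 * p)%N%:Z != 0.
pose w1 (p : nat) := - arr s 6%N (p %% n)%N%:Z.
have cells := flagged_cells fs.
have dmod (q : bool * 'I_m) (h : 'I_n) : ((dbl_row q * n + h) %% n = h)%N.
  by rewrite modnMDl modn_small.
apply: (hoare_seq_pure U0_gt0 (hoare_relax O Y8 U0_gt0 (s := s1) (nb := (2 * (m * n))%N)
  (F := F5) (w := w1) (D := fun p => (p %/ n)%N%:Z) _ b1 _ _ _ _ _ _ _ _)) => //.
- by rewrite (proj1 sm1).
- move=> p s2 pm b2 sm2 pE.
  have [q [h pqh]] := dbl_cell_surj pm; rewrite pqh in pE *.
  have n2 : reg s2 rn = n%:Z by rewrite (proj1 sm2) // (proj1 sm1).
  have a5 : arr s2 5%N = arr s 5%N by rewrite (proj2 sm2) // (proj2 sm1).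
  have a6 : arr s2 6%N = arr s 6%N by rewrite (proj2 sm2) // (proj2 sm1).
  rewrite (eval_row n2 pE) dbl_cell_div /F5 /w1 dmod xs opprK; split=> //.
    by rewrite /= pE a5.
  have sx : small 1 (x h) by apply: smallY; apply: le_trans (xt h) _; rewrite lez_nat.
  move=> _; split=> //.
  have -> : eval s2 (#0 - 6.{col_index})%P = - arr s2 6%N (eval s2 col_index) by rewrite -sub0z.
  by rewrite (eval_col n2 pE) a6 xs opprK.
- move=> p pm _; rewrite Z1 ifT //.
  by rewrite add0r ltz_nat ltn_divLR // -mulnA pm.
move=> s2 b2 sm2 P2.
have Bs2 : based s2 by apply: based_same sm2 Bs1.
pose u (q : bool * 'I_m) := arr s2 7%N (dbl_row q : nat)%:Z.
have uP q : (forall h, dbl_b A B q h -> x h <= u q) /\ exists h, dbl_b A B q h /\ u q = x h.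
  have F5E (h : 'I_n) : F5 (dbl_row q * n + h)%N = dbl_b A B q h by case: (cells q h).
  have w1E (r : bool * 'I_m) (h : 'I_n) : w1 (dbl_row r * n + h)%N = x h by rewrite /w1 dmod xs opprK.
  split=> [h qh|].
    have := P2 _ (dbl_cell_lt q h); rewrite F5E => /(_ qh)[].
    by rewrite w1E dbl_cell_div.
  have [h qh] := dbl_b_ex Ar Br q.
  have := P2 _ (dbl_cell_lt q h); rewrite F5E => /(_ qh)[_ [p' [p'm]]].
  have [q' [h' ->]] := dbl_cell_surj p'm; rewrite !dbl_cell_div => Fq' -[qq'].
  rewrite w1E => uE; exists h'; split=> //.
  have {}qq' : q' = q by apply: dbl_row_inj; apply: ord_inj.
  by case: (cells q h') => _ <-; rewrite -qq'.
have us1 q : small 1 (u q).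
  have [_ [h [_ ->]]] := uP q; apply: smallY; apply: le_trans (xt h) _; rewrite lez_nat //.
apply: (hoare_seq_pure U0_gt0 (hoare_fill O Y8 U0_gt0 (s := s2) (nb := n) (b0 := 0) (v := fun=> 0)
  _ b2 _ _ _ _ _)) => //.
  by case: Bs2 => [[]].
move=> s3 b3 /fill_same sm3 Z3.
have Bs3 : based s3 by apply: based_same sm3 Bs2.
pose F4 (p : nat) := arr s 4%N (2 * p)%N%:Z != 0.
pose w2 (p : nat) := eps * (2 * (m * n <= p)%N%:Z - 1) - arr s2 7%N (p %/ n)%N%:Z.
have w2E (q : bool * 'I_m) (h : 'I_n) : w2 (dbl_row q * n + h)%N = - (side q * eps + u q).
  rewrite /w2 dbl_cell_div dbl_cell_side /side /u; case: q.1 => /=; ring.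
have side1 (q : bool * 'I_m) : side q = 1 \/ side q = -1 by rewrite /side; case: q.1; [left|right].
have ut q : `|u q| <= t%:Z by have [_ [h [_ ->]]] := uP q.
have wt q : `|side q * eps + u q| <= t.+1%:Z.
  by move: (ut q) (side1 q) e1; clear; lia.
apply: hoare_weaken (hoare_relax O Y8 U0_gt0 (s := s3) (nb := (2 * (m * n))%N)
  (F := F4) (w := w2) (D := fun p => (p %% n)%N%:Z) _ b3 _ _ _ _ _ _ _ _) (leqnn _) _ => //.
- by case: Bs3 => [[_ _ _ ->]].
- by rewrite /affordable /= eps8.
- move=> p s4 pm b4 sm4 pE.
  have [q [h pqh]] := dbl_cell_surj pm; rewrite pqh in pE *.
  have a4 : arr s4 4%N = arr s 4%N.
    by rewrite (proj2 sm4) // (proj2 sm3) // (proj2 sm2) // (proj2 sm1).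
  have a7 : arr s4 7%N = arr s2 7%N by rewrite (proj2 sm4) // (proj2 sm3).
  have Bs4 : based s4 by apply: based_same sm4 Bs3.
  have [[n4 _ mn4 _] _] := Bs4.
  rewrite (eval_col n4 pE) dmod; split=> //.
    by rewrite /F4 -a4 /= pE.
  move=> _; have sw : small 1 (w2 (dbl_row q * n + h)%N).
    by rewrite w2E; apply: smallY; rewrite normrN.
  split=> //.
    move: (eval_row n4 pE); rewrite /= => ->; rewrite mn4 pE a7 /w2 dbl_cell_div lez_nat.
    by case: leqP.
- by move=> p pm _; rewrite Z3 ifT // add0r ltz_nat ltn_mod n_gt0.
- move=> s' tr b' sm' [-> P4]; split=> //.
  have F4E (q : bool * 'I_m) (h : 'I_n) : F4 (dbl_row q * n + h)%N = dbl_a A B q h.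
    by case: (cells q h).
  exists (fun j => - arr s' 6%N (j : nat)%:Z).
  have xP (j : 'I_n) : (forall q, dbl_a A B q j -> - arr s' 6%N (j : nat)%:Z <= side q * eps + u q) /\
      exists q, dbl_a A B q j /\ - arr s' 6%N (j : nat)%:Z = side q * eps + u q.
    split=> [q qj|].
      have := P4 _ (dbl_cell_lt q j); rewrite F4E => /(_ qj)[].
      by rewrite w2E dmod lerNl.
    have [q qj] := dbl_a_ex ABc j.
    have := P4 _ (dbl_cell_lt q j); rewrite F4E dmod => /(_ qj)[_ [p' [p'm]]].
    have [q' [h' ->]] := dbl_cell_surj p'm; rewrite dmod F4E w2E => qj' [jh'] ->.
    exists q'; rewrite opprK; split=> //.
    by have <- : h' = j by apply: ord_inj.
  split=> [j|j|j]; last 2 first.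
  - by rewrite opprK.
  - by have [_ [q [_ ->]]] := xP j.
  have [x1 [q [qj xE]]] := xP j; split.
    exists q; split=> // h qh; rewrite xE lerD2l; exact: (proj1 (uP q)).
  move=> q' q'j; have [_ [h [qh uE]]] := uP q'; exists h; split=> //.
  by rewrite -uE; apply: x1.
clear -m_gt0 n_gt0; nia.
Qed.

Lemma flagged_same xs ys s s' : 4%N \notin ys -> 5%N \notin ys -> same xs ys s s' ->
  flagged s -> flagged s'.
Proof. by move=> y4 y5 [_ sa]; rewrite /flagged !sa. Qed.

(** The payments being integers, some [l s (c + eps)] with [0 < l <= k] is an integer; the
    approximation [V / T] from above then determines the value. *)
Lemma iterate_spec (eps : int) s : `|eps| = 1 -> bnd s -> based s -> flagged s ->
  reg s rT = steps%:Z ->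
  hoare (Iterate eps) s (steps * (60 * (m * n) + 34) + 16 * n + 10 * k + 50)
    (pure (fun s' => 0 < reg s' rbd /\
      (reg s' rbn)%:~R / (reg s' rbd)%:~R = sf (c + eps)%:~R)).
Proof.
move=> e1 bs Bs fs TE.
set QQ := pure _; eapply (hoare_weaken (Q := QQ)); [| |by []].
have [_ _ [Ar Br] ABc _] := adm.
have [[nE _ _ _] _] := Bs.
have w1 p j h : dbl_a A B p j -> dbl_b A B p h ->
    `|dbl_wb A B (c + eps)%:~R p h - dbl_wa A B (c + eps)%:~R p j| <= 1 :> R.
  move=> pj ph; rewrite unit_weight // -intr_norm -[leRHS]/(1%:~R) ler_int.
  by move: e1; rewrite /side; case: p.1; clear; lia.
have hv := sfP (c + eps)%:~R.
have [P [P0 PS PB]] := value_iteration (dbl_a_ex ABc) (dbl_b_ex Ar Br) w1 (Ordinal n_gt0) hv.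
rewrite /Iterate.
apply: (hoare_seq_pure U0_gt0 (hoare_fill O Y8 U0_gt0 (nb := n) (b0 := 0) (v := fun=> 0)
  nE bs _ _ _ _ _)) => //.
move=> s1 b1 /fill_same sm1 Z1.
have Bs1 : based s1 by apply: based_same sm1 Bs.
have fs1 : flagged s1 by apply: flagged_same sm1 fs.
have T1 : reg s1 rT = steps%:Z by rewrite (proj1 sm1).
pose I (tau : nat) s' := exists x, [/\ P tau (fun j => (x j)%:~R), holds_values s' x &
  forall j, `|x j| <= tau%:Z].
apply: (hoare_seq_pure U0_gt0 (hoare_for (O := O) Y8 (I := I) (b := 60 * (m * n) + 30) T1 b1 _ _ _ _ _ _)) => //.
- exists (fun=> 0); split=> //; first exact: P0.
  by move=> j; rewrite [arr _ _]/= Z1 oppr0 ifT // add0r ltz_nat ltn_ord.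
- move=> tau s2 tauT b2 sm2 tauE [x [Px xs xt]].
  have Bs2 : based s2 by apply: based_same sm2 Bs1.
  have fs2 : flagged s2 by apply: flagged_same sm2 fs1.
  apply: hoare_weaken (sweep_spec e1 b2 Bs2 fs2 xs xt tauT) _ _ => //.
  move=> s3 tr b3 sm3 [-> [x' [ut xs' xt']]]; split=> //.
  by exists x'; split=> //; apply: PS Px _; apply: unit_turn_value.
move=> s2 b2 sm2 [[x [Px xs xt]] _].
have Bs2 : based s2 by apply: based_same sm2 Bs1.
have [[n2 _ _ _] [_ k2 _ _]] := Bs2.
apply: hoare_seq_aput => // b3; set s3 := set_arr _ _ _ _ in b3 *.
pose V (i : nat) := - arr s2 6%N i%:Z.
have VE (j : 'I_n) : V j = x j by rewrite /V xs opprK.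
have Vs (i : nat) : (i < n)%N -> `|V i| <= steps%:Z.
  by move=> ni; rewrite -[i]/(val (Ordinal ni)) VE.
have sV i : (i < n)%N -> small 1 (V i).
  move=> ni; apply: (small_int Y8) => //; apply: le_trans (Vs i ni) _.
  by rewrite lez_nat ltnW.
apply: (hoare_seq_pure U0_gt0 (hoare_relax O Y8 U0_gt0 (s := s3) (nb := n)
  (F := fun=> true) (w := V) (D := fun=> 0) _ b3 _ _ _ _ _ _ _ _)) => //.
- move=> p s4 pn b4 sm4 pE; split=> // _.
  split; [|exact: sV|exact: sV].
  have -> : eval s4 (#0 - 6.{$rp})%P = - arr s4 6%N (reg s4 rp) by rewrite -sub0z.
  by rewrite pE (proj2 sm4).
move=> s4 b4 sm4 P4.
have [_ [q [qn _ _ qE]]] := P4 0%N n_gt0 isT.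
have Vmax j : (j < n)%N -> V j <= V q by move=> jn; have [] := P4 j jn isT; rewrite qE.
apply: (hoare_seq_setv Y8 U0_gt0 (v := V q)) => //; first exact: sV.
move=> {}b4; set s5 := set_reg _ _ _ in b4 *.
have k5 : reg s5 rk = k%:Z by rewrite /= (proj1 sm4).
have T5 : reg s5 rT = steps%:Z by rewrite /= (proj1 sm4) //= (proj1 sm2).
pose v (i : nat) : int := (V q * i.+1%:Z %/ steps%:Z)%Z.
have sv i : (i < k)%N -> small 5 (v i).
  move=> ik; apply: leq_trans (absz_divz_le _ _) _; rewrite abszM.
  apply: (@leq_trans (Y ^ 2)); last by rewrite leq_pexp2l //; lia.
  rewrite expnS expn1 leq_mul //; first by have := sV q qn; rewrite /fits expn1.
  by apply: leq_trans ik (leq_trans _ YK); rewrite leq_pmulr.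
apply: hoare_weaken (hoare_bestfrac O Y8 U0_gt0 (s := s5) (nb := k) (v := v) k5 k_gt0 b4 _ _ _ _)
  (leqnn _) _ => //.
  move=> i s6 ik sm6 pE; split; last exact: sv.
  have T6 : reg s6 rT = steps%:Z by rewrite (proj1 sm6).
  have V6 : reg s6 rV = V q by rewrite (proj1 sm6) //= eqxx.
  have i1 : i.+1%:Z = reg s6 rp + 1 by rewrite pE -addn1 PoszD.
  by rewrite /v -T6 -V6 i1.
move=> s' tr _ _ [-> [i [ik bnE bdE best]]]; split=> //.
rewrite bnE bdE; split=> //.
have HD : row_gap A B `|c| by move=> i1 j1 h1 f1 f2; rewrite (Hc f1 f2).
have [a [l [u [/andP[l0 lk] _ _ la]]]] := spectral_line HD hv.
have kE : (k ^ 2 = k * k)%N by rewrite -mulnn.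
have [[j0 low] up] := PB _ _ Px.
symmetry; apply: (@best_fraction R 'I_n k steps (V q)%:~R (V q) _
  (a + (l%:Z - 2 * u%:Z) * (c + eps)) l (v i) i.+1) => //.
- by rewrite l0.
- by rewrite la; move: (c + eps) => z; rewrite rmorphD rmorphM rmorphB rmorphM.
- by apply: le_trans low _; rewrite ler_int -VE Vmax.
- by rewrite -[q]/(val (Ordinal qn)) VE; apply: up.
- by rewrite card_ord kE /steps addn1.
- by rewrite /v; apply: lez_floor; rewrite /steps addn1.
- by move=> [|j] // /andP[_ jk]; apply: best.
lia.
Qed.

(** On either side of [c] the function is a ray starting from the value [0], determined by its value
    at distance [1]. The slopes agree exactly when [n1 * d2 + n2 * d1 = 0], and then a single piece
    covers both sides. *)
Lemma degenerate_output st (P : nat) (n1 d1 n2 d2 : int) :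
  0 < d1 -> n1%:~R / d1%:~R = sf (c + 1)%:~R -> 0 < d2 -> n2%:~R / d2%:~R = sf (c - 1)%:~R ->
  reg st 0%N = P%:Z -> P = (n1 * d2 + n2 * d1 != 0) :> nat ->
  (arr st 0%N 0 = c /\ arr st 0%N 1 = 1) ->
  (arr st 1%N 0 = - n2 /\ arr st 1%N 1 = d2) -> (arr st 1%N 2 = c * n2 /\ arr st 1%N 3 = d2) ->
  (arr st 1%N 4 = n1 /\ arr st 1%N 5 = d1) -> (arr st 1%N 6 = - (c * n1) /\ arr st 1%N 7 = d1) ->
  identifies (mx_real R A) (mx_real R B) (output st).
Proof.
move=> d10 p1 d20 p2 PE Pv [c0 c1] [e0 e1] [e2 e3] [e4 e5] [e6 e7].
have [_ _ _ ABc _] := adm.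
have up x : c%:~R <= x -> sf x = (x - c%:~R) * sf (c + 1)%:~R.
  move=> cx; have := @s_degenerate R m n A B sf sfP c 1 (x - c%:~R) Hc.
  rewrite mulr1 [_%:~R + (x - _)]addrC subrK rmorphD /= => -> //; lra.
have dn x : x <= c%:~R -> sf x = (c%:~R - x) * sf (c - 1)%:~R.
  move=> cx; have := @s_degenerate R m n A B sf sfP c (-1) (c%:~R - x) Hc.
  rewrite mulrN1 opprB [_%:~R + (x - _)]addrC subrK rmorphB /= => -> //; lra.
rewrite -p1 in up; rewrite -p2 in dn.
have d1R : d1%:~R != 0 :> R by rewrite intr_eq0 lt0r_neq0.
have d2R : d2%:~R != 0 :> R by rewrite intr_eq0 lt0r_neq0.
have crit : (n1 * d2 + n2 * d1 != 0) = (n1%:~R / d1%:~R + n2%:~R / d2%:~R != 0 :> R).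
  have dd := mulf_neq0 d1R d2R.
  by rewrite addf_div // mulf_eq0 (negPf (invr_neq0 dd)) orbF -!rmorphM -rmorphD intr_eq0.
have P1 : (P <= 1)%N by rewrite Pv; case: (_ != _).
have cut0 : cell_ratio R (arr st 0%N) 0 = c%:~R.
  have g0 : arr st 0%N (2 * 0)%N%:Z = c := c0.
  have g1 : arr st 0%N (2 * 0).+1%N%:Z = 1 := c1.
  by rewrite /cell_ratio g0 g1 divr1.
have sl0 : cell_ratio R (arr st 1%N) (2 * 0) = - (n2%:~R / d2%:~R).
  have g0 : arr st 1%N (2 * (2 * 0))%N%:Z = - n2 := e0.
  have g1 : arr st 1%N (2 * (2 * 0)).+1%N%:Z = d2 := e1.
  by rewrite /cell_ratio g0 g1 rmorphN mulNr.
have ic0 : cell_ratio R (arr st 1%N) (2 * 0).+1 = c%:~R * (n2%:~R / d2%:~R).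
  have g0 : arr st 1%N (2 * (2 * 0).+1)%N%:Z = c * n2 := e2.
  have g1 : arr st 1%N (2 * (2 * 0).+1).+1%N%:Z = d2 := e3.
  by rewrite /cell_ratio g0 g1 rmorphM mulrA.
have sl1 : cell_ratio R (arr st 1%N) (2 * 1) = n1%:~R / d1%:~R.
  have g0 : arr st 1%N (2 * (2 * 1))%N%:Z = n1 := e4.
  have g1 : arr st 1%N (2 * (2 * 1)).+1%N%:Z = d1 := e5.
  by rewrite /cell_ratio g0 g1.
have ic1 : cell_ratio R (arr st 1%N) (2 * 1).+1 = - (c%:~R * (n1%:~R / d1%:~R)).
  have g0 : arr st 1%N (2 * (2 * 1).+1)%N%:Z = - (c * n1) := e6.
  have g1 : arr st 1%N (2 * (2 * 1).+1).+1%N%:Z = d1 := e7.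
  by rewrite /cell_ratio g0 g1 rmorphN mulNr rmorphM mulrA.
move: crit cut0 sl0 ic0 sl1 ic1 up dn; set q1 := n1%:~R / _; set q2 := n2%:~R / _.
move=> crit cut0 sl0 ic0 sl1 ic1 up dn.
apply: (identifies_output (s := sf) (P := P)) => //.
- by move=> i; clear -P1; lia.
- case=> [|i]; last by clear -P1; lia.
  move=> P0; have : q1 + q2 != 0 by rewrite -crit; move: P0; rewrite Pv; case: (_ != _).
  by rewrite sl0 sl1; apply: contra => /eqP[<- _]; rewrite addNr.
move=> i y iP; case: i iP => [|[|i]] iP; last by clear -P1 iP; lia.
- rewrite sl0 ic0 cut0 => _ yc; have [yle|ylt] := leP y c%:~R; first by rewrite dn //; lra.
  have q0 : q1 + q2 = 0.
    apply/eqP; apply: contraT => q12; have P0 : (0 < P)%N by rewrite Pv crit q12.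
    by have := yc P0; rewrite leNgt ylt.
  by rewrite up ?(ltW ylt) // -(addr0_eq q0); clearbody q1 q2; ring.
by move=> /(_ isT); rewrite sl1 ic1 cut0 => yc _; rewrite up //; lra.
Qed.

Lemma hoare_seq_aputv l v a e1 e2 cm s b Q : bnd s ->
  affordable dr da U0 (EOp OAdd e1 e2) && (edeg dr da e2 <= da a)%N ->
  eval s e1 = l -> eval s e2 = v ->
  (bnd (set_arr s a l v) -> hoare cm (set_arr s a l v) b Q) ->
  hoare (CSeq (CPut a e1 e2) cm) s b.+2 Q.
Proof. by move=> bs ok <- <-; apply: hoare_seq_aput. Qed.

Lemma degenerate_spec s : bnd s -> based s -> reg s rlow = c ->
  hoare Degenerate s (2 * (steps * (60 * (m * n) + 34)) + 40 * (m * n) + 32 * n + 20 * k + 200)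
    (pure (fun s' => identifies (mx_real R A) (mx_real R B) (output s'))).
Proof.
move=> bs Bs cE.
have [_ _ _ ABc _] := adm.
set QQ := pure _; eapply (hoare_weaken (Q := QQ)); [| |by []].
apply: hoare_seq_aset => // b1; apply: hoare_seq_aset => // {b1}; set s1 := set_reg _ _ _ => b1.
have Bs1 : based s1 by [].
apply: (hoare_seq_pure U0_gt0 (build_spec (N := 0) (t := 1%N) O adm Y8 Ycells YK YM b1 Bs1 _ _ _)) => //.
move=> s2 b2 sm2 Q2; have Bs2 : based s2 by apply: based_same sm2 Bs1.
have fs2 : flagged s2 by do 5 eexists; split; last exact: Q2.
have [[n2 _ _ _] [K2 _ _ _]] := Bs2.
have c2 : reg s2 rlow = c by rewrite (proj1 sm2).
apply: (hoare_seq_setv Y8 U0_gt0 (v := steps%:Z)) => //.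
- by rewrite /= n2 K2 /steps PoszD !PoszM.
- by apply: small_nat => //; apply: ltnW.
move=> {}b2; set s3 := set_reg _ _ _ in b2 *.
have Bs3 : based s3 by [].
have fs3 : flagged s3 by [].
apply: (hoare_seq_pure U0_gt0 (iterate_spec _ b2 Bs3 fs3 _)) => //.
move=> s4 b4 sm4 [d1 p1].
have Bs4 : based s4 by apply: based_same sm4 Bs3.
have fs4 : flagged s4 by apply: flagged_same sm4 fs3.
have T4 : reg s4 rT = steps%:Z by rewrite (proj1 sm4).
have c4 : reg s4 rlow = c by rewrite (proj1 sm4).
apply: hoare_seq_aset => // {}b4; apply: hoare_seq_aset => // {}b4; set s5 := set_reg _ _ _ in b4 *.
have n5 : reg s5 rp1n = reg s4 rbn by [].
have d5 : reg s5 rp1d = reg s4 rbd by [].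
have Bs5 : based s5 by [].
have fs5 : flagged s5 by [].
apply: (hoare_seq_pure U0_gt0 (iterate_spec (eps := -1) _ b4 Bs5 fs5 _)) => //.
move=> s6 b6 sm6 [d2 p2].
have c6 : reg s6 rlow = c by rewrite (proj1 sm6).
have n6 : reg s6 rp1n = reg s4 rbn by rewrite (proj1 sm6).
have d6 : reg s6 rp1d = reg s4 rbd by rewrite (proj1 sm6).
rewrite -n6 -d6 in d1 p1.
apply: hoare_seq_aset => // {}b6; apply: hoare_seq_aset => // {}b6.
pose c' := reg s6 rlow.
pose n1 := reg s6 rp1n; pose d1' := reg s6 rp1d; pose n2' := reg s6 rbn; pose d2' := reg s6 rbd.
apply: (hoare_seq_aputv (l := 0) (v := c')) => // {}b6.
apply: (hoare_seq_aputv (l := 1) (v := 1)) => // {}b6.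
apply: (hoare_seq_aputv (l := 0) (v := 0%Z - n2')) => // {}b6.
apply: (hoare_seq_aputv (l := 1) (v := d2')) => // {}b6.
apply: (hoare_seq_aputv (l := 2) (v := c' * n2')) => // {}b6.
apply: (hoare_seq_aputv (l := 3) (v := d2')) => // {}b6.
apply: (hoare_seq_aputv (l := 4) (v := n1)) => // {}b6.
apply: (hoare_seq_aputv (l := 5) (v := d1')) => // {}b6.
apply: (hoare_seq_aputv (l := 6) (v := 0%Z - c' * n1)) => // {}b6.
apply: (hoare_seq_aputv (l := 7) (v := d1')) => // {}b6.
set s7 := set_arr _ _ _ _ in b6 *.
pose QD := pure (fun s' => identifies (mx_real R A) (mx_real R B) (output s')).
have fin (b : bool) : b = (reg s6 rp1n * reg s6 rbd + reg s6 rbn * reg s6 rp1d != 0) ->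
    QD (set_reg s7 0 (Posz b)) [::].
  move=> bE; split=> //; apply: (degenerate_output (P := b) d1 p1 d2 p2) => //.
  - by rewrite bE.
  - by rewrite /= /n2' sub0z.
  - by rewrite /= /c' c6.
  - by rewrite /= /c' sub0z c6.
apply: (hoare_if (b := 1) Y8) => // cnd.
  apply: hoare_aset => //; apply: (fin true); symmetry; exact: cnd.
apply: hoare_aset => //; apply: (fin false); symmetry; apply/negbTE; rewrite negbK; apply/eqP; exact: cnd.
by clear; lia.
Qed.

End Degenerate.

(** * Complexity *)

Lemma gap_range_unique m n (A B : 'M[option int]_(m, n)) lo up lo' up' :
  gap_range A B lo up -> gap_range A B lo' up' -> lo = lo' /\ up = up'.
Proof.
move=> [H [i1 [j1 [h1 [a1 b1 e1]]]] [i2 [j2 [h2 [a2 b2 e2]]]]].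
move=> [H' [i3 [j3 [h3 [a3 b3 e3]]]] [i4 [j4 [h4 [a4 b4 e4]]]]].
have /andP[x1 _] := H _ _ _ a3 b3; have /andP[_ x2] := H _ _ _ a4 b4.
have /andP[x3 _] := H' _ _ _ a1 b1; have /andP[_ x4] := H' _ _ _ a2 b2.
by move: x1 x2 x3 x4; rewrite e1 e2 e3 e4; clear; lia.
Qed.

(** In units of cost, one share covers the preparation, the degenerate case and a round of the scan;
    the total is one share per call, plus one. *)
Definition work (m n : nat) := (2000 * (m * n * (n * n * n)))%N.

Lemma work_le m n k b : (0 < m)%N -> (0 < n)%N -> (k <= n)%N ->
  (b <= 2 * (steps m n * (60 * (m * n) + 34)) + 40 * (m * n) + 32 * n + 20 * k + 200)%N ->
  k = minn (2 * m) n ->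
  (20 * (m * n) + 30 + (22 * (m * n * n) + 30) + 30 + b +
    (80 * (m * n) + 10 * (k * k) + 200) <= work m n)%N.
Proof.
move=> m0 n0 kn bb kE; rewrite /work.
have le1 (x y : nat) : (0 < y)%N -> (x <= x * y)%N by move=> y0; rewrite leq_pmulr.
set q := (m * n * (n * n * n))%N.
have n30 : (0 < n * n * n)%N by rewrite !muln_gt0 n0.
have mn0 : (0 < m * n)%N by rewrite muln_gt0 m0.
have q1 : (m * n <= q)%N by apply: le1.
have q3 : (n * n * n <= q)%N by rewrite leq_pmull.
have kk : (k * k <= n * n)%N by rewrite leq_mul.
have nn : (n * n <= n * n * n)%N by apply: le1.
have nn1 : (n <= n * n)%N by apply: le1.
have q2 : (m * n * n <= q)%N by rewrite leq_mul2l (leq_trans nn1 nn) orbT.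
have q4 : (n * (k * k) <= n * n * n)%N by rewrite -mulnA leq_mul2l kk orbT.
have sE : (steps m n <= 3 * (n * n * n))%N.
  by rewrite /steps -kE -mulnA; move: q4 n30; clear; lia.
have mE : (60 * (m * n) + 34 <= 94 * (m * n))%N by move: mn0; clear; lia.
have sm : (steps m n * (60 * (m * n) + 34) <= 282 * q)%N.
  apply: leq_trans (leq_mul sE mE) _; rewrite /q; clear; lia.
move: bb q1 q2 q3 kk nn nn1 q4 sm n30 kn; clear; lia.
Qed.

Lemma add_costs a b d e U w1 w2 w3 c : (w1 <= a * U)%N -> (w2 <= b * U)%N ->
  (w3 <= d * U)%N -> (c < U)%N ->
  ((w1 + (w2 + (c + w3).+1).+1).+1 <= (a + b + 30 + d + e) * U)%N.
Proof. by rewrite !mulnDl; lia. Qed.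

Lemma add_scan_costs a b e U w1 w2 w3 w4 c z : (w1 <= a * U)%N -> (w2 <= b * U)%N ->
  (w3 <= 10 * U)%N -> (w4 <= z.+1 * e * U)%N -> (c < U)%N ->
  ((w1 + (w2 + (c + (w3 + w4).+1).+1).+1).+1 <= z.+1 * (a + b + 30 + 0 + e) * U)%N.
Proof.
move=> h1 h2 h3 h4 cU; rewrite addn0 mulnDr [(_ * U)%N]mulnDl.
have : ((a + b + 30) * U <= z.+1 * (a + b + 30) * U)%N by rewrite leq_mul2r leq_pmull ?orbT.
move: h4; move: (z.+1 * _ * U)%N (z.+1 * e * U)%N => T V h4; rewrite !mulnDl; lia.
Qed.

(** * The complete program *)

Section Main.
Variables (R : realType) (O : oracle) (m n M : nat) (A B : 'M[option int]_(m, n)) (Y : nat).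
Hypotheses (OP : oracle_correct R O) (adm : admissible M A B).
Let k := minn (2 * m) n.
Hypotheses (Y8 : (8 <= Y)%N) (Ycells : (2 * (m * n * n) <= Y)%N)
  (YK : (k * k <= Y)%N) (YM : (2 * M <= Y)%N) (YT : (steps m n < Y)%N).
Variables (sf : R -> R) (low up : int).
Hypotheses (sfP : forall lam, spectral A B lam (sf lam)) (gr : gap_range A B low up).
Notation hoare := (hoare O Y dr da U0).
Notation bnd := (bnd Y dr da).
Notation based := (based A B).
Notation candidate := (candidate m n).

Let m_gt0 : (0 < m)%N. Proof. by case: adm. Qed.
Let n_gt0 : (0 < n)%N. Proof. by case: adm. Qed.

Definition ranges Range (lo hi : int) := forall s, bnd s -> based s ->
  reg s rlow = low -> reg s rup = up ->
  hoare Range s 10 (pure (fun s' => [/\ based s', reg s' rlo = 2 * lo & reg s' rhi = 2 * hi])).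

Definition scannable (lo hi : int) M' :=
  [/\ lo < hi,
      forall N t (d : int), candidate lo hi N t -> 0 <= d <= 3 ->
        `|((N + d) %/ 4)%Z| + t%:Z * M%:Z <= M'%:Z,
      forall N t, candidate lo hi N t -> `|N| <= Y%:Z,
      (2 * n * M' <= Y)%N /\ (max_calls m n lo hi < Y)%N &
      (exists al be, forall x, hi%:~R - 1 <= x -> sf x = al * x + be) /\
      (exists al be, forall x, x <= lo%:~R + 1 -> sf x = al * x + be)].

(** The range has to be scannable only when [low < up]. Otherwise all differences agree and no call
    is made, as a budget of zero demands. *)
Lemma reconstruct_spec Range lo hi M' :
  (low < up -> ranges Range lo hi /\ scannable lo hi M') ->
  exists s' tr w, [/\ exec O (Reconstruct Range) (input A B) s' tr w,
    identifies (mx_real R A) (mx_real R B) (output s'),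
    (size tr <= if (low < up)%R then (max_calls m n lo hi).+1 else 0)%N,
    List.Forall (good m n M') tr &
    (w <= (size tr).+1 * work m n * unit_cost Y U0)%N].
Proof.
move=> Hscan.
have [s1 [tr1 [w1 [ex1 wb1 b1 sm1 [tr1E [Bs1 rc1]]]]]] := init_spec O adm Y8 Ycells YK YM.
have g1 : arr s1 9%N 0 = 0 by rewrite (proj2 sm1).
have [s2 [tr2 [w2 [ex2 wb2 b2 sm2 [tr2E [lo' [up' [loE upE gr']]]]]]]] :=
  gaps_spec O adm Y8 Ycells YK YM b1 Bs1 rc1 g1.
have [lE uE] := gap_range_unique gr' gr.
rewrite lE in loE; rewrite uE in upE; rewrite tr1E in ex1; rewrite tr2E in ex2.
have Bs2 : based s2 by apply: based_same sm2 Bs1.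
have okc : affordable dr da U0 ($rup <= $rlow)%P by [].
have c2 := cost_lt Y8 b2 okc.
set U := unit_cost Y U0 in wb1 wb2 c2 *.
have Wb := @work_le m n k.
have [upl|lup] := leP up low.
  have lowup : low = up.
    case: gr => [H [i [j [h [fi fj _]]]] _]; apply/eqP; rewrite eq_le upl andbT.
    by have /andP[x y] := H _ _ _ fi fj; apply: le_trans x y.
  have Hc i j h : finite A i j -> finite B i h -> intval A i j - intval B i h = up.
    case: gr => [H _ _] fi fj; have := H _ _ _ fi fj; rewrite lowup => le.
    by apply/eqP; rewrite eq_le andbC.
  have rl2 : reg s2 rlow = up by rewrite loE.
  have [s3 [tr3 [w3 [ex3 wb3 b3 sm3 [tr3E idf]]]]] :=
    degenerate_spec O adm Y8 Ycells YK YM sfP Hc YT b2 Bs2 rl2.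
  have ex4 : exec O (CIf ($rup <= $rlow)%P Degenerate (Range;; Scan)%P) s2 s3 tr3
      (cost s2 ($rup <= $rlow)%P + w3).+1.
    by apply: exec_if; rewrite /= loE upE upl; exact: ex3.
  have ex := exec_seq ex1 (exec_seq ex2 ex4); rewrite tr3E in ex.
  exists s3, [::]; eexists; split; [exact: ex|by []|by []|by constructor|].
  have Wm := Wb _ m_gt0 n_gt0 (geq_minr _ _) (leqnn _) erefl.
  rewrite mul1n; apply: leq_trans (leq_mul Wm (leqnn U)).
  exact: add_costs.
have [HR [lohi cM cY [YM' YP] [hr lr]]] := Hscan lup.
have [s3 [tr3 [w3 [ex3 wb3 b3 sm3 [tr3E [Bs3 lo3 hi3]]]]]] := HR s2 b2 Bs2 loE upE.
have [s4 [tr4 [w4 [ex4 wb4 sz4 F4 idf]]]] :=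
  scan_spec OP adm Y8 Ycells YK YM sfP lohi cM cY YM' YP hr lr b3 Bs3 lo3 hi3.
have ex5 : exec O (CIf ($rup <= $rlow)%P Degenerate (Range;; Scan)%P) s2 s4 (tr3 ++ tr4)
    (cost s2 ($rup <= $rlow)%P + (w3 + w4).+1).+1.
  by apply: exec_if; rewrite /= loE upE leNgt lup; exact: exec_seq ex3 ex4.
have ex := exec_seq ex1 (exec_seq ex2 ex5); rewrite tr3E in ex.
exists s4, tr4; eexists; split; [exact: ex|by []|by []|by []|].
have Wm := Wb 0%N m_gt0 n_gt0 (geq_minr _ _) (leq0n _) erefl.
apply: leq_trans (leq_mul (leq_mul (leqnn _) Wm) (leqnn U)).
exact: add_scan_costs.
Qed.

End Main.

(** * Extremal differences and the constants [Cup], [Clow] and [Delta] *)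

Section Gaps.
Variables (R : realType) (m n : nat).
Implicit Types A B : 'M[option int]_(m, n).

Lemma gap_rangeC A B low up : gap_range A B low up -> gap_range B A (- up) (- low).
Proof.
move=> [H [i1 [j1 [h1 [a1 b1 e1]]]] [i2 [j2 [h2 [a2 b2 e2]]]]]; split.
- by move=> i j h ij ih; have /andP[x y] := H i h j ih ij; clear -x y; lia.
- by exists i2, h2, j2; rewrite -e2 opprB.
by exists i1, h1, j1; rewrite -e1 opprB.
Qed.

Lemma entry_finite A i j : (mx_real R A i j != -oo%E) = finite A i j.
Proof. by rewrite mxE /finite; case: (A i j). Qed.

Lemma entry_intval A i j : finite A i j -> mx_real R A i j = ((intval A i j)%:~R : R)%:E.
Proof. by rewrite mxE /finite /intval; case: (A i j). Qed.

Lemma Cup_value A B low up : gap_range A B low up ->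
  Cup (mx_real R A) (mx_real R B) = (up%:~R : R)%:E.
Proof.
move=> [H _ [i [j [h [fi fj upE]]]]]; apply/eqP; rewrite eq_le; apply/andP; split.
  apply: bigmax_le => [|i' _]; first exact: leNye.
  apply: bigmax_le => [|j' _]; first exact: leNye.
  apply: bigmax_le => [|h']; first exact: leNye.
  rewrite !entry_finite => /andP[fi' fj']; rewrite !entry_intval //.
  by rewrite -EFinB lee_fin -rmorphB ler_int; case/andP: (H _ _ _ fi' fj').
apply: le_trans (le_bigmax _ _ i); apply: le_trans (le_bigmax _ _ j).
apply: le_trans (le_bigmax_cond _ _ _); last by rewrite !entry_finite; apply/andP; split; eassumption.
by rewrite !entry_intval // -upE rmorphB.
Qed.

Lemma Clow_value A B low up : gap_range A B low up ->
  Clow (mx_real R A) (mx_real R B) = (low%:~R : R)%:E.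
Proof.
move=> [H [i [j [h [fi fj lowE]]]] _]; apply/eqP; rewrite eq_le; apply/andP; split.
  apply: le_trans (bigmin_le _ i _) _; apply: le_trans (bigmin_le _ h _) _.
  apply: le_trans (bigmin_le_cond _ _ _) _; first by rewrite !entry_finite; apply/andP; split; eassumption.
  by rewrite !entry_intval // -lowE rmorphB.
apply: le_bigmin => [|i' _]; first exact: leey.
apply: le_bigmin => [|j' _]; first exact: leey.
apply: le_bigmin => [|h']; first exact: leey.
rewrite !entry_finite => /andP[fi' fj']; rewrite !entry_intval //.
by rewrite -EFinB lee_fin -rmorphB ler_int; case/andP: (H _ _ _ fi' fj').
Qed.

Lemma gap_range_le A B low up : gap_range A B low up -> low <= up.
Proof.
by move=> [H [i [j [h [fi fj _]]]] _]; have /andP[x y] := H _ _ _ fi fj; apply: le_trans x y.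
Qed.

(** [Delta] as a natural number: the maximum is nonnegative because [low <= up]. *)
Definition max_gap (low up : int) : nat := absz (Num.max up (- low)).

Lemma max_gapE low up : low <= up -> (max_gap low up)%:Z = Num.max up (- low).
Proof. by rewrite /max_gap => le; lia. Qed.

Lemma Delta_value A B low up : gap_range A B low up ->
  Delta (mx_real R A) (mx_real R B) = ((max_gap low up)%:R : R)%:E.
Proof.
move=> gr; rewrite /Delta (Cup_value gr) (Cup_value (gap_rangeC gr)) -EFin_max.
rewrite -[(max_gap _ _)%:R]/((max_gap low up)%:Z%:~R) (max_gapE (gap_range_le gr)).
by congr EFin; rewrite !maxEle ler_int; case: ifP.
Qed.

Lemma gap_range_row_gap A B low up : gap_range A B low up ->
  row_gap A B (max_gap low up)%:Z.
Proof.
move=> gr; rewrite (max_gapE (gap_range_le gr)); case: gr => H _ _ i j h fi fj.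
by have := H _ _ _ fi fj; clear; lia.
Qed.

Lemma gap_range_bounded M A B low up : bounded_by M A -> bounded_by M B ->
  gap_range A B low up -> `|low| <= 2 * M%:Z /\ `|up| <= 2 * M%:Z.
Proof.
move=> bA bB [_ [i1 [j1 [h1 [_ _ <-]]]] [i2 [j2 [h2 [_ _ <-]]]]].
have := bounded_intval i1 j1 bA; have := bounded_intval i1 h1 bB.
have := bounded_intval i2 j2 bA; have := bounded_intval i2 h2 bB.
clear; lia.
Qed.

End Gaps.

(** * The intervals to be scanned *)

Section Ranges.
Variables (R : realType) (O : oracle) (m n M : nat) (A B : 'M[option int]_(m, n)) (Y : nat).
Hypotheses (adm : admissible M A B) (Y8 : (8 <= Y)%N).
Let k := minn (2 * m) n.
Variables (low up : int).
Hypothesis (gr : gap_range A B low up).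
Notation ranges := (ranges O A B Y low up).
Notation D := (max_gap low up).
Notation hoare := (hoare O Y dr da U0).

Lemma delta_range_spec (r E : nat) : (r == rK) && (E == k * k)%N || (r == rk) && (E == k) ->
  (2 * (D * E + 1) <= Y)%N ->
  ranges (DeltaRange (EReg r)) (- (D * E + 1)%N%:Z) (D * E + 1)%N%:Z.
Proof.
move=> rE DY s bs Bs lowE upE.
have [] : dr r = 1%N /\ forall s', based A B s' -> reg s' r = E%:Z.
  by case/orP: rE => /andP[/eqP-> /eqP->]; split=> // s' [_ []].
move=> dr1 regE; have DE := max_gapE (gap_range_le gr).
have D1 : (D <= Y)%N.
  apply: leq_trans DY; have : (0 < E)%N.
    have [m0 n0 _ _ _] := adm; have k0 : (0 < k)%N by rewrite /k leq_min muln_gt0 m0.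
    by case/orP: rE => /andP[_ /eqP->] //; rewrite muln_gt0 k0.
  by move=> E0; have : (D <= D * E)%N by [rewrite leq_pmulr]; clear; lia.
set Q := pure _; eapply (hoare_weaken (Q := Q)); [| |by []].
have rne : r \notin [:: rhi; rlo] by case/orP: rE => /andP[/eqP-> _].
apply: (hoare_seq_pure U0_gt0 (b1 := 2) (P := fun s' => reg s' rhi = D%:Z)).
  apply: hoare_if => //; rewrite /= lowE upE; case: ifP => // h _.
    apply: hoare_set => //=; rewrite ?upE.
      by have -> : up = D%:Z; [rewrite DE; clear -h; lia|apply: small_nat].
    by split=> //=; rewrite DE; clear -h; lia.
  apply: hoare_set => //=; rewrite lowE sub0z.
    by have -> : - low = D%:Z; [rewrite DE; clear -h; lia|apply: small_nat].
  by split=> //=; rewrite DE; clear -h; lia.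
move=> s1 b1 sm1 hi1.
have Bs1 : based A B s1 by apply: based_same sm1 Bs.
have r1 := regE s1 Bs1.
have ok : affordable dr da U0 (#2 * ($rhi * (EReg r) + #1))%P.
  by rewrite /affordable /= dr1.
apply: (hoare_seq_setv Y8 U0_gt0 (v := (2 * (D * E + 1))%N%:Z)) => //.
  by rewrite /= hi1 r1 PoszM PoszD PoszM.
move=> {}b1; apply: hoare_set => //=.
  rewrite sub0z /fits abszN; exact: small_nat.
split=> //; rewrite /= sub0z mulrN PoszM; split=> //.
by [].
Qed.

Lemma finite_range_spec : (`|2 * low - 2| <= Y%:Z) -> (`|2 * up + 2| <= Y%:Z) ->
  ranges FiniteRange (low - 1) (up + 1).
Proof.
move=> lowY upY s bs Bs lowE upE.
set Q := pure _; eapply (hoare_weaken (Q := Q)); [| |by []].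
apply: (hoare_seq_setv Y8 U0_gt0 (v := 2 * low - 2)) => //; first by rewrite /= lowE.
move=> b1; apply: hoare_set => //=; rewrite upE.
  exact: (small_int Y8).
split=> //; split=> //=; first by rewrite mulrBr.
by rewrite mulrDr.
by [].
Qed.

End Ranges.

(** * Sizes of the numbers in the program *)

(** The exponent [7] comes from the bound on the number of calls, of order [M k ^ 6]. *)
Definition magnitude (X : nat) : nat := (100 * X ^ 7)%N.

Section Magnitudes.
Variables (m n M : nat).
Let k := minn (2 * m) n.
Let X := (m + n + M).+1.
Local Notation Y := (magnitude X).

Let kX : (k <= X)%N. Proof. by rewrite /k /X; clear; lia. Qed.
Let nX : (n <= X)%N. Proof. by rewrite /X; clear; lia. Qed.
Let mX : (m <= X)%N. Proof. by rewrite /X; clear; lia. Qed.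
Let MX : (M <= X)%N. Proof. by rewrite /X; clear; lia. Qed.

Let below a j x : (a <= 100)%N -> (j <= 7)%N -> (x <= a * X ^ j)%N -> (x <= Y)%N.
Proof.
move=> a1 j7 xa; apply: leq_trans xa _; rewrite /magnitude leq_mul //.
by rewrite leq_pexp2l.
Qed.

Let X2 x y : (x <= X)%N -> (y <= X)%N -> (x * y <= X ^ 2)%N.
Proof. by move=> xX yX; rewrite -mulnn leq_mul. Qed.

Let X3 x y z : (x <= X)%N -> (y <= X)%N -> (z <= X)%N -> (x * y * z <= X ^ 3)%N.
Proof. by move=> xX yX zX; rewrite expnSr leq_mul ?X2. Qed.

Lemma magnitude8 : (8 <= Y)%N.
Proof. by apply: (@below 8 0). Qed.

Lemma magnitude_cells : (2 * (m * n * n) <= Y)%N.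
Proof. by apply: (@below 2 3) => //; rewrite leq_mul2l X3. Qed.

Lemma magnitude_kk : (k * k <= Y)%N.
Proof. by apply: (@below 1 2) => //; rewrite mul1n X2. Qed.

Lemma magnitude_entries : (2 * M <= Y)%N.
Proof. by apply: (@below 2 1) => //; rewrite leq_mul2l expn1. Qed.

Lemma magnitude_steps : (steps m n < Y)%N.
Proof.
apply: (@below 4 3) => //; rewrite /steps -/k -mulnA mulnA.
have := X3 nX kX kX; have : (0 < X ^ 3)%N by rewrite expn_gt0.
rewrite mulnA; clear; lia.
Qed.

(** [e] will be [k ^ 2], [k] or [1]. From [|N| <= 2 H t] and [H <= 2 M e + 1], a rounded quarter of
    [N] is at most [M e t + t]; with a scaled entry [t M] this is at most [t M (e + 2)], as [M > 0].
    For [e = 1] and [t = k ^ 2] this is exactly [3 M k ^ 2]. *)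
Lemma scan_magnitudes (lo hi : int) (e H M' : nat) :
  (0 < M)%N -> (H <= 2 * M * e + 1)%N -> (e <= k * k)%N ->
  (k * k * (M * (e + 2)) <= M')%N -> (M' <= 5 * X ^ 5)%N ->
  - H%:Z <= lo -> lo < hi -> hi <= H%:Z ->
  [/\ forall N t (d : int), candidate m n lo hi N t -> 0 <= d <= 3 ->
        `|((N + d) %/ 4)%Z| + t%:Z * M%:Z <= M'%:Z,
      forall N t, candidate m n lo hi N t -> `|N| <= Y%:Z,
      (2 * n * M' <= Y)%N, (max_calls m n lo hi < Y)%N & (2 * H + 2 <= Y)%N].
Proof.
move=> M0 He ek M'l M'u loH lohi hiH.
have X0 : (0 < X)%N by [].
have pw j : (0 < X ^ j)%N by rewrite expn_gt0.
have HX : (H <= 3 * X ^ 3)%N.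
  have := X3 MX kX kX; have : (M * e <= M * k * k)%N by rewrite -mulnA leq_mul2l ek orbT.
  by move: He (pw 3%N); clear; lia.
have NH N t : candidate m n lo hi N t -> [/\ (0 < t)%N, (t <= k * k)%N & `|N| <= 2 * H%:Z * t%:Z].
  move=> [/andP[t0 tk] /andP[Nlo Nhi]]; split=> //.
  have tZ : 0 <= t%:Z by [].
  have := ler_wpM2r tZ hiH; have := ler_wpM2r tZ loH; move: Nlo Nhi; clear; lia.
split.
- move=> N t d /NH[t0 tk Nt] d3.
  have q1 : 4 * `|((N + d) %/ 4)%Z| <= 2 * H%:Z * t%:Z + 3.
    by move: Nt d3; move: (2 * H%:Z * t%:Z) => z; clear; lia.
  have Ht : (H * t <= 2 * (M * e * t) + t)%N.
    by have := leq_mul He (leqnn t); rewrite mulnDl mul1n -!mulnA.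
  have q2 : `|((N + d) %/ 4)%Z| <= (M * e * t + t)%N%:Z.
    by move: q1 Ht t0; move: ((N + d) %/ 4)%Z (M * e * t)%N => z w; clear; lia.
  have tM : (t <= M * t)%N by rewrite leq_pmull.
  have e2 : (M * e * t + 2 * (M * t) <= k * k * (M * (e + 2)))%N.
    have -> : (M * e * t + 2 * (M * t) = t * (M * (e + 2)))%N by clear; lia.
    by rewrite leq_mul2r tk orbT.
  by move: q2 tM (leq_trans e2 M'l); move: (_ %/ 4)%Z (M * e * t)%N => z w; clear; lia.
- move=> N t /NH[_ tk Nt]; apply: le_trans Nt _.
  have tX : (t <= X ^ 2)%N by apply: leq_trans tk (X2 kX kX).
  have : (2 * H * t <= Y)%N.
    apply: (@below 6 5) => //; rewrite -mulnA -(mulnA 2 3) leq_mul2l /=.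
    by rewrite (_ : 5 = 3 + 2)%N // expnD mulnA leq_mul.
  by clear; lia.
- apply: (@below 10 6) => //; rewrite -mulnA -(mulnA 2 5) leq_mul2l /=.
  by rewrite expnS mulnCA leq_mul.
- have kk := X2 kX kX; have kk1 : ((k * k).+1 <= 2 * X ^ 2)%N by move: kk (pw 2%N); clear; lia.
  have hl : (absz (hi - lo)%R <= 6 * X ^ 3)%N by move: HX loH lohi hiH; clear; lia.
  rewrite /max_calls -/k; apply: (@leq_ltn_trans (12 * X ^ 7)); last first.
    by rewrite /magnitude ltn_pmul2r.
  apply: leq_trans (leq_mul hl (leq_mul kk kk1)) _.
  by rewrite (_ : 7 = 3 + (2 + 2))%N // !expnD; clear; lia.
by apply: (@below 8 3) => //; move: HX (pw 3%N); clear; lia.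
Qed.

End Magnitudes.

(** The left ray for [(A, B)] is the reflection of the right ray for [(B, A)]. *)
Lemma left_ray (R : realType) m n (A B : 'M[option int]_(m, n)) (sf : R -> R) (x0 : R) :
  (forall lam, spectral A B lam (sf lam)) ->
  (forall s' : R -> R, (forall lam, spectral B A lam (s' lam)) -> ray_affine s' (- x0)) ->
  exists al be, forall x, x <= x0 -> sf x = al * x + be.
Proof.
move=> sfP H; have [|al [be Hab]] := H (fun x => sf (- x)).
  by move=> lam; have := spectralC (sfP (- lam)); rewrite opprK.
exists (- al), be => x xx0; have := Hab (- x); rewrite opprK lerN2 => -> //.
by rewrite mulrN mulNr.
Qed.

(** The binary length of the numbers is linear in [m + n + log M], which makes the work outside the
    oracle polynomial in the length of [M]. *)
Lemma log_magnitude m n M :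
  (trunc_log 2 (magnitude (m + n + M).+1) < 22 * (m + n + trunc_log 2 M).+1)%N.
Proof.
set l := trunc_log 2 M; set S := (m + n + l).+1.
have Ml : (M < 2 ^ l.+1)%N by apply: trunc_log_ltn.
have mnl : (m + n < 2 ^ (m + n))%N by apply: ltn_expl.
have p1 : (2 ^ l.+1 <= 2 ^ S)%N by rewrite leq_exp2l // /S; clear; lia.
have p2 : (2 ^ (m + n) <= 2 ^ S)%N by rewrite leq_exp2l // /S; clear; lia.
have XS : ((m + n + M).+1 <= 2 ^ S.+1)%N.
  by rewrite expnS; move: Ml mnl p1 p2; clear; lia.
have YS : (magnitude (m + n + M).+1 <= 2 ^ (7 + S.+1 * 7))%N.
  by rewrite expnD /magnitude leq_mul // expnM leq_exp2r.
have := leq_trunc_log 2 YS; rewrite trunc_expnK // /S; clear; lia.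
Qed.

Lemma scaled_product_le a u b S p L : (p <= S ^ 5)%N -> (L <= b * S)%N ->
  (a * p * (u * L) <= a * u * b * S ^ 6)%N.
Proof.
move=> pS LS; rewrite mulnACA -[(a * u * b * _)%N]mulnA leq_mul2l.
apply/orP; right; have -> : (b * S ^ 6 = S ^ 5 * (b * S))%N by rewrite expnSr mulnCA.
exact: leq_mul.
Qed.

Lemma work_log : exists c, forall m n M,
  (work m n * unit_cost (magnitude (m + n + M).+1) U0 <=
    c * (m + n + trunc_log 2 M).+1 ^ 6)%N.
Proof.
exists (2000 * U0 * 22)%N => m n M; apply: scaled_product_le; last exact: log_magnitude.
set S := _.+1; have nS : (n <= S)%N by rewrite /S; clear; lia.
have mS : (m <= S)%N by rewrite /S; clear; lia.
by rewrite (_ : S ^ 5 = S * S * (S * S * S))%N ?leq_mul // !expnS expn0 muln1 !mulnA.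
Qed.

(** * Budgets of the three programs *)

Definition outcome (R : realType) (O : oracle) (prog : cmd) m n (A B : 'M[option int]_(m, n))
    (calls M' W : nat) :=
  exists s tr w, [/\ exec O prog (input A B) s tr w,
    identifies (mx_real R A) (mx_real R B) (output s), (size tr <= calls)%N,
    List.Forall (good m n M') tr & (w <= W * (size tr).+1)%N].

Section Final.
Variables (R : realType) (O : oracle) (m n M : nat) (A B : 'M[option int]_(m, n)).
Hypotheses (OP : oracle_correct R O) (adm : admissible M A B).
Let k := minn (2 * m) n.
Let Y := magnitude (m + n + M).+1.

Let m_gt0 : (0 < m)%N. Proof. by case: adm. Qed.
Let n_gt0 : (0 < n)%N. Proof. by case: adm. Qed.
Let k_gt0 : (0 < k)%N. Proof. by rewrite /k leq_min muln_gt0 m_gt0. Qed.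

(** The extrema are those that the program computes; their existence is read off its correctness. *)
Lemma gap_range_exists : exists low up, gap_range A B low up.
Proof.
have Y8 := magnitude8 m n M; have Yc := magnitude_cells m n M.
have YK := magnitude_kk m n M; have YM := magnitude_entries m n M.
have [s1 [tr1 [w1 [_ _ b1 sm1 [_ [Bs1 rc1]]]]]] := init_spec O adm Y8 Yc YK YM.
have g1 : arr s1 9%N 0 = 0 by rewrite (proj2 sm1).
have [s2 [tr2 [w2 [_ _ _ _ [_ [low [up [_ _ gr]]]]]]]] := gaps_spec O adm Y8 Yc YK YM b1 Bs1 rc1 g1.
by exists low, up.
Qed.

Lemma spectral_function : exists sf : R -> R, forall lam, spectral A B lam (sf lam).
Proof.
have [_ _ [Ar Br] ABc _] := adm.
suff /choice[sf sfP] : forall lam : R, exists rho : R, spectral A B lam rho by exists sf.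
by move=> lam; apply: spectral_exists.
Qed.

Variables (sf : R -> R) (low up : int).
Hypotheses (sfP : forall lam, spectral A B lam (sf lam)) (gr : gap_range A B low up).
Let D := max_gap low up.

Lemma gap_M : low < up -> [/\ (0 < M)%N, (0 < D)%N & (D <= 2 * M)%N].
Proof.
have [_ _ _ _ [bA bB]] := adm; have [h1 h2] := gap_range_bounded bA bB gr.
move=> lu; have := max_gapE (ltW lu); rewrite -/D; move: h1 h2 lu; move: D => d.
by clear=> *; split; lia.
Qed.

Lemma outcome_scan Range lo hi e H M' calls W :
  (low < up -> [/\ (2 * H + 2 <= Y)%N -> ranges O A B Y low up Range lo hi,
     (H <= 2 * M * e + 1)%N, (e <= k * k)%N,
     [/\ - H%:Z <= lo, lo < hi, hi <= H%:Z & ((max_calls m n lo hi).+1 <= calls)%N] &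
     ray_affine sf (hi%:~R - 1) /\
     (exists al be, forall x, x <= lo%:~R + 1 -> sf x = al * x + be)]) ->
  (k * k * (M * (e + 2)) <= M')%N -> (M' <= 5 * (m + n + M).+1 ^ 5)%N ->
  (work m n * unit_cost Y U0 <= W)%N ->
  outcome R O (Reconstruct Range) A B calls M' W.
Proof.
move=> Hyp M'l M'u WW.
have Y8 := magnitude8 m n M; have Yc := magnitude_cells m n M.
have YK := magnitude_kk m n M; have YM := magnitude_entries m n M.
have YT := magnitude_steps m n M.
have [|s [tr [w [ex idf sz F wb]]]] := @reconstruct_spec R O m n M A B Y OP adm Y8 Yc YK YM YT
    sf low up sfP gr Range lo hi M'.
  move=> lu; have [M0 _ _] := gap_M lu.
  have [Hr He ek [h1 h2 h3 _] [r1 r2]] := Hyp lu.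
  have [c1 c2 c3 c4 c5] := scan_magnitudes M0 He ek M'l M'u h1 h2 h3.
  by split; [apply: Hr|split].
exists s, tr, w; split=> //.
  apply: leq_trans sz _; case: ifP => // lu.
  by have [_ _ _ [_ _ _ ->] _] := Hyp lu.
by rewrite mulnC; apply: leq_trans wb _; rewrite -mulnA leq_mul2l WW orbT.
Qed.

Let sub1 (x : int) : (x + 1)%:~R - 1 = x%:~R :> R.
Proof. by rewrite rmorphD addrK. Qed.

Let opp_sub1 (x : nat) : - ((- (x + 1)%N%:Z)%:~R + 1) = x%:~R :> R.
Proof. by rewrite rmorphN PoszD rmorphD opprD opprK addrK. Qed.

(** The length of the range is [2 (D e + 1) <= 4 D e], and [k ^ 2 (k ^ 2 + 1) <= 2 k ^ 4], so at
    most [8 D e k ^ 4] points follow the first; the query at the left end raises the constant to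
    [9]. *)
Lemma outcome_delta r e M' W :
  (r == rK) && (e == k * k)%N || (r == rk) && (e == k) ->
  ray_affine sf (D * e)%N%:~R ->
  (forall s' : R -> R, (forall lam, spectral B A lam (s' lam)) -> ray_affine s' (D * e)%N%:~R) ->
  (k * k * (M * (e + 2)) <= M')%N -> (M' <= 5 * (m + n + M).+1 ^ 5)%N ->
  (work m n * unit_cost Y U0 <= W)%N ->
  outcome R O (Reconstruct (DeltaRange (EReg r))) A B (9 * (D * e * k ^ 4)) M' W.
Proof.
move=> rE ray1 ray2 M'l M'u WW; pose H := (D * e + 1)%N.
have kk0 : (0 < k * k)%N by rewrite muln_gt0 k_gt0.
have e0 : (0 < e)%N by case/orP: rE => /andP[_ /eqP->].
have ek : (e <= k * k)%N by case/orP: rE => /andP[_ /eqP->] //; rewrite leq_pmulr.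
apply: (@outcome_scan _ (- H%:Z) H%:Z e H) => // lu.
have [M0 D0 DM] := gap_M lu; split=> //.
- move=> YH; apply: (delta_range_spec O adm (magnitude8 _ _ _) gr) => //.
  by apply: leq_trans YH; rewrite leq_addr.
- by rewrite /H leq_add2r leq_mul2r DM orbT.
- split=> //; first by rewrite /H; clear; lia.
  have De0 : (0 < D * e)%N by rewrite muln_gt0 D0.
  have hl : (absz (H%:Z - - H%:Z)%R <= 4 * (D * e))%N.
    by rewrite /H; move: De0; move: (D * e)%N => d; clear; lia.
  have kk1 : ((k * k).+1 <= 2 * (k * k))%N by move: kk0; clear; lia.
  have k4 : (k ^ 4 = k * k * (k * k))%N by rewrite !expnS expn0 muln1 !mulnA.
  have := leq_mul hl (leq_mul (leqnn (k * k)) kk1).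
  rewrite -[leqLHS]/(max_calls m n (- H%:Z) H%:Z) k4; have : (0 < D * e * (k * k * (k * k)))%N by rewrite !muln_gt0 D0 e0 k_gt0.
  move: (max_calls _ _ _ _) (k * k)%N (D * e)%N => z K d; clear; nia.
split; first by rewrite /H PoszD sub1.
by apply: left_ray sfP _ => s' sP'; rewrite opp_sub1; apply: ray2.
Qed.

(** The length of the range is [up - low + 2 <= 3 (up - low)], as [low < up] are integers. Outside
    [low .. up] the slopes are [1] on the left and [-1] on the right. *)
Lemma outcome_finite M' W : all_finite A -> all_finite B ->
  (k * k * (M * 3) <= M')%N -> (M' <= 5 * (m + n + M).+1 ^ 5)%N ->
  (work m n * unit_cost Y U0 <= W)%N ->
  outcome R O (Reconstruct FiniteRange) A B (9 * (absz (up - low)%R * k ^ 4)) M' W.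
Proof.
move=> fA fB M'l M'u WW; have kk0 : (0 < k * k)%N by rewrite muln_gt0 k_gt0.
have fin (X : 'M[option int]_(m, n)) i j : all_finite X -> finite X i j.
  by move=> fX; rewrite /finite; have := fX i j; case: (X i j).
have [_ _ _ _ [bA bB]] := adm; have [lM uM] := gap_range_bounded bA bB gr.
have Y8 : (8 <= Y)%N by apply: magnitude8.
apply: (@outcome_scan _ (low - 1) (up + 1) 1 (2 * M * 1 + 1)) => // lu.
have [M0 D0 DM] := gap_M lu; split=> //.
- move=> YH; apply: finite_range_spec => //; move: YH lM uM; move: Y => y; clear; lia.
- split; try by move: lM uM lu; clear; lia.
  have hl : (absz (up + 1 - (low - 1))%R <= 3 * absz (up - low)%R)%N by move: lu; clear; lia.
  have g0 : (0 < absz (up - low)%R)%N by move: lu; clear; lia.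
  have kk1 : ((k * k).+1 <= 2 * (k * k))%N by move: kk0; clear; lia.
  have k4 : (k ^ 4 = k * k * (k * k))%N by rewrite !expnS expn0 muln1 !mulnA.
  have := leq_mul hl (leq_mul (leqnn (k * k)) kk1).
  rewrite -[leqLHS]/(max_calls m n (low - 1) (up + 1)) k4.
  have : (0 < absz (up - low)%R * (k * k * (k * k)))%N by rewrite !muln_gt0 g0 k_gt0.
  move: (absz (up - low)%R) (max_calls _ _ _ _) (k * k)%N => g z K; clear; nia.
have [H _ _] := gr; split.
  rewrite sub1; exists (-1), (sf up%:~R + up%:~R) => x ux.
  rewrite (s_ray_finite sfP n_gt0 m_gt0 fA fB (C := up)) //; first by lra.
  by move=> i j h; have /andP[] := H i j h (fin A i j fA) (fin B i h fB).
apply: left_ray sfP _ => s' sP'.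
have -> : - ((low - 1)%:~R + 1) = (- low)%:~R :> R by rewrite rmorphB rmorphN subrK.
exists (-1), (s' (- low)%:~R + (- low)%:~R) => x ux.
rewrite (s_ray_finite sP' n_gt0 m_gt0 fB fA (C := - low)) //; first by lra.
move=> i j h; have /andP[x1 _] := H i h j (fin A i h fA) (fin B i j fB).
by rewrite lerNr opprB.
Qed.

End Final.

Lemma good_time (R : realType) O m n M' g : good m n M' g ->
  ((((time O g)%:R : R)%:E) <= MPG R O (2 * m) n M')%E.
Proof. by move=> gg; apply: ereal_sup_ubound; exists g. Qed.

Lemma outcome_within (R : realType) O prog m n (A B : 'M[option int]_(m, n))
    calls M' W (N : \bar R) :
  outcome R O prog A B calls M' W -> (((calls%:R : R)%:E) <= N)%E ->
  reconstructs_within O prog A B N M' W.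
Proof.
move=> [s [tr [w [ex idf sz F wb]]]] cN; exists s, tr, w; split=> //.
  by apply: le_trans cN; rewrite lee_fin ler_nat.
by apply: List.Forall_impl F => g gg; split=> //; apply: good_time.
Qed.

Lemma sum_time_le O tr T : List.Forall (fun g => (time O g <= T)%N) tr ->
  (\sum_(g <- tr) time O g <= size tr * T)%N.
Proof.
elim=> [|g tr' gT _ IH]; first by rewrite big_nil.
by rewrite big_cons mulSn leq_add.
Qed.

Lemma outcome_in_time (R : realType) O prog m n (A B : 'M[option int]_(m, n))
    calls M' W c d T : (forall m n M, (MPG R O m n M <= (((c * (m + n + M).+1 ^ d)%N%:R : R)%:E))%E) ->
  outcome R O prog A B calls M' W ->
  ((W + c * (2 * m + n + M').+1 ^ d) * calls.+1 <= T)%N ->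
  reconstructs_in_time R O prog A B T.
Proof.
move=> pp [s [tr [w [ex idf sz F wb]]]] bT; exists s, tr, w; split=> //.
apply: leq_trans bT; rewrite /total_time mulnDl leq_add //.
  by apply: leq_trans wb _; rewrite leq_mul2l ltnS sz orbT.
set T0 := (c * _)%N; apply: (@leq_trans (size tr * T0)).
  apply: sum_time_le; apply: List.Forall_impl F => g /(good_time R O) gt.
  by rewrite -(ler_nat R) -lee_fin; apply: le_trans gt (pp _ _ _).
by rewrite mulnC leq_mul2l (leq_trans sz) ?orbT // leqnSn.
Qed.

(** * Payments bounded by a power of the input size *)

Section Payments.
Variables (m n M : nat).
Let k := minn (2 * m) n.
Let X := (m + n + M).+1.

Let kX : (k <= X)%N. Proof. by rewrite /k /X; clear; lia. Qed.
Let MX : (M <= X)%N. Proof. by rewrite /X; clear; lia. Qed.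
Let kkX : (k * k <= X ^ 2)%N. Proof. by rewrite -mulnn leq_mul. Qed.

Lemma payment_le j x : (j <= 3)%N -> (x <= 5 * X ^ j)%N -> (k * k * x <= 5 * X ^ 5)%N.
Proof.
move=> j3 xX; apply: leq_trans (leq_mul kkX xX) _; rewrite mulnCA leq_mul2l /=.
by rewrite -expnD leq_pexp2l // -[5%N]/(2 + 3)%N leq_add2l.
Qed.

Lemma payment_general : (k ^ 2 * (M + 4 * M * k ^ 2) <= 5 * X ^ 5)%N.
Proof.
rewrite -mulnn (@payment_le 3) //.
have h1 : (M * (k * k) <= X ^ 3)%N by rewrite expnS leq_mul.
have h2 : (M <= X ^ 3)%N by apply: leq_trans MX _; rewrite -{1}[X]expn1 leq_pexp2l.
by move: h1 h2; clear; nia.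
Qed.

Lemma payment_no_bottom_col : (k ^ 2 * (M + 4 * M * k) <= 5 * X ^ 5)%N.
Proof.
rewrite -mulnn (@payment_le 2) //.
have h1 : (M * k <= X ^ 2)%N by rewrite -mulnn leq_mul.
have h2 : (M <= X ^ 2)%N by apply: leq_trans MX _; rewrite -{1}[X]expn1 leq_pexp2l.
by move: h1 h2; clear; nia.
Qed.

Lemma payment_finite : (3 * M * k ^ 2 <= 5 * X ^ 5)%N.
Proof.
rewrite -mulnn mulnC (@payment_le 1) // expn1.
by move: MX; clear; lia.
Qed.

End Payments.

Lemma log_le M : (trunc_log 2 M <= M)%N.
Proof.
case: M => // M; have /andP[le _] := trunc_log_bounds (ltnSn 1) (ltn0Sn M).
by apply: leq_trans le; apply: ltnW; apply: ltn_expl.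
Qed.

Lemma polynomial_bound c c0 d0 X S M1 calls : (0 < X)%N -> (S <= X)%N ->
  (M1 <= 8 * X ^ 5)%N -> (calls <= 18 * X ^ 7)%N ->
  ((c * S ^ 6 + c0 * M1 ^ d0) * calls.+1 <=
    (c + c0 * 8 ^ d0) * 19 * X ^ (6 + 5 * d0 + 7))%N.
Proof.
move=> X0 SX MX cX; have p j : (0 < X ^ j)%N by rewrite expn_gt0 X0.
have h1 : (c * S ^ 6 <= c * X ^ (6 + 5 * d0))%N.
  rewrite leq_mul2l; apply/orP; right; apply: (@leq_trans (X ^ 6)); first by rewrite leq_exp2r.
  by rewrite leq_pexp2l // leq_addr.
have h2 : (c0 * M1 ^ d0 <= c0 * 8 ^ d0 * X ^ (6 + 5 * d0))%N.
  rewrite -mulnA leq_mul2l; apply/orP; right; apply: (@leq_trans ((8 * X ^ 5) ^ d0)).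
    by case: (d0) => // d; rewrite leq_exp2r.
  by rewrite expnMn -expnM leq_mul2l leq_pexp2l ?orbT // leq_addl.
have h3 : (calls.+1 <= 19 * X ^ 7)%N by move: cX (p 7%N); clear; lia.
apply: leq_trans (leq_mul (leq_add h1 h2) h3) _.
by rewrite -mulnDl mulnACA -expnD.
Qed.

Local Open Scope ereal_scope.

Theorem theorem7 (R : realType) :
  (exists (prog : cmd) (C c d : nat), forall O : oracle, oracle_correct R O ->
    (forall (m n M : nat) (A B : 'M[option int]_(m, n)),
      admissible M A B ->
      let k := minn (2 * m) n in
      reconstructs_within O prog A B
        ((C%:R : R)%:E * Delta (mx_real R A) (mx_real R B) *
           ((k ^ 6)%N%:R : R)%:E)
        (k ^ 2 * (M + 4 * M * k ^ 2))
        (c * (m + n + trunc_log 2 M).+1 ^ d))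
    /\
    (pseudo_polynomial R O ->
      exists c' d' : nat,
        forall (m n M : nat) (A B : 'M[option int]_(m, n)),
        admissible M A B ->
        reconstructs_in_time R O prog A B (c' * (m + n + M).+1 ^ d')))
  /\
  (exists (prog : cmd) (C c d : nat), forall O : oracle, oracle_correct R O ->
    forall (m n M : nat) (A B : 'M[option int]_(m, n)),
      admissible M A B -> no_bottom_col A -> no_bottom_col B ->
      let k := minn (2 * m) n in
      reconstructs_within O prog A B
        ((C%:R : R)%:E * Delta (mx_real R A) (mx_real R B) *
           ((k ^ 5)%N%:R : R)%:E)
        (k ^ 2 * (M + 4 * M * k))
        (c * (m + n + trunc_log 2 M).+1 ^ d))
  /\
  (exists (prog : cmd) (C c d : nat), forall O : oracle, oracle_correct R O ->
    forall (m n M : nat) (A B : 'M[option int]_(m, n)),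
      admissible M A B -> all_finite A -> all_finite B ->
      let k := minn (2 * m) n in
      reconstructs_within O prog A B
        ((C%:R : R)%:E *
           (Cup (mx_real R A) (mx_real R B) -
            Clow (mx_real R A) (mx_real R B)) *
           ((k ^ 4)%N%:R : R)%:E)
        (3 * M * k ^ 2)
        (c * (m + n + trunc_log 2 M).+1 ^ d)).
Proof.
have [c Hc] := work_log.
have general O m n M (A B : 'M[option int]_(m, n)) : oracle_correct R O -> admissible M A B ->
    exists low up, gap_range A B low up /\
    outcome R O (Reconstruct (DeltaRange (EReg rK))) A B
      (9 * (max_gap low up * minn (2 * m) n ^ 6))
      (minn (2 * m) n ^ 2 * (M + 4 * M * minn (2 * m) n ^ 2))
      (c * (m + n + trunc_log 2 M).+1 ^ 6).
  move=> OP adm; have [low [up gr]] := gap_range_exists O adm; exists low, up; split=> //.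
  have [sf sfP] := spectral_function R adm.
  set k := minn (2 * m) n; have kk : (k ^ 2 = k * k)%N by rewrite -mulnn.
  have -> : (max_gap low up * k ^ 6 = max_gap low up * (k * k) * k ^ 4)%N.
    by rewrite -kk -mulnA -expnD.
  apply: (outcome_delta OP adm sfP gr) => //; first by rewrite !eqxx.
  - rewrite -kk PoszM; apply: (s_ray sfP); exact: gap_range_row_gap.
  - move=> s' sP'; rewrite -kk PoszM; apply: (s_ray sP'); apply: row_gapC.
    exact: gap_range_row_gap.
  - rewrite -/k kk leq_mul2l; apply/orP; right.
    have : (0 < k * k)%N by case: adm => m0 n0 _ _ _; rewrite muln_gt0 /k leq_min muln_gt0 m0 n0.
    by move: (k * k)%N => K; clear; nia.
  exact: payment_general.
have natE (a b d : nat) : ((a%:R : R)%:E * (b%:R : R)%:E * (d%:R : R)%:E) =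
    ((a * (b * d))%N%:R : R)%:E by rewrite -!EFinM -!natrM mulnA.
split; last split.
(* The three programs differ only in the range that they scan. *)
- exists (Reconstruct (DeltaRange (EReg rK))), 9%N, c, 6%N => O OP; split.
    move=> m n M A B adm k; have [low [up [gr Ho]]] := general O m n M A B OP adm.
    by apply: outcome_within Ho _; rewrite (Delta_value R gr) natE.
  move=> [c0 [d0 pp]]; exists ((c + c0 * 8 ^ d0) * 19)%N, (6 + 5 * d0 + 7)%N.
  move=> m n M A B adm; have [low [up [gr Ho]]] := general O m n M A B OP adm.
  apply: outcome_in_time pp Ho _; apply: polynomial_bound => //.
  + by rewrite ltnS leq_add2l log_le.
  + have := payment_general m n M; set P := (_ * _)%N; set X := (m + n + M).+1 => PX.
    have : (X <= X ^ 5)%N by rewrite -{1}[X]expn1 leq_pexp2l.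
    by move: PX; rewrite {1 3}/X; move: (X ^ 5)%N => z; clear; lia.
  (* As [Delta <= 2 M], the number of calls is at most [18 X ^ 7] with [X = m + n + M + 1]. *)
  have [_ _ _ _ [bA bB]] := adm; have [lM uM] := gap_range_bounded bA bB gr.
  have DM : (max_gap low up <= 2 * M)%N by have := max_gapE (gap_range_le gr); move: lM uM; clear; lia.
  have := leq_mul DM (leqnn (minn (2 * m) n ^ 6)).
  have : (M * minn (2 * m) n ^ 6 <= (m + n + M).+1 ^ 7)%N.
    rewrite [leqRHS]expnS; apply: leq_mul; first by clear; lia.
    by rewrite leq_exp2r //; clear; lia.
  rewrite -mulnA; move: (M * _)%N (max_gap _ _ * _)%N (_ ^ 7)%N => x y z; clear; lia.
- exists (Reconstruct (DeltaRange (EReg rk))), 9%N, c, 6%N => O OP m n M A B adm Acol Bcol k.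
  have [low [up gr]] := gap_range_exists O adm; have [sf sfP] := spectral_function R adm.
  apply: (@outcome_within R O _ m n A B (9 * (max_gap low up * k * k ^ 4))); last first.
    by rewrite (Delta_value R gr) natE -mulnA -expnS.
  have kk : (k ^ 2 = k * k)%N by rewrite -mulnn.
  apply: (outcome_delta OP adm sfP gr) => //; first by rewrite !eqxx orbT.
  + rewrite PoszM; apply: (s_ray_no_bottom_col sfP Bcol); exact: gap_range_row_gap.
  + move=> s' sP'; rewrite PoszM; apply: (s_ray_no_bottom_col sP' Acol); apply: row_gapC.
    exact: gap_range_row_gap.
  + rewrite -/k kk leq_mul2l; apply/orP; right.
    have : (0 < k)%N by case: adm => m0 n0 _ _ _; rewrite /k leq_min muln_gt0 m0 n0.
    by move: (k)%N => K; clear; nia.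
  exact: payment_no_bottom_col.
exists (Reconstruct FiniteRange), 9%N, c, 6%N => O OP m n M A B adm fA fB k.
have [low [up gr]] := gap_range_exists O adm; have [sf sfP] := spectral_function R adm.
apply: (@outcome_within R O _ m n A B (9 * (absz (up - low)%R * k ^ 4))); last first.
  rewrite (Cup_value R gr) (Clow_value R gr) -EFinB -rmorphB /=.
  have -> : (up - low)%R%:~R = (absz (up - low)%R)%:R :> R.
    by rewrite -[RHS]/((absz (up - low)%R)%:Z%:~R) abszE ger0_norm // subr_ge0 (gap_range_le gr).
  by rewrite natE.
apply: (outcome_finite OP adm sfP gr) => //.
  by rewrite -/k -mulnn mulnC [(3 * M)%N]mulnC.
exact: payment_finite.
Qed.
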